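(* Let $k'$ be a number field or a local field, $k/k'$ a separable quadratic extension, possibly split ($k=k'\times k'$), and let $n=m+2r+1$ with $m,r\ge0$. With the notation of the context: (1) There is a natural bijection $$[\mathrm S_n(k')_{\mathrm{reg}}]/\mathbf H(k')\;\overset{\mathbf N}{\longleftrightarrow}\;\coprod_{\beta\in[\mathrm{Her}_m(k/k')^\times]}[\mathrm U_n^\beta(k')_{\mathrm{reg}}]/\mathbf H^\beta(k').$$ (2) The set $\mathrm S_n(k')_{\mathrm{reg}}$ (resp. $\mathrm U_n^\beta(k')_{\mathrm{reg}}$) is non-empty and Zariski open in $\mathrm S_n$ (resp. $\mathrm U_n^\beta$). Moreover, the $\mathbf H$-stabilizer (resp. $\mathbf H^\beta$-stabilizer) of a regular $\zeta$ (resp. $\zeta^\beta$) is trivial.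
   Context: $\tau$ is the nontrivial involution of $k$ fixing $k'$; ${}^{\mathrm t}g$ is the transpose; for an invertible $t$, $t^{\tau,-1}=(t^\tau)^{-1}$. $\mathrm{Her}_m(k/k')^\times=\{\beta\in\mathrm{GL}_m(k):{}^{\mathrm t}\beta^\tau=\beta\}$; $\beta_1,\beta_2$ are similar if $\beta_2={}^{\mathrm t}g^\tau\beta_1g$ for some $g\in\mathrm{GL}_m(k)$, and $[\mathrm{Her}_m(k/k')^\times]$ is the set of similarity classes (choose a representative of each). Fix $\beta_0\in k'^\times$, and for $\beta\in\mathrm{Her}_m(k/k')^\times$ let $\beta'=\mathrm{diag}(\beta,\beta_0)$. Label the coordinates of $k^n$ by $v_1,\dots,v_r,w_1,\dots,w_m,w_0,\check v_r,\dots,\check v_1$, in this order. Groups. $\mathrm S_n$ is the $k'$-variety with $\mathrm S_n(k')=\{s\in\mathrm{GL}_n(k):ss^\tau=\mathbf 1_n\}$. $\mathrm U_n^\beta$ is the unitary group $\{g\in\mathrm{GL}_n(k):{}^{\mathrm t}g^\tau J_\beta g=J_\beta\}$, where $J_\beta$ is the block-antidiagonal matrix with blocks $w_r,\beta',w_r$ and $w_r$ is the $r\times r$ antidiagonal permutation matrix; $\mathrm U_{m+1}^\beta$ and $\mathrm U_m^\beta$ are the unitary groups of $\beta'$ and $\beta$; $\mathrm U_m^\beta\subset\mathrm U_n^\beta$ acts on the coordinates $w_1,\dots,w_m$. $U_{1^r,m+1,1^r}\subset\mathrm{GL}_{n,k}$ is the unipotent radical of the standard block upper triangular parabolic with block sizes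 $1^r,m+1,1^r$. $U'_{1^r,m+1}\subset\mathrm U_n^\beta$ is the unipotent radical of the parabolic subgroup stabilizing the flag $\langle v_1\rangle\subset\langle v_1,v_2\rangle\subset\cdots\subset\langle v_1,\dots,v_r\rangle$. $\mathrm{GL}_m\subset\mathrm{GL}_n$ acts on the coordinates $w_1,\dots,w_m$. $\mathbf H=\mathrm{Res}_{k/k'}(U_{1^r,m+1,1^r})\rtimes\mathrm{GL}_{m,k'}$ acts on the right on $\mathrm S_n$ by $[s](u,g)=g^{-1}u^{-1}su^\tau g$. $\mathbf H^\beta=\{(u_1g,u_2g):u_1,u_2\in U'_{1^r,m+1},\ g\in\mathrm U_m^\beta\}$ acts on the right on $\mathrm U_n^\beta$ by $[x](u_1g,u_2g)=g^{-1}u_1^{-1}xu_2g$. $[\,\cdot\,]/\mathbf H(k')$ and $[\,\cdot\,]/\mathbf H^\beta(k')$ denote sets of orbits of $k'$-points. Regularity. $\zeta\in\mathrm S_n(k')$ (resp. $\zeta\in\mathrm U_n^\beta(k')$) is pre-regular if its stabilizer under $\mathrm{Res}_{k/k'}U_{1^r,m+1,1^r}$ (acting by $u^{-1}\zeta u^\tau$) (resp. under $(U'_{1^r,m+1})^2$, acting by $u_1^{-1}\zeta u_2$) is trivial. In that case its orbit under $U_{1^r,m+1,1^r}(k)$ (resp. $(U'_{1^r,m+1}(k'))^2$) contains a unique element, its normal form, whose only nonzero entries are: a central $(m+1)\times(m+1)$ block $\mathrm{Pr}(\zeta)$ in the coordinates $w_1,\dots,w_m,w_0$ (belonging to $\mathrm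 S_{m+1}(k')$, resp. $\mathrm U_{m+1}^\beta(k')$), $t_i(\zeta)\in k^\times$ in position $(v_i,\check v_i)$ and $t_i(\zeta)^{\tau,-1}$ in position $(\check v_i,v_i)$, $1\le i\le r$. A matrix $\xi\in\mathrm M_{m+1}(k)$ is regular if it is regular semisimple, the vectors $\xi^ie$ ($0\le i\le m$) span $k^{m+1}$, and the row vectors ${}^{\mathrm t}e\,\xi^i$ ($0\le i\le m$) span $\mathrm M_{1,m+1}(k)$, where $e={}^{\mathrm t}[0,\dots,0,1]$. $\zeta$ is regular if it is pre-regular and $\mathrm{Pr}(\zeta)$ is regular; the subscript reg denotes the regular elements, which are stable under $\mathbf H(k')$ (resp. $\mathbf H^\beta(k')$). The natural bijection in (1) is the one for which the orbit of $\zeta$ corresponds to the orbit of $\zeta^\beta$ (they ''match'') exactly when $t_i(\zeta)=t_i(\zeta^\beta)$ for $i=1,\dots,r$ and $\mathrm{Pr}(\zeta)=g^{-1}\mathrm{Pr}(\zeta^\beta)g$ for some $g\in\mathrm{GL}_m(k)$, embedded in $\mathrm{GL}_{m+1}(k)$ as $\mathrm{diag}(g,1)$. *)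

(* Defs.v *)
From HB Require Import structures.
From mathcomp Require Import all_boot all_order all_algebra all_field.
From mathcomp Require Import all_classical topology tvs.

Set Implicit Arguments.
Unset Strict Implicit.
Unset Printing Implicit Defensive.

Import GRing.Theory.
Local Open Scope classical_set_scope.
Local Open Scope ring_scope.

HB.mixin Record TopologicalZmodule_isTopologicalField K
    & TopologicalZmodule K & GRing.Field K := {
  mulf_continuous : continuous (fun x : K * K => x.1 * x.2) ;
  invf_continuous : forall x : K, x != 0 -> continuous_at x (GRing.inv : K -> K)
}.

#[short(type="topologicalFieldType")]
HB.structure Definition TopologicalField :=
  {K of TopologicalZmodule K & GRing.Field K
        & TopologicalZmodule_isTopologicalField K}.

Definition number_field (F : fieldType) : Prop :=
  exists (L : fieldExtType rat) (f : {rmorphism F -> L}), bijective f.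

(* Non-discrete locally compact Hausdorff topological fields: R, C, the finite
   extensions of Q_p, and the F_q((t)). *)
Definition local_field (F : fieldType) : Prop :=
  exists (K : topologicalFieldType) (f : {rmorphism F -> K}),
    [/\ bijective f, hausdorff_space K, locally_compact [set: K]
      & ~ (forall A : set K, open A)].

(* Either a separable quadratic field extension, or the split algebra. *)
Definition separable_quadratic (k' : fieldType) (k : comUnitAlgType k') : Prop :=
  (exists (L : fieldExtType k') (f : {lrmorphism k -> L}),
     [/\ bijective f, \dim {:L} = 2%N & separable 1 {:L}]) \/
  (exists f : {lrmorphism k -> (k'^o * k'^o)%type}, bijective f).

Section Zariski.
Variables (k' : fieldType) (k : comUnitAlgType k') (n : nat).

(* Polynomial functions over k' on M_n(k), regarded as an affine space over k'
   (restriction of scalars): the k'-algebra of functions generated by the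
   k'-linear forms of the entries. *)
Inductive polyfun : ('M[k]_n -> k') -> Prop :=
| polyfun_cst (c : k') : polyfun (fun=> c)
| polyfun_entry (l : {scalar k}) (i j : 'I_n) : polyfun (fun A => l (A i j))
| polyfun_add p q : polyfun p -> polyfun q -> polyfun (fun A => p A + q A)
| polyfun_mul p q : polyfun p -> polyfun q -> polyfun (fun A => p A * q A).

Definition zariski_open (X U : set 'M[k]_n) : Prop :=
  exists2 P : set ('M[k]_n -> k'), P `<=` polyfun
    & U = X `&` [set A | exists2 p, P p & p A != 0].

End Zariski.

Section Groups.
Variables (k' : fieldType) (k : comUnitAlgType k') (tau : {lrmorphism k -> k}).
Local Notation cj := (map_mx tau).

Definition sym_space n : set 'M[k]_n :=
  [set s | s \in unitmx /\ s *m cj s = 1%:M].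

Definition unitary n (J : 'M[k]_n) : set 'M[k]_n :=
  [set g | g \in unitmx /\ (cj g)^T *m J *m g = J].

Definition Her m : set 'M[k]_m :=
  [set b | b \in unitmx /\ (cj b)^T = b].

Arguments sym_space n _ : clear implicits.
Arguments Her m _ : clear implicits.

Definition similar_herm m (b1 b2 : 'M[k]_m) : Prop :=
  exists2 g : 'M[k]_m, g \in unitmx & b2 = (cj g)^T *m b1 *m g.

Definition herm_representatives m (B : set 'M[k]_m) : Prop :=
  B `<=` Her m /\
  forall b, Her m b -> exists! b1, B b1 /\ similar_herm b1 b.

(* diag(g, 1) *)
Definition embed1 m (g : 'M[k]_m) : 'M[k]_(m + 1) := block_mx g 0 0 1%:M.

(* Over k = k' * k' this asks that both components have a separable
   characteristic polynomial. *)
Definition regular_semisimple n (xi : 'M[k]_n) : Prop :=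
  forall (K : fieldType) (f : {rmorphism k -> K}),
    separable_poly (char_poly (map_mx f xi)).

Definition regular_mx m (xi : 'M[k]_(m + 1)) : Prop :=
  let e : 'cV[k]_(m + 1) := delta_mx (rshift m ord0) ord0 in
  [/\ regular_semisimple xi,
      forall v : 'cV[k]_(m + 1), exists c : 'I_(m + 1) -> k,
        v = \sum_i c i *: (xi ^+ i *m e)
    & forall v : 'rV[k]_(m + 1), exists c : 'I_(m + 1) -> k,
        v = \sum_i c i *: (e^T *m xi ^+ i)].

Variables (b0 : k') (m r : nat).

(* The summands are the coordinates v_1 .. v_r, then w_1 .. w_m, w_0, then
   the duals of v_r .. v_1 in this (reversed) order: the dual of v_i has index
   rev_ord i in the last summand. *)
Local Notation n := (r + (m + 1 + r))%N.

(* Block-antidiagonal matrix with blocks A, B, C from top right to bottom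
   left. *)
Definition antidiag_block (A : 'M[k]_r) (B : 'M[k]_(m + 1)) (C : 'M[k]_r) :
    'M[k]_n :=
  block_mx 0 (row_mx 0 A) (col_mx 0 C) (block_mx B 0 0 0).

Definition beta' (b : 'M[k]_m) : 'M[k]_(m + 1) := block_mx b 0 0 (b0%:A)%:M.

Definition w_mx : 'M[k]_r := \matrix_(i, j) (j == rev_ord i)%:R.

Definition unitary_n (b : 'M[k]_m) : set 'M[k]_n :=
  unitary (antidiag_block w_mx (beta' b) w_mx).

Definition embed_n (g : 'M[k]_m) : 'M[k]_n :=
  block_mx 1%:M 0 0 (block_mx (embed1 g) 0 0 1%:M).

(* Index of the block of sizes 1^r, m + 1, 1^r containing a coordinate. *)
Definition blk (i : nat) : nat :=
  if (i < r)%N then i else if (i < r + (m + 1))%N then r else (i - m)%N.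

Definition unip : set 'M[k]_n :=
  [set u | forall i j : 'I_n, ~~ (blk i < blk j)%N -> u i j = (i == j)%:R].

(* With F_i = <v_1, .., v_i>, the coordinate flag
   F_1 < .. < F_r <= F_r^perp < .. < F_1^perp < k^n has blocks 1^r, m + 1, 1^r,
   and the unipotent radical of the stabilizer of F_1 < .. < F_r in the unitary
   group consists of the elements acting trivially on its graded pieces. *)
Definition unip' (b : 'M[k]_m) : set 'M[k]_n := unitary_n b `&` unip.

Definition H_S : set ('M[k]_n * 'M[k']_m) := unip `*` [set g | g \in unitmx].

Definition act_S (s : 'M[k]_n) (h : 'M[k]_n * 'M[k']_m) : 'M[k]_n :=
  let g := embed_n (map_mx (in_alg k) h.2) in
  invmx g *m invmx h.1 *m s *m cj h.1 *m g.

Definition orbit_S (s : 'M[k]_n) : set 'M[k]_n := act_S s @` H_S.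

Definition H_U (b : 'M[k]_m) : set ('M[k]_n * 'M[k]_n) :=
  [set h | exists u1 u2 g, [/\ unip' b u1, unip' b u2, unitary b g
     & h = (u1 *m embed_n g, u2 *m embed_n g)]].

Definition act_U (x : 'M[k]_n) (h : 'M[k]_n * 'M[k]_n) : 'M[k]_n :=
  invmx h.1 *m x *m h.2.

Definition orbit_U (b : 'M[k]_m) (x : 'M[k]_n) : set 'M[k]_n :=
  act_U x @` H_U b.

Definition prereg_S (z : 'M[k]_n) : Prop :=
  sym_space n z /\
  forall u, unip u -> invmx u *m z *m cj u = z -> u = 1%:M.

Definition prereg_U (b : 'M[k]_m) (z : 'M[k]_n) : Prop :=
  unitary_n b z /\
  forall u1 u2, unip' b u1 -> unip' b u2 -> invmx u1 *m z *m u2 = z ->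
    u1 = 1%:M /\ u2 = 1%:M.

(* Entries t_i at (v_i, dual of v_i), (t_i^tau)^-1 at (dual of v_i, v_i), and
   the central block P. *)
Definition normal_mx (t : 'I_r -> k) (P : 'M[k]_(m + 1)) : 'M[k]_n :=
  antidiag_block (\matrix_(i, j) (if j == rev_ord i then t i else 0)) P
    (\matrix_(i, j) (if i == rev_ord j then (tau (t j))^-1 else 0)).

(* [normal_form_S z t P]: the orbit of z contains the normal form with data
   t_i(z) = t i and Pr(z) = P. *)
Definition normal_form_S (z : 'M[k]_n) (t : 'I_r -> k) (P : 'M[k]_(m + 1)) :
    Prop :=
  [/\ forall i, t i \is a GRing.unit, sym_space (m + 1) P
    & exists2 u, unip u & invmx u *m z *m cj u = normal_mx t P].

Definition normal_form_U (b : 'M[k]_m) (z : 'M[k]_n) (t : 'I_r -> k)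
    (P : 'M[k]_(m + 1)) : Prop :=
  [/\ forall i, t i \is a GRing.unit, unitary (beta' b) P
    & exists u1 u2, [/\ unip' b u1, unip' b u2
        & invmx u1 *m z *m u2 = normal_mx t P]].

Definition S_reg : set 'M[k]_n :=
  [set z | prereg_S z /\ exists t P, normal_form_S z t P /\ regular_mx P].

Definition U_reg (b : 'M[k]_m) : set 'M[k]_n :=
  [set z | prereg_U b z /\ exists t P, normal_form_U b z t P /\ regular_mx P].

Definition matches (b : 'M[k]_m) (z zb : 'M[k]_n) : Prop :=
  exists t P tb Pb,
    [/\ normal_form_S z t P, normal_form_U b zb tb Pb,
        forall i, t i = tb i
      & exists2 g : 'M[k]_m, g \in unitmx
          & P = invmx (embed1 g) *m Pb *m embed1 g].

(* [S_n(k')_reg] / H(k') *)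
Definition S_orbits : set (set 'M[k]_n) := orbit_S @` S_reg.

(* The coproduct over b in B of the sets [U_n^b(k')_reg] / H^b(k') *)
Definition U_orbits (B : set 'M[k]_m) : set ('M[k]_m * set 'M[k]_n) :=
  [set p | B p.1 /\ (orbit_U p.1 @` U_reg p.1) p.2].

End Groups.

Arguments sym_space {k' k} tau n _.
Arguments Her {k' k} tau m _.
Arguments unip {k' k} m r _.
Arguments H_S {k' k} m r _.
Arguments S_reg {k' k} tau m r _.
Arguments unitary_n {k' k} tau b0 {m} r b _.
Arguments U_reg {k' k} tau b0 {m} r b _.
Arguments U_orbits {k' k} tau b0 {m} r B _.
Arguments S_orbits {k' k} tau m r _.

(* Main.v *)
Require Import Defs.
From HB Require Import structures.
From mathcomp Require Import all_boot all_order all_algebra all_field.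
From mathcomp Require Import all_classical topology tvs.
From mathcomp Require Import zify.

Set Implicit Arguments.
Unset Strict Implicit.
Unset Printing Implicit Defensive.

Import GRing.Theory.
Local Open Scope classical_set_scope.
Local Open Scope ring_scope.

(** Orbits are classified by normal forms, and normal forms by linear algebra
    around a cyclic vector.

    The elements having a normal form are those of the open cell of the Bruhat
    decomposition, [z = u1 N u2^-1] with [u1], [u2] block unipotent and [N] block
    antidiagonal. Up to the permutation [wrev] this is a block LU decomposition:
    it exists exactly when the leading minors of [wrev z] are units, it is unique
    ([cell_exists], [cell_minors], [cell_unique]), and its factors are rational
    in [z]. The symmetric space and the unitary group are fixed loci of
    involutions that respect this decomposition, so by uniqueness the factors of
    [z] inherit the symmetry of [z]: [N] is a normal form, and [u1], [u2] are as
    the corresponding group action requires ([normal_form_S_exists],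
    [normal_form_U_exists]). Hence orbits correspond to pairs [(t, P)], with the
    central block [P] up to conjugation by the rational points of the linear
    group in one case and by the unitary group of the form in the other
    ([orbit_S_nf], [orbit_U_nf]).

    Regularity of [P] makes the last basis vector [e0] cyclic for [P] and for its
    transpose. Two matrices with the same characteristic polynomial, each with a
    cyclic vector, are intertwined by exactly one matrix carrying one vector to
    the other ([intertw_exists], [intertw_uniq]). All the remaining algebra comes
    from this rigidity.
    - Stabilizers are trivial, since a matrix that commutes with [P] and fixes
      [e0] is the identity.
    - If [P * tau P = 1], then [P] is unitary for [beta' b] exactly when [beta' b]
      intertwines [P] with its transpose and scales [e0] by [b0]. There is one
      such matrix; its uniqueness makes it symmetric and fixed by [tau], so [P]
      determines [b] ([form_exists], [form_unique]).
    - If [Q] is unitary and regular, the intertwiner of [tau Q] with the inverse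
      of [Q] that fixes [e0] is a cocycle in the linear group. Hilbert 90
      trivializes it and conjugates [Q] into the symmetric space ([sym_exists]).
    - Elements of the symmetric space conjugate over [k] are conjugate over [k']
      ([conj_rational]).
    These facts give the bijection.

    Openness: regularity is the invertibility of one polynomial in the entries of
    [P], which are rational functions of [z], and being a unit of [k] is the
    nonvanishing of the norm to [k'] ([zariski_open_cell]).

    Existence of regular elements: the Cayley transform
    [(X - a) (X - tau a)^-1] sends matrices fixed by the relevant semilinear
    involution into the group. These form a [k']-structure on all matrices and
    [k'] is infinite, so a generic one satisfies any condition that some matrix
    over [k] satisfies ([exists_cayley]). *)

(** * Block unipotent matrices and block LU decomposition *)

Section BlockUnipotent.
Variables (R : comUnitRingType) (n : nat) (f : 'I_n -> nat).
Implicit Types A B D L U u v : 'M[R]_n.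

(** Here and below [f i] is the index of the block containing [i]. *)
Definition upU u := forall i j, ~~ (f i < f j)%N -> u i j = (i == j)%:R.
Definition bdiag D := forall i j, f i != f j -> D i j = 0.
Definition shifts d A := forall i j, ~~ (f i + d <= f j)%N -> A i j = 0.

Lemma shifts_add d A B : shifts d A -> shifts d B -> shifts d (A + B).
Proof. by move=> hA hB i j h; rewrite mxE hA // hB // addr0. Qed.

Lemma shifts_mul d e A B :
  shifts d A -> shifts e B -> shifts (d + e) (A *m B).
Proof.
move=> hA hB i j h; rewrite mxE big1 // => l _.
have [h1|/hA->] := boolP (f i + d <= f l)%N; last by rewrite mul0r.
rewrite hB ?mulr0 //; apply: contra h => h2.
by rewrite addnA (leq_trans _ h2) // leq_add2r.
Qed.

Lemma shifts_opp d A : shifts d A -> shifts d (- A).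
Proof. by move=> hA i j h; rewrite mxE hA // oppr0. Qed.

Lemma upUE u : upU u <-> shifts 1 (u - 1%:M).
Proof.
split=> h i j hij.
  by rewrite !mxE h ?subrr // -addn1.
by apply/eqP; rewrite -subr_eq0; move: (h i j); rewrite !mxE addn1 => ->.
Qed.

Lemma upU1 : upU 1%:M.
Proof. by move=> i j _; rewrite mxE. Qed.

Lemma upU_mul u v : upU u -> upU v -> upU (u *m v).
Proof.
move=> /upUE hu /upUE hv; apply/upUE.
have -> : u *m v - 1%:M = (u - 1%:M) *m (v - 1%:M) + ((u - 1%:M) + (v - 1%:M)).
  rewrite -[in LHS](subrK 1%:M u) -[in LHS](subrK 1%:M v).
  by rewrite mulmxDl mulmxDr mulmx1 mul1mx !addrA addrK.
apply: shifts_add; last exact: shifts_add.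
move=> i j h; apply: (shifts_mul hu hv); apply: contra h.
by apply: leq_trans; rewrite leq_add2l.
Qed.

Lemma shifts_exp A i : shifts 1 A -> shifts i (A ^+ i).
Proof.
move=> hA; elim: i => [|i IH]; last by rewrite exprS; exact: (shifts_mul hA IH).
move=> a b; rewrite addn0 expr0 mxE; case: eqVneq => // ->.
by rewrite leqnn.
Qed.

(** With [u = 1 + x], [x] strictly block upper triangular, the inverse of [u]
    is the finite geometric series of [- x]. *)
Lemma upU_inv u : upU u -> u \in unitmx /\ upU (invmx u).
Proof.
move=> /upUE; set x := u - 1%:M => hx.
pose N := (\max_i f i).+1.
have xN0 : (- x) ^+ N = 0.
  apply/matrixP => i j; rewrite (@shifts_exp _ N (shifts_opp hx)) ?mxE //.
  by rewrite -ltnNge ltn_addl // ltnS; apply: leq_bigmax.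
pose y := \sum_(i < N) (- x) ^+ i.
have uy : u *m y = 1%:M.
  have e : - x - 1 = - u by rewrite /x opprB addrAC subrr sub0r.
  have := subrX1 (- x) N; rewrite xN0 sub0r e mulNr => /oppr_inj e1.
  exact: esym e1.
have [uu _] := mulmx1_unit uy; split=> //.
have -> : invmx u = y by rewrite -[y](mulKmx uu) uy mulmx1.
suff hy M : shifts 1 (\sum_(i < M.+1) (- x) ^+ i - 1%:M).
  by apply/upUE; apply: hy.
rewrite big_ord_recl expr0 [1%:M]/(1 : 'M_n) addrAC subrr add0r.
elim/big_ind: _ => [i j _|A B|i _]; [by rewrite mxE| exact: shifts_add|].
move=> a b h; apply: (@shifts_exp _ (lift ord0 i) (shifts_opp hx)).
by apply: contra h; apply: leq_trans; rewrite leq_add2l.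
Qed.

Lemma bdiag_shifts D : bdiag D -> shifts 0 D.
Proof.
move=> hD i j; rewrite addn0 => h; apply: hD.
by apply: contra h => /eqP ->.
Qed.

Lemma upU_conj D D' u : bdiag D -> bdiag D' -> D *m D' = 1%:M ->
  upU u -> upU (D *m u *m D').
Proof.
move=> /bdiag_shifts hD /bdiag_shifts hD' DD' /upUE hu; apply/upUE.
have -> : D *m u *m D' - 1%:M = D *m (u - 1%:M) *m D'.
  by rewrite mulmxBr mulmxBl mulmx1 DD'.
exact: (shifts_mul (shifts_mul hD hu) hD').
Qed.

(** The two sides are block lower, resp. upper, triangular, and their
    block-diagonal parts are [D] and [D']. *)
Lemma LU_unique L U D D' : upU L^T -> upU U -> bdiag D -> bdiag D' ->
  D \in unitmx -> L *m D = D' *m U -> [/\ L = 1%:M, U = 1%:M & D = D'].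
Proof.
move=> hL hU hD hD' uD e.
have eL i j : ~~ (f j < f i)%N -> (L *m D) i j = D i j.
  move=> h; rewrite mxE (bigD1 i) //= big1 ?addr0 => [|l li].
    by have := hL i i; rewrite ltnn mxE eqxx => ->; rewrite ?mul1r.
  have [e1|ne] := eqVneq (f l) (f j); last by rewrite hD // mulr0.
  have := hL l i; rewrite mxE e1 => ->; last by [].
  by rewrite (negPf li) mul0r.
have eU i j : ~~ (f i < f j)%N -> (D' *m U) i j = D' i j.
  move=> h; rewrite mxE (bigD1 j) //= big1 ?addr0 => [|l li].
    by rewrite hU ?ltnn // eqxx mulr1.
  have [e1|ne] := eqVneq (f i) (f l); last by rewrite hD' // mul0r.
  by rewrite hU -?e1 // (negPf li) mulr0.
have DD' : D = D'.
  apply/matrixP => i j; have [e1|ne] := eqVneq (f i) (f j).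
    by rewrite -eL ?e1 ?ltnn // e eU ?e1 ?ltnn.
  by rewrite hD ?hD'.
have LD : L *m D = D.
  apply/matrixP => i j; case: (ltngtP (f i) (f j)) => h.
  - by rewrite eL // -leqNgt ltnW.
  - by rewrite e eU ?DD' // -leqNgt ltnW.
  - by rewrite eL // h ltnn.
split=> //; first by rewrite -(mulmxK uD L) LD mulmxV.
by rewrite -(mulKmx uD U) [in D *m U]DD' -e LD mulVmx.
Qed.

Definition blkproj c : 'M[R]_n := \matrix_(i, j) ((i == j) && (f i < c)%N)%:R.
(** A leading principal block, completed by an identity block so that its size
    does not depend on [c]. *)
Definition corner c A := blkproj c *m A *m blkproj c + (1%:M - blkproj c).

Lemma proj_mull c A i j : (blkproj c *m A) i j = if (f i < c)%N then A i j else 0.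
Proof.
rewrite mxE (bigD1 i) //= big1 => [|l li]; last first.
  by rewrite mxE eq_sym (negPf li) mul0r.
by rewrite mxE eqxx addr0; case: ifP; rewrite ?mul1r ?mul0r.
Qed.

Lemma proj_mulr c A i j : (A *m blkproj c) i j = if (f j < c)%N then A i j else 0.
Proof.
rewrite mxE (bigD1 j) //= big1 => [|l li]; last by rewrite mxE (negPf li) mulr0.
by rewrite mxE eqxx addr0; case: ifP; rewrite ?mulr1 ?mulr0.
Qed.

Lemma proj_tr c : (blkproj c)^T = blkproj c.
Proof. by apply/matrixP=> i j; rewrite !mxE [j == i]eq_sym; case: eqVneq => [->|]. Qed.

Lemma proj_idem c : blkproj c *m blkproj c = blkproj c.
Proof.
by apply/matrixP=> i j; rewrite proj_mull !mxE; case: (f i < c)%N; rewrite ?andbF.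
Qed.

Lemma proj_compl c : blkproj c *m (1%:M - blkproj c) = 0.
Proof. by rewrite mulmxBr mulmx1 proj_idem subrr. Qed.

Lemma compl_proj c : (1%:M - blkproj c) *m blkproj c = 0.
Proof. by rewrite mulmxBl mul1mx proj_idem subrr. Qed.

Lemma compl_idem c : (1%:M - blkproj c) *m (1%:M - blkproj c) = 1%:M - blkproj c.
Proof. by rewrite mulmxBr mulmx1 compl_proj subr0. Qed.

Lemma corner_tr c A : corner c A^T = (corner c A)^T.
Proof.
by rewrite /corner linearD linearB /= !trmx_mul trmx1 proj_tr mulmxA.
Qed.

Lemma corner_mul c A B :
  corner c A *m corner c B = corner c (A *m blkproj c *m B).
Proof.
rewrite /corner; have := compl_proj c; have := proj_compl c.
have := compl_idem c; move: (1%:M - blkproj c) => Q QQ PQ QP.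
rewrite mulmxDl !mulmxDr QQ.
rewrite -[_ *m Q]mulmxA PQ mulmx0 addr0.
rewrite !mulmxA QP !mul0mx add0r.
by rewrite -(mulmxA _ (blkproj c) (blkproj c)) proj_idem.
Qed.

Lemma corner1 c : corner c 1%:M = 1%:M.
Proof. by rewrite /corner mulmx1 proj_idem addrC subrK. Qed.

Lemma lowU_proj c L : upU L^T -> blkproj c *m L *m blkproj c = blkproj c *m L.
Proof.
move=> hL; apply/matrixP => i j; rewrite proj_mulr !proj_mull.
case: ifP => // hj; case: ifP => // hi.
have := hL j i; rewrite mxE => ->.
  by case: eqVneq hj => // ->; rewrite hi.
by rewrite -leqNgt (leq_trans (ltnW hi)) // leqNgt hj.
Qed.

Lemma upU_proj c U : upU U -> blkproj c *m U *m blkproj c = U *m blkproj c.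
Proof.
move=> hU; apply: trmx_inj; rewrite !trmx_mul proj_tr mulmxA.
by apply: lowU_proj; rewrite trmxK.
Qed.

Lemma corner_proj c A B : blkproj c *m A *m blkproj c = blkproj c *m B *m blkproj c ->
  corner c A = corner c B.
Proof. by rewrite /corner => ->. Qed.

Lemma bdiag_proj c D : bdiag D -> blkproj c *m D = D *m blkproj c.
Proof.
move=> hD; apply/matrixP => i j; rewrite proj_mull proj_mulr.
have [->//|ne] := eqVneq (f i) (f j).
by rewrite hD // !if_same.
Qed.

Lemma bdiag_projP D : (forall c, blkproj c *m D = D *m blkproj c) -> bdiag D.
Proof.
move=> h i j; case: ltngtP => // hij _.
  have := congr1 (fun M : 'M_n => M i j) (h (f j)).
  by rewrite proj_mull proj_mulr hij ltnn.
have := congr1 (fun M : 'M_n => M i j) (h (f i)).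
by rewrite proj_mull proj_mulr hij ltnn => <-.
Qed.

Lemma bdiag_inv D : D \in unitmx -> bdiag D -> bdiag (invmx D).
Proof.
move=> u hD; apply: bdiag_projP => c.
by rewrite -[LHS](mulKmx u) [D *m _]mulmxA -(bdiag_proj c hD) mulmxK.
Qed.

Lemma bdiag_mul D D' : bdiag D -> bdiag D' -> bdiag (D *m D').
Proof.
move=> h h'; apply: bdiag_projP => c.
by rewrite mulmxA bdiag_proj // -mulmxA bdiag_proj // mulmxA.
Qed.

(** Necessity of the minor conditions for a block LU decomposition: corners are
    multiplicative along block triangular factors. *)
Lemma LU_corner_unit c L A U : upU L^T -> upU U -> bdiag (L *m A *m U) ->
  L *m A *m U \in unitmx -> corner c A \in unitmx.
Proof.
move=> hL hU hD uD.
have uc : corner c (L *m A *m U) \in unitmx.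
  suff e : corner c (L *m A *m U) *m corner c (invmx (L *m A *m U)) = 1%:M.
    by case: (mulmx1_unit e).
  by rewrite corner_mul -bdiag_proj // -(mulmxA (blkproj c)) mulmxV // mulmx1
     -(corner1 c); apply: corner_proj; rewrite !mulmx1 !proj_idem.
suff e : corner c L *m corner c A *m corner c U = corner c (L *m A *m U).
  by move: uc; rewrite -e !unitmx_mul => /andP[/andP[_ ->]].
rewrite !corner_mul; apply: corner_proj.
rewrite !mulmxA lowU_proj // -!mulmxA; congr (_ *m (_ *m (_ *m _))).
by rewrite mulmxA upU_proj.
Qed.

(** The lower triangular factor in closed form: row [i] subtracts from row [i]
    of [A] the combination of the rows of smaller block index that clears the
    entries of smaller block index. The formula shows that the decomposition is
    a rational function of [A] whose denominators are the leading minors. *)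
Definition elimL A : 'M[R]_n := \matrix_(i, j)
  ((i == j)%:R
   - (A *m blkproj (f i) *m invmx (corner (f i) A) *m blkproj (f i)) i j).
Definition elimU A := (elimL A^T)^T.

Lemma elimL_low A : upU (elimL A)^T.
Proof.
move=> i j h; rewrite 2!mxE proj_mulr eq_sym.
by rewrite (negPf h) subr0.
Qed.

Lemma elimU_up A : upU (elimU A).
Proof. exact: elimL_low. Qed.

Lemma elimL_mulE A B i j : (elimL A *m B) i j =
  B i j - (A *m blkproj (f i) *m invmx (corner (f i) A) *m blkproj (f i) *m B) i j.
Proof.
rewrite mxE [in RHS]mxE (eq_bigr (fun l => (i == l)%:R * B l j -
  (A *m blkproj (f i) *m invmx (corner (f i) A) *m blkproj (f i)) i l * B l j)).
  rewrite sumrB; congr (_ - _); rewrite (bigD1 i) //= eqxx mul1r big1 ?addr0 //.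
  by move=> l; rewrite eq_sym => /negPf ->; rewrite mul0r.
by move=> l _; rewrite mxE mulrBl.
Qed.

Lemma elimL_clear A i j : corner (f i) A \in unitmx -> (f j < f i)%N ->
  (elimL A *m A) i j = 0.
Proof.
move=> u h; rewrite elimL_mulE; set c := f i.
have e : A *m blkproj c *m invmx (corner c A) *m blkproj c *m A *m blkproj c
       = A *m blkproj c.
  have -> : A *m blkproj c *m invmx (corner c A) *m blkproj c *m A *m blkproj c
     = A *m blkproj c *m (invmx (corner c A) *m (blkproj c *m A *m blkproj c)).
    by rewrite !mulmxA.
  have -> : blkproj c *m A *m blkproj c = corner c A *m blkproj c.
    by rewrite /corner mulmxDl compl_proj addr0 -(mulmxA _ (blkproj c) (blkproj c))
       proj_idem.
  by rewrite mulKmx // -mulmxA proj_idem.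
have := congr1 (fun M : 'M_n => M i j) e; rewrite 2!proj_mulr h => ->.
by rewrite subrr.
Qed.

Lemma elim_bdiag A : (forall i, corner (f i) A \in unitmx) ->
  bdiag (elimL A *m A *m elimU A).
Proof.
move=> u.
have main B i j : (forall i, corner (f i) B \in unitmx) -> (f j < f i)%N ->
    (elimL B *m B *m elimU B) i j = 0.
  move=> uB h; rewrite mxE big1 // => l _.
  have [h1|h1] := ltnP (f l) (f i); first by rewrite elimL_clear // mul0r.
  have hl := leq_trans h h1.
  rewrite elimU_up -?leqNgt; last exact: ltnW.
  by case: eqVneq hl => [->|]; rewrite ?ltnn ?mulr0.
move=> i j; case: ltngtP => // h _; last exact: main.
have <- : (elimL A^T *m A^T *m elimU A^T)^T = elimL A *m A *m elimU A.
  by rewrite !trmx_mul /elimU !trmxK mulmxA.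
by rewrite mxE main // => l; rewrite corner_tr unitmx_tr.
Qed.

End BlockUnipotent.

Lemma upU_map (R S : comUnitRingType) (g : {rmorphism R -> S}) n
  (f : 'I_n -> nat) (u : 'M[R]_n) : upU f u -> upU f (map_mx g u).
Proof. by move=> h i j hij; rewrite mxE h // rmorph_nat. Qed.

(** * Krylov matrices, cyclic vectors and regularity *)

Section Krylov.
Variables (R : comUnitRingType) (n : nat).
Implicit Types (A B C : 'M[R]_n) (e f : 'cV[R]_n) (p : {poly R}).

Lemma trmx_exp A i : (A ^+ i)^T = A^T ^+ i.
Proof.
elim: i => [|i IH]; first by rewrite !expr0 trmx1.
by rewrite exprS exprSr [LHS]trmx_mul IH.
Qed.

Lemma expSmx A i : A ^+ i.+1 = A *m A ^+ i. Proof. exact: exprS. Qed.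

Definition krylov A e : 'M[R]_n := \matrix_(i, j) (A ^+ j *m e) i 0.

Lemma krylov_mul A e (c : 'cV[R]_n) :
  krylov A e *m c = \sum_i c i 0 *: (A ^+ i *m e).
Proof.
apply/matrixP => i j; rewrite ord1 mxE summxE; apply: eq_bigr => l _.
by rewrite !mxE mulrC.
Qed.

Lemma krylov_spanP A e :
  (forall v : 'cV[R]_n, exists c : 'I_n -> R, v = \sum_i c i *: (A ^+ i *m e))
  <-> krylov A e \in unitmx.
Proof.
split=> [h|u v]; last first.
  exists (fun i => (invmx (krylov A e) *m v) i 0).
  by rewrite -krylov_mul mulKVmx.
have [c hc] := fin_all_exists (fun j => h (delta_mx j 0)).
suff /mulmx1_unit [] : krylov A e *m (\matrix_(i, j) c j i) = 1%:M by [].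
apply/matrixP => i j.
have /matrixP /(_ i 0) := hc j; rewrite !mxE summxE eqxx andbT => ->.
by apply: eq_bigr => l _; rewrite !mxE mulrC.
Qed.

Lemma krylov_row_spanP A (v0 : 'rV[R]_n) :
  (forall v : 'rV[R]_n, exists c : 'I_n -> R, v = \sum_i c i *: (v0 *m A ^+ i))
  <-> krylov A^T v0^T \in unitmx.
Proof.
apply: (iff_trans _ (krylov_spanP _ _)); split=> h v.
  have [c hc] := h v^T; exists c; rewrite -[v]trmxK hc linear_sum /=.
  by apply: eq_bigr => i _; rewrite linearZ /= trmx_mul trmx_exp.
have [c hc] := h v^T; exists c; rewrite -[v]trmxK hc linear_sum /=.
by apply: eq_bigr => i _; rewrite linearZ /= trmx_mul trmxK trmx_exp trmxK.
Qed.

(** The evaluation [horner_mx], for sizes such as [m + 1] that are not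
    successors on the nose. *)
Definition evalmx A p : 'M[R]_n := \sum_(i < size p) p`_i *: A ^+ i.

Lemma evalmx_wide A p N : (size p <= N)%N ->
  evalmx A p = \sum_(i < N) p`_i *: A ^+ i.
Proof.
move=> h; rewrite /evalmx (big_ord_widen _ (fun i => p`_i *: A ^+ i) h).
rewrite [RHS](bigID (fun i : 'I_N => (i < size p)%N)) /=.
rewrite [X in _ + X]big1 ?addr0 // => i; rewrite -leqNgt => hi.
by rewrite nth_default ?scale0r.
Qed.

End Krylov.

Lemma evalmxE (R : comUnitRingType) n (A : 'M[R]_n.+1) (p : {poly R}) :
  evalmx A p = horner_mx A p.
Proof.
rewrite -[p in RHS]coefK poly_def rmorph_sum; apply: eq_bigr => i _.
by rewrite [RHS]linearZ /= rmorphXn /= horner_mx_X.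
Qed.

Section KrylovTheory.
Variables (R : comUnitRingType) (n : nat).
Implicit Types (A B C : 'M[R]_n) (e f : 'cV[R]_n) (p q : {poly R}).

Lemma mx0_eq (M N : 'M[R]_0) : M = N.
Proof. by apply/matrixP; case. Qed.

Lemma evalmxM A p q : evalmx A (p * q) = evalmx A p *m evalmx A q.
Proof.
by case: n A => [|n'] A; [exact: mx0_eq | rewrite !evalmxE rmorphM].
Qed.

Lemma evalmxD A p q : evalmx A (p + q) = evalmx A p + evalmx A q.
Proof.
by case: n A => [|n'] A; [exact: mx0_eq | rewrite !evalmxE rmorphD].
Qed.

Lemma evalmx1 A : evalmx A 1 = 1%:M.
Proof.
by case: n A => [|n'] A; [exact: mx0_eq | rewrite !evalmxE rmorph1].
Qed.

Lemma evalmx_char A : evalmx A (char_poly A) = 0.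
Proof.
by case: n A => [|n'] A; [exact: mx0_eq | rewrite !evalmxE Cayley_Hamilton].
Qed.

Lemma exp_char A :
  A ^+ n = - \sum_(i < n) (char_poly A)`_i *: A ^+ i.
Proof.
apply/eqP; rewrite -addr_eq0 addrC; apply/eqP; have := evalmx_char A.
rewrite (@evalmx_wide _ _ _ _ n.+1) ?size_char_poly //.
rewrite big_ord_recr /= => {2}<-; congr (_ + _).
have /monicP := char_poly_monic A; rewrite /lead_coef size_char_poly /= => ->.
by rewrite scale1r.
Qed.

Lemma char_poly_intertw A B C : C \in unitmx -> C *m A = B *m C ->
  char_poly A = char_poly B.
Proof.
move=> uC e; rewrite /char_poly /char_poly_mx.
set a := map_mx _ A; set b := map_mx _ B; set c := map_mx (@polyC R) C.
have uc : (\det C)^-1%:P * \det c = 1.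
  by rewrite det_map_mx -polyCM mulVr -?unitmxE.
have e1 : c *m ('X%:M - a) = ('X%:M - b) *m c.
  by rewrite mulmxBr mulmxBl scalar_mxC /a /b /c -!map_mxM e.
have := congr1 determinant e1; rewrite !det_mulmx [RHS]mulrC => e2.
by rewrite -[LHS]mul1r -uc -mulrA e2 mulrA uc mul1r.
Qed.

Lemma char_poly_trmx A : char_poly A^T = char_poly A.
Proof.
rewrite /char_poly -det_tr; congr (\det _); apply/matrixP => i j.
by rewrite !mxE eq_sym.
Qed.

Lemma intertw_exp A B C i : C *m A = B *m C -> C *m A ^+ i = B ^+ i *m C.
Proof.
move=> e; elim: i => [|i IH]; first by rewrite !expr0 mulmx1 mul1mx.
by rewrite !expSmx mulmxA e -!mulmxA IH.
Qed.

Lemma intertw_krylov A B C e : C *m A = B *m C ->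
  C *m krylov A e = krylov B (C *m e).
Proof.
move=> h; apply/matrixP => i j.
rewrite [RHS]mxE mulmxA -(intertw_exp _ h) -mulmxA [in RHS]mxE mxE.
by apply: eq_bigr => l _; rewrite mxE.
Qed.

Lemma intertw_uniq A B C C' e : krylov A e \in unitmx ->
  C *m A = B *m C -> C' *m A = B *m C' -> C *m e = C' *m e -> C = C'.
Proof.
move=> u h h' he; rewrite -(mulmxK u C) (intertw_krylov _ h) he.
by rewrite -(intertw_krylov _ h') mulmxK.
Qed.

Definition companion p : 'M[R]_n :=
  \matrix_(i, j) (if (j.+1 < n)%N then (i == j.+1 :> nat)%:R else - p`_i).

Lemma mul_krylov A e : A *m krylov A e = krylov A e *m companion (char_poly A).
Proof.
apply/matrixP => i j.
have -> : (A *m krylov A e) i j = (A ^+ j.+1 *m e) i 0.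
  by rewrite expSmx -mulmxA !mxE; apply: eq_bigr => l _; rewrite mxE.
have [h|h] := boolP (j.+1 < n)%N.
  rewrite [RHS]mxE (bigD1 (Ordinal h)) //= big1 ?addr0 => [|l].
    by rewrite !mxE h eqxx mulr1.
  by rewrite -val_eqE /= => ne; rewrite [companion _ _ _]mxE h (negPf ne) mulr0.
have -> : j.+1 = n by apply/eqP; rewrite eqn_leq ltn_ord leqNgt h.
rewrite exp_char mulNmx mulmx_suml !mxE summxE -sumrN.
apply: eq_bigr => l _; rewrite -scalemxAl mxE [krylov A e i l]mxE.
by rewrite [companion _ _ _]mxE (negPf h) mulrN mulrC.
Qed.

Lemma krylov_col0 A e (h : (0 < n)%N) : krylov A e *m delta_mx (Ordinal h) 0 = e.
Proof.
rewrite -colE; apply/matrixP => i j; rewrite ord1 2!mxE /= expr0.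
by rewrite [_ *m _]mul1mx.
Qed.

(** Both matrices act on their Krylov bases through the companion matrix of the
    common characteristic polynomial. *)
Lemma intertw_exists A B e f : char_poly A = char_poly B ->
  krylov A e \in unitmx -> krylov B f \in unitmx ->
  exists C, [/\ C \in unitmx, C *m A = B *m C & C *m e = f].
Proof.
move=> hp uA uB; exists (krylov B f *m invmx (krylov A e)).
rewrite unitmx_mul unitmx_inv uA uB; split=> //.
  apply: (can_inj (mulmxK uA)).
  rewrite -[LHS]mulmxA mul_krylov -[LHS]mulmxA mulKmx //.
  by rewrite -[RHS]mulmxA mulmxKV // mul_krylov hp.
have [h|] := ltnP 0 n.
  rewrite -{2}(krylov_col0 A e h) -mulmxA mulKmx //; exact: krylov_col0.
move=> hn; apply/matrixP => i; have := ltn_ord i.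
by rewrite ltnNge (leq_trans hn).
Qed.

(** The value at [A] of the derivative of the characteristic polynomial. Its
    determinant replaces the discriminant: unlike a resultant, whose size is
    that of the derivative, it has the same shape in every characteristic and
    commutes with ring morphisms. *)
Definition dchar A : 'M[R]_n :=
  \sum_(i < n) ((char_poly A)^`())`_i *: A ^+ i.

Lemma dcharE A : dchar A = evalmx A (char_poly A)^`().
Proof.
rewrite (@evalmx_wide _ _ _ _ n) // -ltnS -(size_char_poly A) lt_size_deriv //.
exact/monic_neq0/char_poly_monic.
Qed.

(** One polynomial in the entries of [A] whose invertibility is the regularity
    of [A] with respect to [e]. *)
Definition regdet A e : R :=
  \det (dchar A) * \det (krylov A e) * \det (krylov A^T e).

Lemma regdet_unit A e : (regdet A e \is a GRing.unit) =
  [&& dchar A \in unitmx, krylov A e \in unitmx & krylov A^T e \in unitmx].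
Proof. by rewrite /regdet !unitrM -!unitmxE andbA. Qed.

Lemma krylov_annihilator A e p : krylov A e \in unitmx ->
  (size p <= n)%N -> evalmx A p = 0 -> p = 0.
Proof.
move=> u hp h0.
have : krylov A e *m \col_i p`_i = 0.
  rewrite krylov_mul -[RHS](mul0mx _ e) -h0 (evalmx_wide _ hp) mulmx_suml.
  by apply: eq_bigr => i _; rewrite mxE scalemxAl.
move=> /(congr1 (mulmx (invmx (krylov A e)))); rewrite mulKmx // mulmx0.
move=> h; apply/polyP => i; rewrite coef0; have [hi|hi] := ltnP i n.
  by have /matrixP /(_ (Ordinal hi) 0) := h; rewrite !mxE.
by rewrite nth_default // (leq_trans hp).
Qed.

End KrylovTheory.

Section Map.
Variables (R S : comUnitRingType) (g : {rmorphism R -> S}) (n : nat).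

Lemma map_mx_exp (A : 'M[R]_n) i : map_mx g (A ^+ i) = map_mx g A ^+ i.
Proof.
by elim: i => [|i IH]; rewrite ?expr0 ?map_mx1 // !expSmx map_mxM IH.
Qed.

Lemma map_krylov (A : 'M[R]_n) e :
  map_mx g (krylov A e) = krylov (map_mx g A) (map_mx g e).
Proof.
by apply/matrixP => i j; 
  rewrite [LHS]mxE [krylov A e i j]mxE [RHS]mxE -map_mx_exp -map_mxM [RHS]mxE.
Qed.

Lemma map_dchar (A : 'M[R]_n) : map_mx g (dchar A) = dchar (map_mx g A).
Proof.
rewrite /dchar raddf_sum; apply: eq_bigr => i _.
by rewrite /= map_mxZ map_mx_exp -map_char_poly deriv_map coef_map.
Qed.

End Map.

(** For a cyclic matrix no nonzero polynomial of degree less than [n] vanishes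
    at it; so a common factor of the characteristic polynomial and its
    derivative would be invertible at [A] and could be cancelled in the
    Cayley-Hamilton relation. *)
Lemma cyclic_separable (K : fieldType) n (A : 'M[K]_n) e :
  krylov A e \in unitmx ->
  separable_poly (char_poly A) <-> dchar A \in unitmx.
Proof.
move=> u; rewrite dcharE unlock; set p := char_poly A.
have p0 : p != 0 by exact/monic_neq0/char_poly_monic.
split=> [/Bezout_eq1_coprimepP [[v w] /= e1]|hu].
  suff : evalmx A w *m evalmx A p^`() = 1%:M by case/mulmx1_unit.
  rewrite -evalmxM -(evalmx1 A) -e1 evalmxD [evalmx A (v * p)]evalmxM.
  by rewrite evalmx_char mulmx0 add0r.
set d := gcdp p p^`(); rewrite /coprimep -/d.
have d0 : d != 0 by rewrite gcdp_eq0 (negPf p0).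
have hd : p = p %/ d * d by rewrite divpK ?dvdp_gcdl.
have hd' : p^`() = p^`() %/ d * d by rewrite divpK ?dvdp_gcdr.
have ud : evalmx A d \in unitmx.
  by move: hu; rewrite hd' evalmxM unitmx_mul => /andP[].
have h0 : evalmx A (p %/ d) = 0.
  by rewrite -(mulmxK ud (evalmx A _)) -evalmxM -hd evalmx_char mul0mx.
case: (ltngtP (size d) 1) => // [|h1]; first by rewrite ltnS leqn0 size_poly_eq0 (negPf d0).
have /eqP : p %/ d = 0.
  apply: (krylov_annihilator u) => //.
  rewrite size_divp // size_char_poly leq_subLR -add1n leq_add2r.
  by case: (size d) h1 => [|[|m]].
by rewrite divp_eq0 (negPf p0) (negPf d0) /= ltnNge dvdp_leq ?dvdp_gcdl.
Qed.

(** * Quadratic algebras over an infinite field *)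

Definition no_finite_cover (T : eqType) := forall s : seq T, exists x, x \notin s.

Lemma no_finite_cover_inj (T : eqType) (h : nat -> T) :
  injective h -> no_finite_cover T.
Proof.
move=> hi s; have u : uniq (map h (iota 0 (size s).+1)).
  by rewrite map_inj_uniq ?iota_uniq.
have [|/allPn[x _ xs]] := boolP (all (mem s) (map h (iota 0 (size s).+1))).
  by move=> /allP /(uniq_leq_size u); rewrite size_map size_iota ltnn.
by exists x.
Qed.

Lemma number_field_infinite (F : fieldType) : number_field F -> no_finite_cover F.
Proof.
move=> [L [f _]]; apply: (@no_finite_cover_inj _ (fun i => i%:R)) => i j e.
have := congr1 f e; rewrite !rmorph_nat => /eqP.
rewrite -!(rmorph_nat (in_alg L)) (inj_eq (fmorph_inj (in_alg L))) => h.
by apply/eqP; move: h; rewrite Num.Theory.eqr_nat.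
Qed.

(** A finite Hausdorff space is discrete. *)
Lemma local_field_infinite (F : fieldType) : local_field F -> no_finite_cover F.
Proof.
move=> [K [f [[g fK gK] hK _ ndisc]]] s; apply: contrapT => hs.
apply: ndisc => A; rewrite -closedC.
move: (hausdorff_accessible hK) => /accessible_finite_set_closed; apply.
apply: (@sub_finite_set _ _ [set` map f s]); last exact: finite_seq.
move=> x _ /=; rewrite -[x]gK map_f //.
by apply/negPn/negP => h; apply: hs; exists (g x).
Qed.

(** By induction on the degree, dividing out one root of the form [h x] at a
    time. *)
Lemma finite_roots (F K : fieldType) (h : {rmorphism F -> K}) (p : {poly K}) :
  p != 0 -> exists bad : seq F, forall x, x \notin bad -> p.[h x] != 0.
Proof.
have [n] := ubnP (size p); elim: n p => // n IH p hn p0.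
have [[x /eqP px]|hx] := pselect (exists x, p.[h x] == 0); last first.
  by exists [::] => x _; apply/negP => px; apply: hx; exists x.
have /factor_theorem[q e] : root p (h x) by apply/eqP.
have q0 : q != 0 by apply: contra_neq p0 => q0; rewrite e q0 mul0r.
have [|bad hbad] := IH q _ q0.
  by move: hn; rewrite e size_Mmonic ?monicXsubC // size_XsubC addn2.
exists (x :: bad) => y; rewrite inE negb_or => /andP[yx yb].
by rewrite e hornerM hornerXsubC mulf_neq0 ?hbad // subr_eq0 (inj_eq (fmorph_inj h)).
Qed.

Section QuadraticAlgebra.
Variables (k' : fieldType) (k : comUnitAlgType k').

(** A form of the quadratic hypothesis common to its two cases: for a field
    extension both morphisms are the identification with the field, for the
    split algebra they are the two projections. *)
Definition tested_by_fields := exists (K1 K2 : fieldType)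
  (f1 : {rmorphism k -> K1}) (f2 : {rmorphism k -> K2}),
  forall x, x \is a GRing.unit = (f1 x != 0) && (f2 x != 0).

Lemma bij_unit (S : unitRingType) (f : {rmorphism k -> S}) x :
  bijective f -> (x \is a GRing.unit) = (f x \is a GRing.unit).
Proof.
move=> [g fK gK]; apply/idP/idP => [|u]; first exact: rmorph_unit.
apply/unitrP; exists (g (f x)^-1).
split; apply: (can_inj fK); rewrite rmorphM rmorph1 gK ?mulVr ?divrr //.
Qed.

Lemma quadratic_tested : separable_quadratic k -> tested_by_fields.
Proof.
case=> [[L [f [fb _ _]]]|[f fb]].
  by exists L, L, f, f => x; rewrite andbb (bij_unit _ fb) unitfE.
exists k', k', (@fst k'^o k'^o \o f), (@snd k'^o k'^o \o f) => x.
by rewrite (bij_unit _ fb) -!unitfE.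
Qed.

Variable tau : {lrmorphism k -> k}.
Hypothesis htauK : involutive tau.
Hypothesis htau1 : exists x, tau x != x.

Definition quadratic_basis (a : k) (l1 l2 : {scalar k}) :=
  forall x, x = l1 x *: 1 + l2 x *: a.

(** In the field case any element moved by [tau] generates. In the split case
    [tau] permutes the idempotents of [k' * k'] and fixes [0] and [1]; being
    nontrivial it exchanges the two primitive ones, so [(1, 0)] is suitable. *)
Lemma quadratic_has_basis : separable_quadratic k ->
  exists a l1 l2, quadratic_basis a l1 l2 /\ a - tau a \is a GRing.unit.
Proof.
case=> [[L [f [fb dimL _]]]|[f fb]].
  have [a ha] := htau1.
  have fi : injective f by apply: bij_inj.
  pose X : 2.-tuple L := [tuple 1; f a].
  have hX : basis_of fullv X.
    rewrite basisEfree subvf dimL size_tuple /= andbT.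
    rewrite (perm_free (_ : perm_eq _ [:: f a; 1])) ?(perm_catC [:: 1] [:: f a]) //.
    rewrite free_cons seq1_free oner_neq0 andbT span_seq1.
    apply/negP => /vlineP [c e]; move: ha.
    have -> : a = c%:A by apply: fi; rewrite e linearZ rmorph1.
    by rewrite linearZ rmorph1 eqxx.
  exists a, (coord X ord0 \o f), (coord X (lift ord0 ord0) \o f); split.
    move=> x; apply: fi; rewrite {1}(coord_basis hX (memvf (f x))).
    rewrite 2!big_ord_recl big_ord0 addr0 [RHS]linearD.
    by rewrite [X in _ = X + _]linearZ [X in _ = _ + X]linearZ rmorph1.
  rewrite (bij_unit _ fb) unitfE rmorphB subr_eq0 (inj_eq fi).
  by rewrite eq_sym.
have [g fK gK] := fb.
have ext (p q : (k'^o * k'^o)%type) : p.1 = q.1 -> p.2 = q.2 -> p = q.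
  by case: p q => ? ? [? ?] /= -> ->.
pose a := g (1, 0).
have fa : f a = (1, 0) by rewrite gK.
exists a, (@snd k'^o k'^o \o f), ((@fst k'^o k'^o \o f) \- (@snd k'^o k'^o \o f)).
split.
  move=> x; apply: (can_inj fK); rewrite linearD !linearZ /= rmorph1 fa.
  apply: ext => /=; rewrite /GRing.scale /=.
    by rewrite !mulr1 addrC subrK.
  by rewrite mulr1 mulr0 addr0.
rewrite (bij_unit _ fb) rmorphB /= fa.
have [id1 id2] : (f (tau a)).1 * (f (tau a)).1 = (f (tau a)).1 /\
   (f (tau a)).2 * (f (tau a)).2 = (f (tau a)).2.
  have : f (tau a) * f (tau a) = f (tau a).
    rewrite -!rmorphM; congr (f (tau _)); apply: (can_inj fK).
    by rewrite rmorphM /= fa; apply: ext; rewrite /= ?mulr1 ?mulr0.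
  by case: (f (tau a)) => u v [].
have idem (u : k') : u * u = u -> u = 0 \/ u = 1.
  move=> /eqP; rewrite -subr_eq0 -{3}[u]mulr1 -mulrBr mulf_eq0 subr_eq0.
  by case/orP=> /eqP; [left|right].
have tinj : injective tau by apply: can_inj htauK.
case e: (f (tau a)) id1 id2 => [u v] /= id1 id2.
have no0 : (u, v) <> (0, 0).
  move=> e0; have : tau a = tau 0 by apply: (can_inj fK); rewrite e e0 !rmorph0.
  by move/tinj => a0; have := fa; rewrite a0 rmorph0 => -[/eqP]; rewrite eq_sym oner_eq0.
have no1 : (u, v) <> (1, 1).
  move=> e0; have : tau a = tau 1 by apply: (can_inj fK); rewrite e e0 !rmorph1.
  by move/tinj => a0; have := fa; rewrite a0 rmorph1 => -[/eqP]; rewrite oner_eq0.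
have noa : (u, v) <> (1, 0).
  move=> e0; have ta : tau a = a by apply: (can_inj fK); rewrite e e0 fa.
  have [y] := htau1; rewrite -(fK y); case: (f y) => y1 y2.
  have -> : g (y1, y2) = y2 *: 1 + (y1 - y2) *: a.
    apply: (can_inj fK); rewrite gK linearD !linearZ /= rmorph1 fa; apply: ext => /=.
      by rewrite /GRing.scale /= !mulr1 addrC subrK.
    by rewrite /GRing.scale /= mulr1 mulr0 addr0.
  by rewrite linearD !linearZ /= rmorph1 ta eqxx.
case: (idem _ id1) (idem _ id2) => eu [] ev; rewrite eu ev in no0 no1 noa * => //.
by apply/andP; rewrite /= subr0 sub0r unitrN unitr1.
Qed.

Variables (a : k) (l1 l2 : {scalar k}).
Hypothesis hbas : quadratic_basis a l1 l2.
Hypothesis ua : a - tau a \is a GRing.unit.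

Lemma tau_in_alg c : tau c%:A = c%:A.
Proof. by rewrite linearZ rmorph1. Qed.

Lemma scale_unit_eq0 (c : k') (y : k) : y \is a GRing.unit -> c *: y = 0 -> c = 0.
Proof.
move=> uy e; apply/eqP; apply: contraTT uy => c0.
have -> : y = 0 by rewrite -[y]scale1r -(mulVf c0) -scalerA e scaler0.
by rewrite unitr0.
Qed.

Lemma tau_fixed x : tau x = x -> x = (l1 x)%:A.
Proof.
move=> e; rewrite [LHS]hbas.
have : l2 x *: (a - tau a) = 0.
  rewrite scalerBr -linearZ /=.
  have -> : l2 x *: a = x - (l1 x)%:A by rewrite {2}(hbas x) addrC addKr.
  by rewrite rmorphB /= tau_in_alg e subrr.
by move/(scale_unit_eq0 ua) => ->; rewrite scale0r addr0.
Qed.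

(** The norm of [k] over [k'], in the coordinate of [1]. *)
Definition qnorm (x : k) : k' := l1 (x * tau x).

Lemma qnormE x : (qnorm x)%:A = x * tau x.
Proof. by rewrite -tau_fixed // rmorphM /= htauK mulrC. Qed.

Lemma qnorm_unit x : (x \is a GRing.unit) = (qnorm x != 0).
Proof.
have e : (x \is a GRing.unit) = (x * tau x \is a GRing.unit).
  rewrite unitrM; case: (boolP (x \is a GRing.unit)) => //= u.
  by rewrite rmorph_unit.
rewrite e -qnormE; apply/idP/idP.
  by apply: contraTneq => ->; rewrite scale0r unitr0.
by move=> h; rewrite scaler_unit ?unitr1 // unitfE.
Qed.

Hypothesis htest : tested_by_fields.

Lemma unit_by_fields x :
  (forall (K : fieldType) (f : {rmorphism k -> K}), f x != 0) ->
  x \is a GRing.unit.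
Proof. by have [K1 [K2 [f1 [f2 ->]]]] := htest => h; rewrite !h. Qed.

(** Each of the two field-valued morphisms sends [p] to a nonzero polynomial,
    which has finitely many roots along [k']. *)
Lemma poly_unit_cofinite (p : {poly k}) (x : k) : p.[x] \is a GRing.unit ->
  exists bad : seq k', forall s, s \notin bad -> p.[s%:A] \is a GRing.unit.
Proof.
have [K1 [K2 [f1 [f2 hf]]]] := htest; rewrite hf -!horner_map /= => /andP[h1 h2].
have nz (K : fieldType) (q : {poly K}) (y : K) : q.[y] != 0 -> q != 0.
  by apply: contraNneq => ->; rewrite horner0.
have [bad1 hb1] := finite_roots (f1 \o in_alg k) (nz _ _ _ h1).
have [bad2 hb2] := finite_roots (f2 \o in_alg k) (nz _ _ _ h2).
exists (bad1 ++ bad2) => s; rewrite mem_cat negb_or => /andP[s1 s2].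
by rewrite hf -!horner_map /= hb1 ?hb2.
Qed.

Hypothesis hinf : no_finite_cover k'.

Lemma poly_unit_point (p q : {poly k}) (x y : k) :
  p.[x] \is a GRing.unit -> q.[y] \is a GRing.unit ->
  exists s : k', p.[s%:A] \is a GRing.unit /\ q.[s%:A] \is a GRing.unit.
Proof.
move=> /poly_unit_cofinite[b1 h1] /poly_unit_cofinite[b2 h2].
have [s] := hinf (b1 ++ b2); rewrite mem_cat negb_or => /andP[/h1 ? /h2 ?].
by exists s.
Qed.

End QuadraticAlgebra.

(** * Algebras of functions and Zariski openness *)

(** The functions to which polynomial expressions in matrices are applied occur
    in several guises: polynomial functions on a matrix space, polynomial
    functions of one parameter, and localizations of both. *)
Definition fun_algebra (T : Type) (R : comUnitRingType) (C : set (T -> R)) :=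
  [/\ forall c, C (fun=> c),
      forall F G, C F -> C G -> C (fun t => F t + G t)
    & forall F G, C F -> C G -> C (fun t => F t * G t)].

Section FunAlgebra.
Variables (T : Type) (R : comUnitRingType) (C : set (T -> R)).
Hypothesis hC : fun_algebra C.

Lemma fa_cst c : C (fun=> c). Proof. by case: hC. Qed.
Lemma fa_add F G : C F -> C G -> C (fun t => F t + G t).
Proof. by case: hC => _ h _; apply: h. Qed.
Lemma fa_mul F G : C F -> C G -> C (fun t => F t * G t).
Proof. by case: hC => _ _; apply. Qed.

Lemma fa_ext F G : F =1 G -> C F -> C G.
Proof. by move=> /funext ->. Qed.

Lemma fa_opp F : C F -> C (fun t => - F t).
Proof.
move=> hF; apply: fa_ext (fa_mul (fa_cst (-1)) hF) => t.
by rewrite mulN1r.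
Qed.

Lemma fa_sum I (r : seq I) P (F : I -> T -> R) : (forall i, C (F i)) ->
  C (fun t => \sum_(i <- r | P i) F i t).
Proof.
move=> hF; elim: r => [|i r IH].
  by apply: fa_ext (fa_cst 0) => t; rewrite big_nil.
case: (boolP (P i)) => hi.
  by apply: fa_ext (fa_add (hF i) IH) => t; rewrite big_cons hi.
by apply: fa_ext IH => t; rewrite big_cons (negPf hi).
Qed.

Lemma fa_prod I (r : seq I) P (F : I -> T -> R) : (forall i, C (F i)) ->
  C (fun t => \prod_(i <- r | P i) F i t).
Proof.
move=> hF; elim: r => [|i r IH].
  by apply: fa_ext (fa_cst 1) => t; rewrite big_nil.
case: (boolP (P i)) => hi.
  by apply: fa_ext (fa_mul (hF i) IH) => t; rewrite big_cons hi.
by apply: fa_ext IH => t; rewrite big_cons (negPf hi).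
Qed.

Definition mxfun m n (X : T -> 'M[R]_(m, n)) :=
  forall i j, C (fun t => X t i j).

Lemma mxfun_ext m n (X Y : T -> 'M[R]_(m, n)) : X =1 Y -> mxfun X -> mxfun Y.
Proof. by move=> /funext ->. Qed.

Lemma mxfun_cst m n (A : 'M[R]_(m, n)) : mxfun (fun=> A).
Proof. by move=> i j; apply: fa_cst. Qed.

Lemma mxfun_add m n (X Y : T -> 'M[R]_(m, n)) : mxfun X -> mxfun Y ->
  mxfun (fun t => X t + Y t).
Proof.
by move=> hX hY i j; apply: fa_ext (fa_add (hX i j) (hY i j)) => t; rewrite mxE.
Qed.

Lemma mxfun_scale m n F (X : T -> 'M[R]_(m, n)) : C F -> mxfun X ->
  mxfun (fun t => F t *: X t).
Proof.
by move=> hF hX i j; apply: fa_ext (fa_mul hF (hX i j)) => t; rewrite mxE.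
Qed.

Lemma mxfun_mul m n p (X : T -> 'M[R]_(m, n)) (Y : T -> 'M[R]_(n, p)) :
  mxfun X -> mxfun Y -> mxfun (fun t => X t *m Y t).
Proof.
move=> hX hY i j.
by apply: fa_ext (fa_sum _ _ (fun l => fa_mul (hX i l) (hY l j))) => t; rewrite mxE.
Qed.

Lemma mxfun_tr m n (X : T -> 'M[R]_(m, n)) : mxfun X -> mxfun (fun t => (X t)^T).
Proof. by move=> hX i j; apply: fa_ext (hX j i) => t; rewrite mxE. Qed.

Lemma mxfun_exp n (X : T -> 'M[R]_n) i : mxfun X -> mxfun (fun t => X t ^+ i).
Proof.
move=> hX; elim: i => [|i IH]; first exact: (mxfun_cst 1).
by apply: mxfun_ext (mxfun_mul hX IH) => t; rewrite expSmx.
Qed.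

Lemma mxfun_sum I (r : seq I) P m n (X : I -> T -> 'M[R]_(m, n)) :
  (forall i, mxfun (X i)) -> mxfun (fun t => \sum_(i <- r | P i) X i t).
Proof.
move=> hX i j; apply: fa_ext (fa_sum r P (fun l => hX l i j)) => t.
by rewrite summxE.
Qed.

Lemma fa_det n (X : T -> 'M[R]_n) : mxfun X -> C (fun t => \det (X t)).
Proof.
move=> hX; apply: fa_sum => s; apply: fa_mul; first exact: fa_cst.
by apply: fa_prod => i; apply: hX.
Qed.

Lemma mxfun_adj n (X : T -> 'M[R]_n) : mxfun X -> mxfun (fun t => \adj (X t)).
Proof.
move=> hX i j; apply: (@fa_ext (fun t => cofactor (X t) j i)).
  by move=> t; rewrite mxE.
apply: fa_mul; first exact: fa_cst.
by apply: fa_det => a b; apply: fa_ext (hX (lift j a) (lift i b)) => t; rewrite !mxE.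
Qed.

Lemma fa_char_poly n (X : T -> 'M[R]_n) i : mxfun X ->
  C (fun t => (char_poly (X t))`_i).
Proof.
move=> hX; pose polyf (P : T -> {poly R}) := forall i, C (fun t => (P t)`_i).
have pf_mul P Q : polyf P -> polyf Q -> polyf (fun t => P t * Q t).
  move=> hP hQ l; pose F (j : 'I_l.+1) t := (P t)`_j * (Q t)`_(l - j).
  apply: (@fa_ext (fun t => \sum_(j < l.+1) F j t)).
    by move=> t; rewrite coefM.
  by apply: fa_sum => j; apply: fa_mul; [apply: hP | apply: hQ].
have pf_cst p : polyf (fun=> p) by move=> l; apply: fa_cst.
have pf_sum I (r : seq I) F : (forall i, polyf (F i)) ->
    polyf (fun t => \sum_(i <- r) F i t).
  move=> h l; apply: fa_ext (fa_sum r xpredT (fun i => h i l)) => t.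
  by rewrite coef_sum.
have pf_prod I (r : seq I) F : (forall i, polyf (F i)) ->
    polyf (fun t => \prod_(i <- r) F i t).
  move=> h; elim: r => [|j r IH] l.
    by apply: fa_ext (pf_cst 1 l) => t; rewrite big_nil.
  by apply: fa_ext (pf_mul _ _ (h j) IH l) => t; rewrite big_cons.
have pf_entry a b : polyf (fun t => char_poly_mx (X t) a b).
  move=> l; pose c := ('X%:M : 'M[{poly R}]_n) a b.
  apply: (@fa_ext (fun t => c`_l + - (X t a b * (l == 0%N)%:R))).
    move=> t; rewrite [in RHS]mxE coefD; congr (_ + _).
    rewrite 2!mxE coefN coefC.
    by case: eqP => _; rewrite ?mulr1 ?mulr0.
  apply: fa_add; first exact: fa_cst.
  by apply/fa_opp/fa_mul; [exact: hX | exact: fa_cst].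
move: i; rewrite -/(polyf _); apply: pf_sum => s; apply: pf_mul.
  exact: pf_cst.
by apply: pf_prod => j; apply: pf_entry.
Qed.

Lemma fa_det_krylov n (X : T -> 'M[R]_n) e : mxfun X ->
  C (fun t => \det (krylov (X t) e)).
Proof.
move=> hX; apply: fa_det => i j.
apply: fa_ext (mxfun_mul (mxfun_exp j hX) (mxfun_cst e) i 0) => t.
by rewrite [in RHS]mxE.
Qed.

Lemma fa_det_dchar n (X : T -> 'M[R]_n) : mxfun X ->
  C (fun t => \det (dchar (X t))).
Proof.
move=> hX; apply/fa_det/mxfun_sum => i; apply: mxfun_scale; last exact: mxfun_exp.
apply: fa_ext (fa_mul (fa_char_poly i.+1 hX) (fa_cst (i.+1)%:R)) => t.
by rewrite coef_deriv mulr_natr.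
Qed.

Lemma fa_regdet n (X : T -> 'M[R]_n) e : mxfun X -> C (fun t => regdet (X t) e).
Proof.
move=> hX; apply: fa_mul; last exact/fa_det_krylov/mxfun_tr.
by apply: fa_mul; [exact: fa_det_dchar | exact: fa_det_krylov].
Qed.

(** The localization of [C] at [q]: two functions are identified when they agree
    where [q] is a unit. *)
Definition localized (q : T -> R) : set (T -> R) :=
  [set F | exists N G, C G /\
     forall t, q t \is a GRing.unit -> G t = F t * q t ^+ N].

Variable q : T -> R.
Hypothesis hq : C q.

Lemma fa_exp N : C (fun t => q t ^+ N).
Proof.
elim: N => [|N IH]; first exact: (fa_cst 1).
by apply: fa_ext (fa_mul hq IH) => t; rewrite exprS.
Qed.

Lemma localized_algebra : fun_algebra (localized q).
Proof.
split.
- by move=> c; exists 0%N, (fun=> c); split=> [|t _]; rewrite ?mulr1 //; apply: fa_cst.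
- move=> F G [N [F' [hF' eF]]] [M [G' [hG' eG]]]; exists (N + M)%N.
  exists (fun t => F' t * q t ^+ M + G' t * q t ^+ N); split.
    by apply: fa_add; apply: fa_mul => //; apply: fa_exp.
  by move=> t u; rewrite eF // eG // -!mulrA -!exprD mulrDl [(M + N)%N]addnC.
- move=> F G [N [F' [hF' eF]]] [M [G' [hG' eG]]]; exists (N + M)%N.
  exists (fun t => F' t * G' t); split; first exact: fa_mul.
  by move=> t u; rewrite eF // eG // exprD mulrACA.
Qed.

Lemma localized_sub F : C F -> localized q F.
Proof. by move=> hF; exists 0%N, F; split=> // t _; rewrite mulr1. Qed.

Lemma localized_ext F G : (forall t, q t \is a GRing.unit -> F t = G t) ->
  localized q F -> localized q G.
Proof.
by move=> e [N [H [hH eH]]]; exists N, H; split=> // t u; rewrite eH // e.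
Qed.

Lemma localized_inv D E : C E -> (forall t, D t * E t = q t) ->
  localized q (fun t => (D t)^-1).
Proof.
move=> hE e; exists 1%N, E; split=> // t; rewrite -e expr1 unitrM => /andP[u _].
by rewrite mulKr.
Qed.

End FunAlgebra.

Lemma mxfun_localized_invmx (T : Type) (R : comUnitRingType) (C : set (T -> R))
  (q : T -> R) n (X : T -> 'M[R]_n) E : fun_algebra C -> C q -> mxfun C X ->
  C E -> (forall t, \det (X t) * E t = q t) ->
  mxfun (localized C q) (fun t => invmx (X t)).
Proof.
move=> hC hq hX hE e i j; have hL := localized_algebra hC hq.
apply: (@localized_ext _ _ C q (fun t => (\det (X t))^-1 * (\adj (X t)) i j)).
  move=> t; rewrite -e unitrM => /andP[u _].
  by rewrite /invmx unitmxE u [RHS]mxE.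
apply: (fa_mul hL); first exact: (localized_inv hE e).
by apply: localized_sub; apply: mxfun_adj.
Qed.

Section BlockElimination.
Variables (T : Type) (R : comUnitRingType) (C : set (T -> R)).
Hypothesis hC : fun_algebra C.
Variables (n : nat) (f : 'I_n -> nat).

Definition minors (A : 'M[R]_n) : R := \prod_i \det (corner f (f i) A).

Lemma minorsP A : minors A \is a GRing.unit <->
  forall i, corner f (f i) A \in unitmx.
Proof.
split=> [h i|h].
  by move: h; rewrite unitmxE /minors (bigD1 i) //= unitrM => /andP[].
by apply: rpred_prod => i _; rewrite -unitmxE.
Qed.

Lemma minors_tr A : minors A^T = minors A.
Proof. by apply: eq_bigr => i _; rewrite corner_tr det_tr. Qed.

Variable X : T -> 'M[R]_n.
Hypothesis hX : mxfun C X.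

Lemma mxfun_corner c : mxfun C (fun t => corner f c (X t)).
Proof.
apply: (mxfun_add hC); last exact: mxfun_cst.
apply: (mxfun_mul hC); last exact: mxfun_cst.
by apply: (mxfun_mul hC) => //; exact: mxfun_cst.
Qed.

Lemma fa_minors : C (fun t => minors (X t)).
Proof. by apply: (fa_prod hC) => i; apply: (fa_det hC); exact: mxfun_corner. Qed.

(** The denominators of [elimL] are the determinants of the corners, which all
    divide [minors]. *)
Lemma mxfun_elimL :
  mxfun (localized C (fun t => minors (X t))) (fun t => elimL f (X t)).
Proof.
have hL := localized_algebra hC fa_minors.
have hXL : mxfun (localized C (fun t => minors (X t))) X.
  by move=> i j; apply: localized_sub.
move=> i j; pose P : 'M[R]_n := blkproj R f (f i).
pose Y t := 1%:M - X t *m P *m invmx (corner f (f i) (X t)) *m P.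
apply: (@fa_ext _ _ _ (fun t => Y t i j)).
  by move=> t; rewrite [RHS]mxE /Y !mxE.
have cst A : mxfun (localized C (fun t => minors (X t))) (fun=> A : 'M[R]_n).
  exact: mxfun_cst.
apply: (mxfun_add hL) => //.
move=> a b; apply: (@fa_ext _ _ _ (fun t => - (X t *m P *m invmx (corner f (f i) (X t)) *m P) a b)).
  by move=> t; rewrite [RHS]mxE.
apply: (fa_opp hL); apply: (mxfun_mul hL) => //; apply: (mxfun_mul hL).
  exact: (mxfun_mul hL).
pose E t := \prod_(l | l != i) \det (corner f (f l) (X t)).
have hE : C E by apply: (fa_prod hC) => l; apply: (fa_det hC); exact: mxfun_corner.
apply: (mxfun_localized_invmx hC fa_minors (mxfun_corner _) hE) => t.
by rewrite /minors [RHS](bigD1 i).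
Qed.

End BlockElimination.

Lemma mxfun_elim (T : Type) (R : comUnitRingType) (C : set (T -> R))
  (n : nat) (f : 'I_n -> nat) (X : T -> 'M[R]_n) :
  fun_algebra C -> mxfun C X ->
  mxfun (localized C (fun t => minors f (X t)))
    (fun t => elimL f (X t) *m X t *m elimU f (X t)).
Proof.
move=> hC hX; have hL := localized_algebra hC (fa_minors hC f hX).
apply: (mxfun_mul hL).
  apply: (mxfun_mul hL); first exact: mxfun_elimL.
  by move=> i j; apply: localized_sub.
apply: mxfun_tr.
have e : (fun t => minors f (X t)) = (fun t => minors f (X t)^T).
  by apply: funext => t; rewrite minors_tr.
by rewrite e; apply: (mxfun_elimL hC); apply: mxfun_tr.
Qed.

Section Polyfun.
Variables (k' : fieldType) (k : comUnitAlgType k') (tau : {lrmorphism k -> k}).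
Hypothesis htauK : involutive tau.
Variables (a : k) (l1 l2 : {scalar k}).
Hypothesis hbas : quadratic_basis a l1 l2.
Hypothesis ua : a - tau a \is a GRing.unit.

(** The [k]-valued polynomial functions, seen through their [k']-coordinates. *)
Definition kpolyfun n : set ('M[k]_n -> k) :=
  [set F | forall l : {scalar k}, polyfun (fun A => l (F A))].

Lemma polyfun_ext n (p q : 'M[k]_n -> k') : p =1 q -> polyfun p -> polyfun q.
Proof. by move=> /funext ->. Qed.

Lemma kpolyfun_algebra n : fun_algebra (@kpolyfun n).
Proof.
split.
- by move=> c l; exact: polyfun_cst.
- move=> F G hF hG l; apply: polyfun_ext (polyfun_add (hF l) (hG l)) => A.
  by rewrite linearD.
- move=> F G hF hG l.
  have cst (c : k') : polyfun (fun _ : 'M[k]_n => c) by apply: polyfun_cst.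
  pose mono (i j : {scalar k}) c := polyfun_mul (polyfun_mul (hF i) (hG j)) (cst c).
  apply: polyfun_ext (polyfun_add
    (polyfun_add (mono l1 l1 (l 1)) (mono l1 l2 (l a)))
    (polyfun_add (mono l2 l1 (l a)) (mono l2 l2 (l (a * a))))) => A.
  rewrite [in RHS](hbas (F A)) [in RHS](hbas (G A)).
  rewrite mulrDl !mulrDr -!scalerAl -!scalerAr !mul1r !mulr1 !scalerA !linearD.
  by rewrite !linearZ.
Qed.

Lemma kpolyfun_tau n F : @kpolyfun n F -> kpolyfun (fun A => tau (F A)).
Proof. by move=> hF l; apply: (hF (l \o tau)). Qed.

Lemma kpolyfun_id n : mxfun (@kpolyfun n) id.
Proof. by move=> i j l; apply: polyfun_entry. Qed.

(** Clearing denominators and taking the norm of [k / k'] turns both conditions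
    into the nonvanishing of one [k']-polynomial. *)
Lemma zariski_open_unit n (X : set 'M[k]_n) q F : kpolyfun q ->
  localized (@kpolyfun n) q F ->
  zariski_open X
    (X `&` [set A | q A \is a GRing.unit /\ F A \is a GRing.unit]).
Proof.
move=> hq [N [G [hG eG]]]; have hC := kpolyfun_algebra n.
exists [set fun A => qnorm tau l1 (G A * q A)].
  move=> _ ->; have h := fa_mul hC hG hq.
  exact: (fa_mul hC h (kpolyfun_tau h) l1).
congr (_ `&` _); apply/seteqP; split=> [A [uq uF]|A [_ ->]] /=.
  exists (fun A => qnorm tau l1 (G A * q A)) => //.
  by rewrite -(qnorm_unit htauK hbas ua) unitrM uq eG // unitrM uF unitrX.
rewrite -(qnorm_unit htauK hbas ua) unitrM => /andP[uG uq]; split=> //.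
by move: uG; rewrite eG // unitrM => /andP[].
Qed.

Definition linefun : set (k -> k) :=
  [set F | exists p : {poly k}, forall s, F s = p.[s]].

Lemma linefun_algebra : fun_algebra linefun.
Proof.
split.
- by move=> c; exists c%:P => s; rewrite hornerC.
- by move=> F G [p hp] [q hq]; exists (p + q) => s; rewrite hornerD hp hq.
- by move=> F G [p hp] [q hq]; exists (p * q) => s; rewrite hornerM hp hq.
Qed.

Lemma mxfun_line m n (A B : 'M[k]_(m, n)) : mxfun linefun (fun s => A + s *: B).
Proof.
move=> i j; exists ((A i j)%:P + (B i j) *: 'X) => s.
by rewrite !mxE !hornerE mulrC.
Qed.

Hypothesis htest : tested_by_fields k.
Hypothesis hinf : no_finite_cover k'.

(** Each condition fails at finitely many points of [k'] only. *)
Lemma linefun_point F G x y : linefun F -> linefun G ->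
  F x \is a GRing.unit -> G y \is a GRing.unit ->
  exists s : k', F s%:A \is a GRing.unit /\ G s%:A \is a GRing.unit.
Proof.
move=> [p hp] [q hq]; rewrite hp hq => up uq.
have [s] := poly_unit_point htest hinf up uq.
by rewrite -hp -hq; exists s.
Qed.

Lemma localized_point q F x : linefun q -> localized linefun q F ->
  q x \is a GRing.unit -> F x \is a GRing.unit ->
  exists s : k', q s%:A \is a GRing.unit /\ F s%:A \is a GRing.unit.
Proof.
move=> hq [N [G [hG eG]]] uq uF.
have uG : G x \is a GRing.unit by rewrite eG // unitrM uF unitrX.
have [s [uqs]] := linefun_point hq hG uq uG.
by rewrite eG // unitrM => /andP[uFs _]; exists s.
Qed.

End Polyfun.

(** * The open cell of the Bruhat decomposition *)

Section Coordinates.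
Variables (k' : fieldType) (k : comUnitAlgType k') (m r : nat).
Local Notation n := (r + (m + 1 + r))%N.
Implicit Types (z u L D N : 'M[k]_n).

(** The coordinates [v_i], then [w_i], then the duals, numbered from the dual of
    [v_r] to that of [v_1]. *)
Definition ix1 (i : 'I_r) : 'I_n := lshift (m + 1 + r) i.
Definition ix2 (i : 'I_(m + 1)) : 'I_n := rshift r (lshift r i).
Definition ix3 (i : 'I_r) : 'I_n := rshift r (rshift (m + 1) i).

Lemma ixP (Q : 'I_n -> Prop) : (forall i, Q (ix1 i)) ->
  (forall i, Q (ix2 i)) -> (forall i, Q (ix3 i)) -> forall i, Q i.
Proof.
move=> h1 h2 h3 i; rewrite -(fintype.splitK i).
case: (fintype.split i) => [j|j] /=; first exact: h1.
by rewrite -(fintype.splitK j); case: (fintype.split j) => [l|l];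
   [exact: h2 | exact: h3].
Qed.

Definition bix (i : 'I_n) : nat := blk m r i.

Lemma bix1 i : bix (ix1 i) = i.
Proof. by rewrite /bix /blk /= ltn_ord. Qed.

Lemma bix2 i : bix (ix2 i) = r.
Proof. by rewrite /bix /blk /= ltnNge leq_addr /= ltn_add2l ltn_ord. Qed.

Lemma bix3 i : bix (ix3 i) = (r + i.+1)%N.
Proof.
rewrite /bix /blk /= ltnNge leq_addr /= ltn_add2l ltnNge leq_addr /=.
by rewrite -addnA addnCA addKn add1n.
Qed.

(** Exchanges each [v_i] with its dual and fixes the middle coordinates. *)
Definition rv (i : 'I_n) : 'I_n := match fintype.split i with
  | inl a => ix3 (rev_ord a)
  | inr b => match fintype.split b with
             | inl c => ix2 c
             | inr d => ix1 (rev_ord d)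
             end
  end.

Lemma rv1 i : rv (ix1 i) = ix3 (rev_ord i).
Proof. by rewrite /rv (unsplitK (inl i)). Qed.
Lemma rv2 i : rv (ix2 i) = ix2 i.
Proof. by rewrite /rv (unsplitK (inr (lshift r i))) (unsplitK (inl i)). Qed.
Lemma rv3 i : rv (ix3 i) = ix1 (rev_ord i).
Proof. by rewrite /rv (unsplitK (inr (rshift (m + 1) i))) (unsplitK (inr i)). Qed.

Lemma rvK : involutive rv.
Proof. by apply: ixP => i; rewrite ?rv1 ?rv2 ?rv3 ?rv1 ?rv2 ?rv3 ?rev_ordK. Qed.

Lemma bix_rv i : (bix (rv i) + bix i = r + r)%N.
Proof.
elim/ixP: i => i; have := ltn_ord i.
- by rewrite rv1 bix1 bix3 /=; lia.
- by rewrite rv2 bix2.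
- by rewrite rv3 bix1 bix3 /=; lia.
Qed.

Lemma bix_rv_lt i j : (bix (rv i) < bix (rv j))%N = (bix j < bix i)%N.
Proof.
by have := bix_rv i; have := bix_rv j; lia.
Qed.


Lemma eq_ix : [/\ injective ix1, injective ix2 & injective ix3].
Proof.
by split=> i j h; apply/val_inj; move: (congr1 val h) => /=; lia.
Qed.

Lemma ix_neq : (forall i j, [/\ (ix1 i == ix2 j) = false & (ix2 j == ix1 i) = false]) /\
  (forall i j, [/\ (ix1 i == ix3 j) = false & (ix3 j == ix1 i) = false]) /\
  (forall i j, [/\ (ix2 i == ix3 j) = false & (ix3 j == ix2 i) = false]).
Proof.
by split; [|split] => i j; split; apply/negbTE/eqP => h;
  have := congr1 val h; have := ltn_ord i; have := ltn_ord j; rewrite /=; lia.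
Qed.

Section AntidiagEntries.
Variables (A : 'M[k]_r) (B : 'M[k]_(m + 1)) (C : 'M[k]_r).
Local Notation J := (antidiag_block A B C).
Lemma anti11 i j : J (ix1 i) (ix1 j) = 0.
Proof. by rewrite /antidiag_block block_mxEul mxE. Qed.
Lemma anti12 i j : J (ix1 i) (ix2 j) = 0.
Proof. by rewrite /antidiag_block block_mxEur row_mxEl mxE. Qed.
Lemma anti13 i j : J (ix1 i) (ix3 j) = A i j.
Proof. by rewrite /antidiag_block block_mxEur row_mxEr. Qed.
Lemma anti21 i j : J (ix2 i) (ix1 j) = 0.
Proof. by rewrite /antidiag_block block_mxEdl col_mxEu mxE. Qed.
Lemma anti22 i j : J (ix2 i) (ix2 j) = B i j.
Proof. by rewrite /antidiag_block block_mxEdr block_mxEul. Qed.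
Lemma anti23 i j : J (ix2 i) (ix3 j) = 0.
Proof. by rewrite /antidiag_block block_mxEdr block_mxEur mxE. Qed.
Lemma anti31 i j : J (ix3 i) (ix1 j) = C i j.
Proof. by rewrite /antidiag_block block_mxEdl col_mxEd. Qed.
Lemma anti32 i j : J (ix3 i) (ix2 j) = 0.
Proof. by rewrite /antidiag_block block_mxEdr block_mxEdl mxE. Qed.
Lemma anti33 i j : J (ix3 i) (ix3 j) = 0.
Proof. by rewrite /antidiag_block block_mxEdr block_mxEdr mxE. Qed.
Definition antiE := (anti11, anti12, anti13, anti21, anti22, anti23, anti31,
  anti32, anti33).
End AntidiagEntries.

Definition wrev : 'M[k]_n := antidiag_block (w_mx k r) 1%:M (w_mx k r).

Lemma wrevE i j : wrev i j = (j == rv i)%:R.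
Proof.
have [h12 [h13 h23]] := ix_neq; have [i1 i2 i3] := eq_ix.
by elim/ixP: i => i; elim/ixP: j => j; rewrite ?rv1 ?rv2 ?rv3 /wrev antiE ?mxE
  ?(inj_eq i1) ?(inj_eq i2) ?(inj_eq i3) //; rewrite ?(h12 _ _).1 ?(h12 _ _).2 
  ?(h13 _ _).1 ?(h13 _ _).2 ?(h23 _ _).1 ?(h23 _ _).2 // 1?eq_sym.
Qed.

Lemma wrev_mull N i j : (wrev *m N) i j = N (rv i) j.
Proof.
rewrite mxE (bigD1 (rv i)) //= wrevE eqxx mul1r big1 ?addr0 // => l h.
by rewrite wrevE (negPf h) mul0r.
Qed.

Lemma wrev_mulr N i j : (N *m wrev) i j = N i (rv j).
Proof.
rewrite mxE (bigD1 (rv j)) //= wrevE rvK eqxx mulr1 big1 ?addr0 // => l h.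
by rewrite wrevE -(inj_eq (can_inj rvK)) rvK eq_sym (negPf h) mulr0.
Qed.

Lemma wrevK : wrev *m wrev = 1%:M.
Proof. by apply/matrixP => i j; rewrite wrev_mull wrevE rvK mxE eq_sym. Qed.

Lemma wrev_unit : wrev \in unitmx.
Proof. by case: (mulmx1_unit wrevK). Qed.

Lemma wrev_mulKmx p (N : 'M[k]_(n, p)) : wrev *m (wrev *m N) = N.
Proof. by rewrite mulmxA wrevK mul1mx. Qed.

Lemma wrev_mulmxK p (N : 'M[k]_(p, n)) : N *m wrev *m wrev = N.
Proof. by rewrite -mulmxA wrevK mulmx1. Qed.

Lemma wrev_tr : wrev^T = wrev.
Proof.
by apply/matrixP => i j; rewrite mxE !wrevE -(inj_eq (can_inj rvK)) rvK eq_sym.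
Qed.

Lemma upU_wrev u : upU bix u^T -> upU bix (wrev *m u *m wrev).
Proof.
move=> h i j hij; rewrite wrev_mulr wrev_mull.
have := h (rv j) (rv i); rewrite mxE bix_rv_lt => -> //.
by rewrite eq_sym (inj_eq (can_inj rvK)).
Qed.

Lemma lowU_wrev u : upU bix u -> upU bix (wrev *m u *m wrev)^T.
Proof.
move=> h; rewrite !trmx_mul wrev_tr mulmxA; apply: upU_wrev.
by rewrite trmxK.
Qed.

(** Block-antidiagonal matrices are the translates by [wrev] of the
    block-diagonal ones. *)
Definition banti N := forall i j, (bix i + bix j != r + r)%N -> N i j = 0.

Lemma banti_bdiag N : banti N <-> bdiag bix (wrev *m N).
Proof.
split=> h i j hij.
  by rewrite wrev_mull h //; apply: contra hij; have := bix_rv i; lia.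
have := h (rv i) j; rewrite wrev_mull rvK; apply.
by apply: contra hij; have := bix_rv i; lia.
Qed.

Lemma banti_tr N : banti N -> banti N^T.
Proof. by move=> h i j hij; rewrite mxE h // addnC. Qed.

Lemma banti_inv N : N \in unitmx -> banti N -> banti (invmx N).
Proof.
move=> u /banti_bdiag h; apply/banti_bdiag.
have h1 : bdiag bix (invmx (wrev *m N)).
  by apply: bdiag_inv => //; rewrite unitmx_mul wrev_unit.
have -> : invmx N = invmx (wrev *m N) *m wrev.
  apply: (can_inj (mulmxK u)); rewrite mulVmx // -mulmxA mulVmx //.
  by rewrite unitmx_mul wrev_unit.
move=> i j hij; rewrite mulmxA wrev_mulr wrev_mull h1 //.
by apply: contra hij; have := bix_rv i; have := bix_rv j; lia.
Qed.

Lemma banti_mul_bdiag N D : banti N -> bdiag bix D -> banti (N *m D).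
Proof.
move=> /banti_bdiag h hD; apply/banti_bdiag.
by rewrite mulmxA; apply: bdiag_mul.
Qed.

Lemma bdiag_mul_banti N D : banti N -> bdiag bix D -> banti (D *m N).
Proof.
move=> hN hD; rewrite -[D *m N]trmxK trmx_mul; apply: banti_tr.
apply: banti_mul_bdiag; first exact: banti_tr.
by move=> i j h; rewrite mxE hD // eq_sym.
Qed.

Lemma banti_wrev N : banti N -> banti (wrev *m N *m wrev).
Proof.
move=> hN i j h; rewrite wrev_mulr wrev_mull hN //.
by apply: contra h; have := bix_rv i; have := bix_rv j; lia.
Qed.

(** After multiplication by [wrev] the left unipotent factors become lower
    triangular, and this is the uniqueness of the block LU decomposition. *)
Lemma cell_unique z u1 u2 v1 v2 N N' : upU bix u1 -> upU bix u2 ->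
  upU bix v1 -> upU bix v2 -> banti N -> banti N' -> N \in unitmx ->
  z *m u2 = u1 *m N -> z *m v2 = v1 *m N' -> [/\ u1 = v1, u2 = v2 & N = N'].
Proof.
move=> hu1 hu2 hv1 hv2 hN hN' uN e1 e2.
have [[a1 b1] [a2 b2] [c1 d1] [c2 d2]] :=
  And4 (upU_inv hu1) (upU_inv hu2) (upU_inv hv1) (upU_inv hv2).
have e : invmx v1 *m u1 *m N = N' *m (invmx v2 *m u2).
  have -> : N' = invmx v1 *m z *m v2 by rewrite -mulmxA e2 mulKmx.
  by rewrite -!mulmxA mulKVmx // e1.
have hL := lowU_wrev (upU_mul d1 hu1); set x := invmx v1 *m u1 in e hL.
have hy := upU_mul d2 hu2; set y := invmx v2 *m u2 in e hy.
have eD : wrev *m x *m wrev *m (wrev *m N) = wrev *m N' *m y.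
  by rewrite mulmxA wrev_mulmxK -mulmxA e mulmxA.
have [|||x1 y1 eN] := LU_unique hL hy _ _ _ eD.
- exact/banti_bdiag.
- exact/banti_bdiag.
- by rewrite unitmx_mul wrev_unit.
split.
- have : x = 1%:M by rewrite -[x](wrev_mulKmx) -[wrev *m x]wrev_mulmxK x1 mul1mx wrevK.
  by move/(congr1 (mulmx v1)); rewrite mulKVmx // mulmx1.
- by move: y1 => /(congr1 (mulmx v2)); rewrite mulKVmx // mulmx1.
- by rewrite -[N]wrev_mulKmx eN wrev_mulKmx.
Qed.

(** The middle factor of the cell decomposition of [z], up to [wrev]. *)
Definition cell_core z : 'M[k]_n :=
  elimL bix (wrev *m z) *m (wrev *m z) *m elimU bix (wrev *m z).

Lemma cell_exists z : minors bix (wrev *m z) \is a GRing.unit ->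
  exists u1 u2, [/\ upU bix u1, upU bix u2, banti (wrev *m cell_core z)
    & z *m u2 = u1 *m (wrev *m cell_core z)].
Proof.
move=> /minorsP h; pose L := elimL bix (wrev *m z).
have hL : upU bix (wrev *m L *m wrev) by apply: upU_wrev; exact: elimL_low.
have [uL hL'] := upU_inv hL.
exists (invmx (wrev *m L *m wrev)), (elimU bix (wrev *m z)); split=> //.
- exact: elimU_up.
- apply/banti_bdiag; rewrite wrev_mulKmx; exact: elim_bdiag.
- apply: (can_inj (mulKmx uL)); rewrite mulKVmx // /cell_core.
  by rewrite -!mulmxA.
Qed.

Lemma cell_minors z u1 u2 N : upU bix u1 -> upU bix u2 -> banti N ->
  N \in unitmx -> z *m u2 = u1 *m N ->
  minors bix (wrev *m z) \is a GRing.unit.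
Proof.
move=> h1 h2 /banti_bdiag hN uN e; have [uu1 h1'] := upU_inv h1.
have eD : wrev *m invmx u1 *m wrev *m (wrev *m z) *m u2 = wrev *m N.
  by rewrite -!mulmxA (wrev_mulKmx (z *m u2)) e mulKmx.
apply/minorsP => i; apply: (@LU_corner_unit _ _ _ _ _ _ u2 (lowU_wrev h1')) => //.
  by rewrite eD.
by rewrite eD unitmx_mul wrev_unit.
Qed.

Definition center z : 'M[k]_(m + 1) := \matrix_(i, j) z (ix2 i) (ix2 j).

Lemma center_wrev z : center (wrev *m z) = center z.
Proof. by apply/matrixP => i j; rewrite [LHS]mxE wrev_mull rv2 mxE. Qed.

Lemma center_anti A B C : center (antidiag_block A B C) = B.
Proof. by apply/matrixP => i j; rewrite mxE antiE. Qed.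

End Coordinates.

(** * Diagonal and antidiagonal block shapes *)

Lemma rmap_unitmx (R S : comUnitRingType) (g : {rmorphism R -> S}) n (A : 'M[R]_n) :
  A \in unitmx -> map_mx g A \in unitmx.
Proof.
move=> u; suff : map_mx g A *m map_mx g (invmx A) = 1%:M by case/mulmx1_unit.
by rewrite -map_mxM mulmxV // map_mx1.
Qed.

Lemma rmap_invmx (R S : comUnitRingType) (g : {rmorphism R -> S}) n (A : 'M[R]_n) :
  A \in unitmx -> map_mx g (invmx A) = invmx (map_mx g A).
Proof.
move=> u; apply: (can_inj (mulmxK (rmap_unitmx g u))).
by rewrite -map_mxM !mulVmx ?map_mx1 ?rmap_unitmx.
Qed.

Lemma conj_mxP (R : comUnitRingType) n (u z v N : 'M[R]_n) : u \in unitmx ->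
  invmx u *m z *m v = N <-> z *m v = u *m N.
Proof.
by move=> uu; rewrite -mulmxA; split=> [<-|->]; rewrite ?mulKVmx ?mulKmx.
Qed.

Section Blocks.
Variables (k' : fieldType) (k : comUnitAlgType k') (m r : nat).
Local Notation n := (r + (m + 1 + r))%N.
Local Notation anti := (@antidiag_block k' k m r).

Definition dblock (A : 'M[k]_r) (B : 'M[k]_(m + 1)) (C : 'M[k]_r) : 'M[k]_n :=
  block_mx A 0 0 (block_mx B 0 0 C).

Definition blockE := (mulmx_block, mul_row_col, mul_col_row, mul_row_block,
  mul_block_col, mul_mx_row, mul_col_mx, mul0mx, mulmx0, add0r, addr0, row_mx0,
  col_mx0, block_mx0).

Lemma anti_anti A B C A' B' C' :
  anti A B C *m anti A' B' C' = dblock (A *m C') (B *m B') (C *m A').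
Proof. by rewrite /antidiag_block /dblock !blockE add_block_mx !blockE. Qed.

Lemma dblock_anti A B C A' B' C' :
  dblock A B C *m anti A' B' C' = anti (A *m A') (B *m B') (C *m C').
Proof. by rewrite /antidiag_block /dblock !blockE. Qed.

Lemma anti_dblock A B C A' B' C' :
  anti A B C *m dblock A' B' C' = anti (A *m C') (B *m B') (C *m A').
Proof. by rewrite /antidiag_block /dblock !blockE. Qed.

Lemma dblock_dblock A B C A' B' C' :
  dblock A B C *m dblock A' B' C' = dblock (A *m A') (B *m B') (C *m C').
Proof. by rewrite /dblock !blockE. Qed.

Lemma dblock1 : dblock 1%:M 1%:M 1%:M = 1%:M.
Proof. by rewrite /dblock -!scalar_mx_block. Qed.

Lemma dblock_inj A B C A' B' C' : dblock A B C = dblock A' B' C' ->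
  [/\ A = A', B = B' & C = C'].
Proof. by move=> /eq_block_mx[-> _ _ /eq_block_mx[-> _ _ ->]]. Qed.

Lemma anti_inj A B C A' B' C' : anti A B C = anti A' B' C' ->
  [/\ A = A', B = B' & C = C'].
Proof.
by move=> /eq_block_mx[_ /eq_row_mx[_ ->] /eq_col_mx[_ ->] /eq_block_mx[-> _ _ _]].
Qed.

Lemma anti_tr A B C : (anti A B C)^T = anti C^T B^T A^T.
Proof.
by rewrite /antidiag_block !(tr_block_mx, tr_row_mx, tr_col_mx, trmx0).
Qed.

Lemma dblock_tr A B C : (dblock A B C)^T = dblock A^T B^T C^T.
Proof. by rewrite /dblock !(tr_block_mx, trmx0). Qed.

Lemma map_anti (g : {rmorphism k -> k}) A B C :
  map_mx g (anti A B C) = anti (map_mx g A) (map_mx g B) (map_mx g C).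
Proof.
by rewrite /antidiag_block !(map_block_mx, map_row_mx, map_col_mx, map_mx0).
Qed.

Lemma map_dblock (g : {rmorphism k -> k}) A B C :
  map_mx g (dblock A B C) = dblock (map_mx g A) (map_mx g B) (map_mx g C).
Proof. by rewrite /dblock !(map_block_mx, map_mx0). Qed.

Lemma dblock_bdiag A B C : is_diag_mx A -> is_diag_mx C ->
  bdiag (@bix m r) (dblock A B C).
Proof.
move=> /is_diag_mxP hA /is_diag_mxP hC i j.
elim/ixP: i => i; elim/ixP: j => j; rewrite ?bix1 ?bix2 ?bix3 /dblock => h.
- by rewrite block_mxEul hA.
- by rewrite block_mxEur mxE.
- by rewrite block_mxEur mxE.
- by rewrite block_mxEdl mxE.
- by rewrite eqxx in h.
- by rewrite block_mxEdr block_mxEur mxE.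
- by rewrite block_mxEdl mxE.
- by rewrite block_mxEdr block_mxEdl mxE.
- by rewrite block_mxEdr block_mxEdr hC //; apply: contra h; lia.
Qed.

Lemma dblock1_bdiag B : bdiag (@bix m r) (dblock 1%:M B 1%:M).
Proof. by apply: dblock_bdiag; apply/is_diag_mxP => i j /negPf h; rewrite mxE -val_eqE h. Qed.

(** Diagonal matrices followed, resp. preceded, by the antidiagonal
    permutation. *)
Definition adL (t : 'I_r -> k) : 'M[k]_r :=
  \matrix_(i, j) (if j == rev_ord i then t i else 0).
Definition adR (c : 'I_r -> k) : 'M[k]_r :=
  \matrix_(i, j) (if i == rev_ord j then c j else 0).

Lemma adL_adR t c : adL t *m adR c = diag_mx (\row_i (t i * c i)).
Proof.
apply/matrixP => i j; rewrite !mxE (bigD1 (rev_ord i)) //= !mxE eqxx.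
rewrite big1 ?addr0 => [|l /negPf h]; last by rewrite !mxE h mul0r.
rewrite (inj_eq rev_ord_inj); case: eqVneq => [->|]; rewrite ?mulr1n ?mulr0 //.
Qed.

Lemma adR_adL t c : adR c *m adL t =
  diag_mx (\row_i (c (rev_ord i) * t (rev_ord i))).
Proof.
apply/matrixP => i j; rewrite !mxE (bigD1 (rev_ord i)) //= !mxE rev_ordK eqxx.
rewrite big1 ?addr0 => [|l h]; last first.
  by rewrite !mxE -(inj_eq rev_ord_inj) rev_ordK eq_sym (negPf h) mul0r.
by rewrite eq_sym; case: eqVneq => [->|]; rewrite ?mulr1n ?mulr0.
Qed.

Lemma diag_adL d t : diag_mx (\row_i d i) *m adL t = adL (fun i => d i * t i).
Proof.
apply/matrixP => i j; rewrite mul_diag_mx !mxE.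
by case: ifP; rewrite ?mulr0.
Qed.

Lemma diag_adR d c : diag_mx (\row_i d i) *m adR c =
  adR (fun i => d (rev_ord i) * c i).
Proof.
apply/matrixP => i j; rewrite mul_diag_mx !mxE.
by case: eqVneq => [->|]; rewrite ?mulr0.
Qed.

Lemma adL_tr t : (adL t)^T = adR t.
Proof. by apply/matrixP => i j; rewrite !mxE. Qed.

Lemma adR_tr t : (adR t)^T = adL t.
Proof. by apply/matrixP => i j; rewrite !mxE. Qed.

Lemma map_adL (g : {rmorphism k -> k}) t : map_mx g (adL t) = adL (g \o t).
Proof. by apply/matrixP => i j; rewrite !mxE; case: ifP; rewrite ?rmorph0. Qed.

Lemma map_adR (g : {rmorphism k -> k}) t : map_mx g (adR t) = adR (g \o t).
Proof. by apply/matrixP => i j; rewrite !mxE; case: ifP; rewrite ?rmorph0. Qed.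

Lemma w_adL : w_mx k r = adL (fun=> 1).
Proof. by apply/matrixP => i j; rewrite !mxE; case: ifP. Qed.

Lemma w_adR : w_mx k r = adR (fun=> 1).
Proof.
apply/matrixP => i j; rewrite !mxE -(inj_eq rev_ord_inj) rev_ordK eq_sym.
by case: ifP.
Qed.

Lemma adL_inj t t' : adL t = adL t' -> t = t'.
Proof.
move=> e; apply: funext => i.
by have /matrixP /(_ i (rev_ord i)) := e; rewrite !mxE eqxx.
Qed.

Lemma diag_row1 (d : 'I_r -> k) :
  diag_mx (\row_i d i) = 1%:M <-> forall i, d i = 1.
Proof.
split=> [e i|e]; first by have /matrixP /(_ i i) := e; rewrite !mxE eqxx.
by apply/matrixP => i j; rewrite !mxE e.
Qed.

Lemma banti_shape (N : 'M[k]_n) : banti N ->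
  exists t c, N = anti (adL t) (center N) (adR c).
Proof.
move=> h; exists (fun i => N (ix1 m i) (ix3 m (rev_ord i))).
exists (fun i => N (ix3 m (rev_ord i)) (ix1 m i)).
apply/matrixP => i j; elim/ixP: i => i; elim/ixP: j => j; rewrite antiE ?mxE //;
 try (by apply: h; rewrite ?bix1 ?bix2 ?bix3; have := ltn_ord i;
      have := ltn_ord j; lia).
  case: eqVneq => [->//|ne]; apply: h; rewrite bix1 bix3.
  by apply: contra ne => /eqP e; apply/eqP/val_inj => /=; have := ltn_ord i; lia.
case: eqVneq => [->//|ne]; apply: h; rewrite bix1 bix3.
by apply: contra ne => /eqP e; apply/eqP/val_inj => /=; have := ltn_ord j; lia.
Qed.

Lemma anti_banti t B c : banti (anti (adL t) B (adR c)).
Proof.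
move=> i j; elim/ixP: i => i; elim/ixP: j => j;
  rewrite ?bix1 ?bix2 ?bix3 antiE ?mxE //.
- by move=> h; case: eqP => // e; move: h; rewrite e /=; have := ltn_ord i; lia.
- by lia.
- by move=> h; case: eqP => // e; move: h; rewrite e /=; have := ltn_ord j; lia.
Qed.

End Blocks.

(** * Antidiagonal elements of the two groups *)

Section NormalForms.
Variables (k' : fieldType) (k : comUnitAlgType k') (tau : {lrmorphism k -> k}).
Hypothesis htauK : involutive tau.
Variables (b0 : k') (m r : nat).
Local Notation n := (r + (m + 1 + r))%N.
Local Notation anti := (@antidiag_block k' k m r).
Local Notation cj := (map_mx tau).
Local Notation bix := (@bix m r).
Local Notation wrev := (wrev k m r).
Implicit Types (t c : 'I_r -> k) (P : 'M[k]_(m + 1)) (z u N : 'M[k]_n).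

Lemma cjK p q (A : 'M[k]_(p, q)) : cj (cj A) = A.
Proof. by apply/matrixP => i j; rewrite !mxE htauK. Qed.

Lemma normal_mxE t P :
  normal_mx tau t P = anti (adL t) P (adR (fun i => (tau (t i))^-1)).
Proof. by []. Qed.

Lemma normal_mx_inj t t' P P' : normal_mx tau t P = normal_mx tau t' P' ->
  t = t' /\ P = P'.
Proof. by rewrite !normal_mxE => /anti_inj[/adL_inj -> -> _]. Qed.

Lemma banti_normal t P : banti (normal_mx tau t P).
Proof. exact: anti_banti. Qed.

Lemma normal_mx_unit t P : (forall i, t i \is a GRing.unit) -> P \in unitmx ->
  normal_mx tau t P \in unitmx.
Proof.
move=> ut uP; suff : normal_mx tau t P *m
  anti (adL (tau \o t)) (invmx P) (adR (fun i => (t i)^-1)) = 1%:M.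
  by case/mulmx1_unit.
rewrite normal_mxE anti_anti mulmxV // adL_adR adR_adL -dblock1.
congr dblock; apply/diag_row1 => i /=; first exact: divrr.
by rewrite mulVr ?rmorph_unit.
Qed.

Lemma center_normal t P : center (normal_mx tau t P) = P.
Proof. exact: center_anti. Qed.

(** For matrices of antidiagonal shape both group conditions pair the entry at a
    coordinate with the entry at its dual. *)
Lemma anti_sym t P c : anti (adL t) P (adR c) *m cj (anti (adL t) P (adR c)) = 1%:M
  <-> (forall i, t i * tau (c i) = 1) /\ P *m cj P = 1%:M.
Proof.
rewrite map_anti anti_anti map_adL map_adR adL_adR adR_adL -dblock1; split.
  by move=> /dblock_inj[/diag_row1 h -> _].
move=> [h ->]; congr dblock; apply/diag_row1 => i //=.
by rewrite -[c _]htauK -rmorphM mulrC h rmorph1.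
Qed.

Lemma anti_unitary t P c b :
  (cj (anti (adL t) P (adR c)))^T *m anti (w_mx k r) (beta' b0 b) (w_mx k r)
    *m anti (adL t) P (adR c) = anti (w_mx k r) (beta' b0 b) (w_mx k r)
  <-> (forall i, t i * tau (c i) = 1)
      /\ (cj P)^T *m beta' b0 b *m P = beta' b0 b.
Proof.
rewrite map_anti anti_tr map_adL map_adR adL_tr adR_tr anti_anti dblock_anti.
have -> : adL (tau \o c) *m w_mx k r = diag_mx (\row_i tau (c i)).
  rewrite w_adR adL_adR; congr diag_mx; apply/rowP => i; rewrite !mxE mulr1 //.
have -> : adR (tau \o t) *m w_mx k r = diag_mx (\row_i tau (t (rev_ord i))).
  rewrite w_adL adR_adL; congr diag_mx; apply/rowP => i; rewrite !mxE mulr1 //.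
rewrite diag_adL (diag_adR (fun i => tau (t (rev_ord i)))); split.
  move=> /anti_inj[h -> _]; split=> // i.
  by rewrite mulrC; move: h; rewrite w_adL => /adL_inj /(congr1 (@^~ i)).
move=> [h ->]; rewrite [in RHS]w_adL; congr antidiag_block.
  by congr adL; apply: funext => i; rewrite mulrC h.
rewrite -w_adL w_adR; congr adR; apply: funext => i; rewrite rev_ordK.
by rewrite -[c i]htauK -rmorphM h rmorph1.
Qed.

Lemma dual_entries t c : (forall i, t i * tau (c i) = 1) ->
  (forall i, t i \is a GRing.unit) /\ c = (fun i => (tau (t i))^-1).
Proof.
move=> h; have ut i : t i \is a GRing.unit by apply/unitrPr; exists (tau (c i)).
split=> //; apply: funext => i; rewrite -rmorphV //.
by rewrite -[c i]htauK -[tau (c i)](mulKr (ut i)) h mulr1.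
Qed.

Lemma normal_entries t : (forall i, t i \is a GRing.unit) ->
  forall i, t i * tau (tau (t i))^-1 = 1.
Proof. by move=> ut i; rewrite -rmorphV // htauK divrr. Qed.

(** * Normal forms in the symmetric space *)

Lemma normal_sym t P : (forall i, t i \is a GRing.unit) ->
  sym_space tau (m + 1) P -> sym_space tau n (normal_mx tau t P).
Proof.
move=> ut [uP eP]; split; first exact: normal_mx_unit.
by rewrite normal_mxE; apply/anti_sym; split=> //; apply: normal_entries.
Qed.

Lemma normal_form_SP z t P : normal_form_S tau z t P <->
  [/\ forall i, t i \is a GRing.unit, sym_space tau (m + 1) P
    & exists2 u, upU bix u & z *m cj u = u *m normal_mx tau t P].
Proof.
split=> -[ut sP [u hu e]]; have [uu _] := upU_inv hu; split=> //; exists u => //.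
  exact/(conj_mxP _ _ _ uu).
exact/(conj_mxP _ _ _ uu).
Qed.

(** The involution [z |-> (tau z)^-1] fixes the symmetric space pointwise, so by
    uniqueness it exchanges the two unipotent factors of [z]. *)
Lemma normal_form_S_exists z : sym_space tau n z ->
  minors bix (wrev *m z) \is a GRing.unit ->
  exists t, normal_form_S tau z t (center (cell_core z)).
Proof.
move=> [uz ez] hz; have [u1 [u2 [hu1 hu2 hN e]]] := cell_exists hz.
set N := wrev *m cell_core z in hN e.
have [[uu1 _] [uu2 _]] := (upU_inv hu1, upU_inv hu2).
have uN : N \in unitmx by rewrite -[N](mulKmx uu1) -e !unitmx_mul unitmx_inv uu1 uz.
have ucN := rmap_unitmx tau uN.
have e' : z *m cj u1 = cj u2 *m invmx (cj N).
  apply: (can_inj (mulmxK ucN)); rewrite mulmxKV // -mulmxA -map_mxM -e map_mxM.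
  by rewrite mulmxA ez mul1mx.
have hcN : banti (invmx (cj N)).
  by apply: banti_inv => // i j h; rewrite mxE hN ?rmorph0.
have [_ e2 eN] := cell_unique hu1 hu2 (upU_map tau hu2) (upU_map tau hu1) hN hcN uN e e'.
have [t [c eNs]] := banti_shape hN.
have : N *m cj N = 1%:M by rewrite {1}eN mulVmx.
rewrite eNs => /anti_sym[/dual_entries[ut ec] eP].
exists t; apply/normal_form_SP; split=> //.
  by rewrite -center_wrev -/N; split=> //; case: (mulmx1_unit eP).
exists u1; rewrite // -e2 e; congr (_ *m _).
by rewrite {1}eNs ec -(center_wrev (cell_core z)).
Qed.

Lemma normal_form_S_minors z t P : normal_form_S tau z t P ->
  minors bix (wrev *m z) \is a GRing.unit /\ P = center (cell_core z).
Proof.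
move=> /normal_form_SP[ut [uP sP] [u hu e]]; have uN := normal_mx_unit ut uP.
have h := cell_minors hu (upU_map tau hu) (@banti_normal t P) uN e.
have [u1 [u2 [hu1 hu2 hN e1]]] := cell_exists h; split=> //.
have [_ _ eN] := cell_unique hu (upU_map tau hu) hu1 hu2 (@banti_normal t P) hN uN e e1.
by rewrite -(center_wrev (cell_core z)) -eN center_normal.
Qed.

Lemma normal_form_S_unique z t P t' P' : normal_form_S tau z t P ->
  normal_form_S tau z t' P' -> t = t' /\ P = P'.
Proof.
move=> /normal_form_SP[ut [uP sP] [u hu e]] /normal_form_SP[_ _ [v hv e']].
have [_ _ /normal_mx_inj] := cell_unique hu (upU_map tau hu) hv (upU_map tau hv)
  (@banti_normal t P) (@banti_normal t' P') (normal_mx_unit ut uP) e e'.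
by [].
Qed.

Lemma normal_form_S_prereg z t P : sym_space tau n z ->
  normal_form_S tau z t P -> prereg_S tau z.
Proof.
move=> sz /normal_form_SP[ut [uP sP] [u hu e]]; split=> // v hv.
have [uv _] := upU_inv hv; move/(conj_mxP _ _ _ uv) => ev.
have e' : z *m cj (v *m u) = (v *m u) *m normal_mx tau t P.
  by rewrite map_mxM mulmxA ev -!mulmxA e.
have hvu := upU_mul hv hu; have [uu _] := upU_inv hu.
have [h _ _] := cell_unique hu (upU_map tau hu) hvu (upU_map tau hvu)
  (@banti_normal t P) (@banti_normal t P) (normal_mx_unit ut uP) e e'.
by rewrite -[v](mulmxK uu) -h mulmxV.
Qed.

Lemma S_regP z : S_reg tau m r z <-> sym_space tau n z /\
  exists t P, normal_form_S tau z t P /\ regular_mx P.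
Proof.
split=> [[[sz _] h]|[sz [t [P [h hP]]]]]; first by [].
by split; [exact: normal_form_S_prereg h | exists t, P].
Qed.

Lemma S_reg_cell z : S_reg tau m r z <-> sym_space tau n z /\
  (minors bix (wrev *m z) \is a GRing.unit /\ regular_mx (center (cell_core z))).
Proof.
split=> [/S_regP[sz [t [P [h hP]]]]|[sz [h hP]]].
  by have [um eP] := normal_form_S_minors h; rewrite -eP.
apply/S_regP; split=> //; have [t ht] := normal_form_S_exists sz h.
by exists t, (center (cell_core z)).
Qed.

(** * Normal forms in the unitary groups *)

Variable b : 'M[k]_m.
Hypothesis hb : Her tau m b.
Hypothesis hb0 : b0 != 0.

Local Notation J := (anti (w_mx k r) (beta' b0 b) (w_mx k r)).

Lemma b0_unit : b0%:A \is a @GRing.unit k.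
Proof. by rewrite scaler_unit ?unitr1 // unitfE. Qed.

Lemma beta'_unit : beta' b0 b \in unitmx.
Proof.
have [ub _] := hb; rewrite unitmxE det_lblock unitrM -unitmxE ub.
by rewrite det_scalar expr1 b0_unit.
Qed.

Lemma beta'_herm : (cj (beta' b0 b))^T = beta' b0 b.
Proof.
have [_ eb] := hb.
rewrite /beta' map_block_mx tr_block_mx eb !map_mx0 !trmx0 map_scalar_mx.
by rewrite tr_scalar_mx /= tau_in_alg.
Qed.

Lemma wdblock B : anti (w_mx k r) B (w_mx k r) = wrev *m dblock 1%:M B 1%:M.
Proof. by rewrite anti_dblock !mulmx1 mul1mx. Qed.

Lemma J_unit : J \in unitmx.
Proof.
rewrite wdblock unitmx_mul wrev_unit /=.
suff : dblock 1%:M (beta' b0 b) 1%:M *m dblock 1%:M (invmx (beta' b0 b)) 1%:M = 1%:M :> 'M[k]_n.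
  by case/mulmx1_unit.
by rewrite dblock_dblock !mulmx1 mulmxV ?beta'_unit // dblock1.
Qed.

Lemma normal_unitary t P : (forall i, t i \is a GRing.unit) ->
  unitary tau (beta' b0 b) P -> unitary_n tau b0 r b (normal_mx tau t P).
Proof.
move=> ut [uP eP]; split; first exact: normal_mx_unit.
by rewrite normal_mxE; apply/anti_unitary; split=> //; apply: normal_entries.
Qed.

Lemma normal_form_UP z t P : normal_form_U tau b0 b z t P <->
  [/\ forall i, t i \is a GRing.unit, unitary tau (beta' b0 b) P
    & exists u1 u2, [/\ unip' tau b0 b u1, unip' tau b0 b u2
        & z *m u2 = u1 *m normal_mx tau t P]].
Proof.
split=> -[ut sP [u [u2 [hu hu2 e]]]]; have [uu _] := hu.1; split=> //; exists u, u2;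
  split=> //.
  exact/(conj_mxP _ _ _ uu).
exact/(conj_mxP _ _ _ uu).
Qed.

(** The unitary group is the fixed locus of the involution sending [z] to the
    inverse of the adjoint of [z] for [J]. This involution preserves the
    unipotent group and the antidiagonal shape, because [J] is [wrev] times a
    block-diagonal matrix; hence it fixes the three factors of an element of
    the unitary group. *)
Lemma theta_upU u : upU bix u ->
  exists2 v, upU bix v & (cj u)^T *m J *m v = J.
Proof.
move=> hu; have [uu hu'] := upU_inv hu.
pose B : 'M[k]_n := dblock 1%:M (beta' b0 b) 1%:M.
pose B' : 'M[k]_n := dblock 1%:M (invmx (beta' b0 b)) 1%:M.
have BB' : B *m B' = 1%:M.
  by rewrite dblock_dblock !mulmx1 mulmxV ?beta'_unit // dblock1.
have B'B : B' *m B = 1%:M by apply: mulmx1C.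
pose x := (cj (invmx u))^T.
have ux : (cj u)^T *m x = 1%:M.
  by rewrite -trmx_mul -map_mxM mulVmx // map_mx1 trmx1.
exists (B' *m (wrev *m x *m wrev) *m B).
  apply: upU_conj => //; try exact: dblock1_bdiag.
  by apply: upU_wrev; rewrite trmxK; apply: upU_map.
rewrite wdblock -/B !mulmxA -(mulmxA _ B B') BB' mulmx1 wrev_mulmxK ux.
by rewrite mul1mx.
Qed.

Lemma theta_banti N : banti N -> N \in unitmx ->
  exists2 N', banti N' & (cj N)^T *m J *m N' = J.
Proof.
move=> hN uN; have uNt : (cj N)^T \in unitmx by rewrite unitmx_tr rmap_unitmx.
pose B : 'M[k]_n := dblock 1%:M (beta' b0 b) 1%:M.
pose B' : 'M[k]_n := dblock 1%:M (invmx (beta' b0 b)) 1%:M.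
have BB' : B *m B' = 1%:M.
  by rewrite dblock_dblock !mulmx1 mulmxV ?beta'_unit // dblock1.
exists (B' *m (wrev *m invmx (cj N)^T *m wrev) *m B).
  apply: banti_mul_bdiag; last exact: dblock1_bdiag.
  apply: bdiag_mul_banti; last exact: dblock1_bdiag.
  apply/banti_wrev/banti_inv => //.
  by apply: banti_tr => i j h; rewrite mxE hN // rmorph0.
rewrite wdblock -/B !mulmxA -(mulmxA _ B B') BB' mulmx1 wrev_mulmxK mulmxV //.
by rewrite mul1mx.
Qed.

Lemma normal_form_U_exists z : unitary_n tau b0 r b z ->
  minors bix (wrev *m z) \is a GRing.unit ->
  exists t, normal_form_U tau b0 b z t (center (cell_core z)).
Proof.
move=> [uz ez] hz; have [u1 [u2 [hu1 hu2 hN e]]] := cell_exists hz.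
set N := wrev *m cell_core z in hN e.
have [[uu1 _] [uu2 _]] := (upU_inv hu1, upU_inv hu2).
have uN : N \in unitmx by rewrite -[N](mulKmx uu1) -e !unitmx_mul unitmx_inv uu1 uz.
have [v1 hv1 e1] := theta_upU hu1; have [v2 hv2 e2] := theta_upU hu2.
have [N' hN' eN'] := theta_banti hN uN.
have e' : z *m v2 = v1 *m N'.
  have uM : (cj u2)^T *m (cj z)^T *m J \in unitmx.
    by rewrite !unitmx_mul !unitmx_tr !rmap_unitmx // J_unit.
  apply: (can_inj (mulKmx uM)).
  have -> : (cj u2)^T *m (cj z)^T *m J *m (z *m v2) = J.
    by rewrite mulmxA -2!(mulmxA (cj u2)^T) ez e2.
  by rewrite -trmx_mul -map_mxM e map_mxM trmx_mul -2!(mulmxA (cj N)^T)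
    (mulmxA _ v1) e1 mulmxA eN'.
have [e1' e2' eN] := cell_unique hu1 hu2 hv1 hv2 hN hN' uN e e'.
have [t [c eNs]] := banti_shape hN.
have : (cj N)^T *m J *m N = J by rewrite [X in _ *m X]eN.
rewrite eNs => /anti_unitary[/dual_entries[ut ec] eP].
exists t; apply/normal_form_UP; split=> //.
  rewrite -center_wrev -/N; split=> //.
  have : beta' b0 b \in unitmx := beta'_unit.
  by rewrite -{1}eP unitmx_mul => /andP[].
exists u1, u2; split; [split=> // | split=> // |].
- by split=> //; rewrite {2}e1'.
- by split=> //; rewrite {2}e2'.
- rewrite e; congr (_ *m _).
  by rewrite {1}eNs ec -(center_wrev (cell_core z)).
Qed.

Lemma normal_form_U_minors z t P : normal_form_U tau b0 b z t P ->
  minors bix (wrev *m z) \is a GRing.unit /\ P = center (cell_core z).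
Proof.
move=> /normal_form_UP[ut [uP sP] [u [u' [[_ hu] [_ hu'] e]]]].
have uN := normal_mx_unit ut uP.
have h := cell_minors hu hu' (@banti_normal t P) uN e.
have [u1 [u2 [hu1 hu2 hN e1]]] := cell_exists h; split=> //.
have [_ _ eN] := cell_unique hu hu' hu1 hu2 (@banti_normal t P) hN uN e e1.
by rewrite -(center_wrev (cell_core z)) -eN center_normal.
Qed.

Lemma normal_form_U_unique z t P t' P' : normal_form_U tau b0 b z t P ->
  normal_form_U tau b0 b z t' P' -> t = t' /\ P = P'.
Proof.
move=> /normal_form_UP[ut [uP sP] [u [u' [[_ hu] [_ hu'] e]]]].
move=> /normal_form_UP[_ _ [v [v' [[_ hv] [_ hv'] e']]]].
have [_ _ /normal_mx_inj] := cell_unique hu hu' hv hv'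
  (@banti_normal t P) (@banti_normal t' P') (normal_mx_unit ut uP) e e'.
by [].
Qed.

Lemma normal_form_U_prereg z t P : unitary_n tau b0 r b z ->
  normal_form_U tau b0 b z t P -> prereg_U tau b0 b z.
Proof.
move=> sz /normal_form_UP[ut [uP sP] [u [u' [[_ hu] [_ hu'] e]]]]; split=> //.
move=> v v' [_ hv] [_ hv'].
have [uv _] := upU_inv hv; move/(conj_mxP _ _ _ uv) => ev.
have e' : z *m (v' *m u') = (v *m u) *m normal_mx tau t P.
  by rewrite mulmxA ev -!mulmxA e.
have [[uu _] [uu' _]] := (upU_inv hu, upU_inv hu').
have [h h' _] := cell_unique hu hu' (upU_mul hv hu) (upU_mul hv' hu')
  (@banti_normal t P) (@banti_normal t P) (normal_mx_unit ut uP) e e'.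
by rewrite -[v](mulmxK uu) -[v'](mulmxK uu') -h -h' !mulmxV.
Qed.

Lemma U_regP z : U_reg tau b0 r b z <-> unitary_n tau b0 r b z /\
  exists t P, normal_form_U tau b0 b z t P /\ regular_mx P.
Proof.
split=> [[[sz _] h]|[sz [t [P [h hP]]]]]; first by [].
by split; [exact: normal_form_U_prereg h | exists t, P].
Qed.

Lemma U_reg_cell z : U_reg tau b0 r b z <-> unitary_n tau b0 r b z /\
  (minors bix (wrev *m z) \is a GRing.unit /\ regular_mx (center (cell_core z))).
Proof.
split=> [/U_regP[sz [t [P [h hP]]]]|[sz [h hP]]].
  by have [um eP] := normal_form_U_minors h; rewrite -eP.
apply/U_regP; split=> //; have [t ht] := normal_form_U_exists sz h.
by exists t, (center (cell_core z)).
Qed.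

End NormalForms.

(** * Regular elements and conjugation by the linear group of size m *)

Section Embed1.
Variables (k' : fieldType) (k : comUnitAlgType k') (m : nat).
Implicit Types (g h : 'M[k]_m) (P C : 'M[k]_(m + 1)).

Definition e0 : 'cV[k]_(m + 1) := delta_mx (rshift m ord0) ord0.

Lemma embed1_mul g h : embed1 g *m embed1 h = embed1 (g *m h).
Proof. by rewrite /embed1 mulmx_block !mulmx0 !mul0mx mul1mx !addr0 add0r. Qed.

Lemma embed1_1 : embed1 (1%:M : 'M[k]_m) = 1%:M.
Proof. by rewrite /embed1 -scalar_mx_block. Qed.

Lemma embed1_unit g : (embed1 g \in unitmx) = (g \in unitmx).
Proof. by rewrite !unitmxE det_lblock det1 mulr1. Qed.

Lemma embed1_inv g : g \in unitmx -> invmx (embed1 g) = embed1 (invmx g).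
Proof.
move=> u; have ug : embed1 g \in unitmx by rewrite embed1_unit.
by apply: (can_inj (mulmxK ug)); rewrite mulVmx // embed1_mul mulVmx // embed1_1.
Qed.

Lemma embed1_inj g h : embed1 g = embed1 h -> g = h.
Proof. by move=> /eq_block_mx[]. Qed.

Lemma embed1_tr g : (embed1 g)^T = embed1 g^T.
Proof. by rewrite /embed1 tr_block_mx !trmx0 trmx1. Qed.

Lemma e0E : e0 = col_mx 0 1%:M.
Proof.
apply/matrixP => i j; rewrite ord1 mxE; case: (splitP i) => l e.
  have -> : i = lshift 1 l by apply: val_inj.
  by rewrite col_mxEu mxE eq_lrshift.
have -> : i = rshift m l by apply: val_inj.
by rewrite col_mxEd !ord1 mxE eqxx.
Qed.

Lemma embed1_e0 g : embed1 g *m e0 = e0.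
Proof. by rewrite e0E mul_block_col !mulmx0 mul0mx mul1mx !add0r. Qed.

Lemma fix_e0_embed1 C : C *m e0 = e0 -> C^T *m e0 = e0 -> C = embed1 (ulsubmx C).
Proof.
rewrite -[C]submxK e0E tr_block_mx !mul_block_col !mulmx0 !mulmx1 !add0r.
rewrite block_mxKul => /eq_col_mx[-> ->] /eq_col_mx[e _].
by rewrite /embed1 -[dlsubmx C]trmxK e trmx0.
Qed.

Lemma map_embed1 (S : comUnitAlgType k') (f : {rmorphism k -> S}) g :
  map_mx f (embed1 g) = embed1 (map_mx f g).
Proof. by rewrite /embed1 map_block_mx !map_mx0 map_mx1. Qed.

Hypothesis htest : tested_by_fields k.

(** Units are detected by field-valued morphisms, so separability after every
    base change becomes the invertibility of [dchar P] over [k]. *)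
Lemma regular_mxP P : regular_mx P <-> regdet P e0 \is a GRing.unit.
Proof.
have kryE (K : fieldType) (f : {rmorphism k -> K}) : krylov P e0 \in unitmx ->
    krylov (map_mx f P) (map_mx f e0) \in unitmx.
  by move=> h; rewrite -map_krylov rmap_unitmx.
rewrite regdet_unit; split=> [[ss /krylov_spanP uc /krylov_row_spanP]|].
  rewrite trmxK => ur; rewrite uc ur !andbT unitmxE.
  apply: (unit_by_fields htest) => K f; rewrite -det_map_mx map_dchar -unitfE.
  by rewrite -unitmxE; apply/(cyclic_separable (kryE _ f uc)); apply: ss.
move=> /and3P[ud uc ur]; split; last by apply/krylov_row_spanP; rewrite trmxK.
  move=> K f; apply/(cyclic_separable (kryE _ f uc)).
  by rewrite -map_dchar rmap_unitmx.
exact/krylov_spanP.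
Qed.

Lemma regular_krylov P : regular_mx P -> krylov P e0 \in unitmx.
Proof. by case=> _ /krylov_spanP. Qed.

Lemma regular_krylov_tr P : regular_mx P -> krylov P^T e0 \in unitmx.
Proof. by case=> _ _ /krylov_row_spanP; rewrite trmxK. Qed.

Lemma regular_intertw P Q C : C \in unitmx -> C *m P = Q *m C ->
  C *m e0 = e0 -> C^T *m e0 = e0 -> regular_mx P -> regular_mx Q.
Proof.
move=> uC e h h' /regular_mxP; rewrite regdet_unit => /and3P[ud uc ur].
have [_ uC'] := mulmx1_unit (mulmxV uC).
apply/regular_mxP; rewrite regdet_unit; apply/and3P; split.
- have : C *m dchar P \in unitmx by rewrite unitmx_mul uC.
  have -> : C *m dchar P = dchar Q *m C.
    rewrite /dchar (char_poly_intertw uC e) mulmx_sumr mulmx_suml.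
    apply: eq_bigr => i _; rewrite -scalemxAr -scalemxAl.
    by rewrite (intertw_exp _ e).
  by rewrite unitmx_mul => /andP[].
- by rewrite -h -(intertw_krylov _ e) unitmx_mul uC.
- have e' : C^T *m Q^T = P^T *m C^T by rewrite -!trmx_mul e.
  by move: ur; rewrite -{1}h' -(intertw_krylov _ e') unitmx_mul => /andP[].
Qed.

Lemma regular_conj P g : g \in unitmx -> regular_mx P ->
  regular_mx (invmx (embed1 g) *m P *m embed1 g).
Proof.
move=> ug; rewrite embed1_inv //.
have e : embed1 (invmx g) *m embed1 g = 1%:M by rewrite embed1_mul mulVmx // embed1_1.
apply: (@regular_intertw _ _ (embed1 (invmx g))).
- by rewrite embed1_unit unitmx_inv.
- by rewrite -[RHS]mulmxA (mulmx1C e) mulmx1.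
- exact: embed1_e0.
- by rewrite embed1_tr embed1_e0.
Qed.

(** Such a [C] intertwines [P] with itself, as the identity does. *)
Lemma regular_commute P C : regular_mx P -> C *m P = P *m C -> C *m e0 = e0 ->
  C = 1%:M.
Proof.
move=> /regular_krylov h e he; apply: (intertw_uniq h e).
  by rewrite mul1mx mulmx1.
by rewrite he mul1mx.
Qed.

End Embed1.

(** * Orbits and stabilizers in the symmetric space *)

Section Orbits.
Variables (k' : fieldType) (k : comUnitAlgType k') (tau : {lrmorphism k -> k}).
Variables m r : nat.
Local Notation n := (r + (m + 1 + r))%N.
Local Notation cj := (map_mx tau).
Local Notation bix := (@bix m r).
Local Notation "g ^k" := (map_mx (in_alg k) g) (at level 2, format "g ^k").
Implicit Types (t c : 'I_r -> k) (P : 'M[k]_(m + 1)) (z u N : 'M[k]_n).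

Lemma embed_n_mul (g h : 'M[k]_m) : embed_n r g *m embed_n r h = embed_n r (g *m h).
Proof. by rewrite [LHS]dblock_dblock !mulmx1 embed1_mul. Qed.

Lemma embed_n_1 : embed_n r (1%:M : 'M[k]_m) = 1%:M.
Proof. by rewrite /embed_n embed1_1; exact: dblock1. Qed.

Lemma embed_n_mulV (g : 'M[k]_m) : g \in unitmx ->
  embed_n r g *m embed_n r (invmx g) = 1%:M.
Proof. by move=> u; rewrite embed_n_mul mulmxV // embed_n_1. Qed.

Lemma embed_n_Vmul (g : 'M[k]_m) : g \in unitmx ->
  embed_n r (invmx g) *m embed_n r g = 1%:M.
Proof. by move=> u; rewrite embed_n_mul mulVmx // embed_n_1. Qed.

Lemma embed_n_unit (g : 'M[k]_m) : g \in unitmx -> embed_n r g \in unitmx.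
Proof. by move=> /embed_n_mulV /mulmx1_unit []. Qed.

Lemma embed_n_normal (g : 'M[k]_m) t P : g \in unitmx ->
  embed_n r g *m normal_mx tau t (invmx (embed1 g) *m P *m embed1 g) =
  normal_mx tau t P *m embed_n r g.
Proof.
move=> u; rewrite [LHS]dblock_anti [RHS]anti_dblock !mul1mx !mulmx1.
by rewrite !mulmxA mulmxV ?embed1_unit // mul1mx.
Qed.

Lemma upU_embed_n (g : 'M[k]_m) u : g \in unitmx -> upU bix u ->
  upU bix (embed_n r g *m u *m embed_n r (invmx g)).
Proof.
by move=> ug; apply: upU_conj; try exact: dblock1_bdiag; exact: embed_n_mulV.
Qed.

Lemma upU_embed_nV (g : 'M[k]_m) u : g \in unitmx -> upU bix u ->
  upU bix (embed_n r (invmx g) *m u *m embed_n r g).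
Proof.
by move=> ug; apply: upU_conj; try exact: dblock1_bdiag; exact: embed_n_Vmul.
Qed.

Lemma cj_in_alg p q (g : 'M[k']_(p, q)) : cj g^k = g^k.
Proof. by apply/matrixP => i j; rewrite !mxE /= tau_in_alg. Qed.

Lemma cj_embed_n (g : 'M[k]_m) : cj (embed_n r g) = embed_n r (cj g).
Proof. by rewrite [LHS]map_dblock !map_mx1 map_embed1. Qed.

Lemma sym_conj (G P : 'M[k]_(m + 1)) : G \in unitmx -> cj G = G ->
  sym_space tau (m + 1) P -> sym_space tau (m + 1) (invmx G *m P *m G).
Proof.
move=> uG eG [uP sP]; split; first by rewrite !unitmx_mul unitmx_inv uG uP.
rewrite !map_mxM rmap_invmx // eG -!mulmxA (mulKVmx uG) (mulmxA P) sP.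
by rewrite mul1mx mulVmx.
Qed.

Lemma act_SP z z' u (g : 'M[k']_m) : u \in unitmx -> g \in unitmx ->
  act_S tau z (u, g) = z' <->
  z *m cj (u *m embed_n r g^k) = (u *m embed_n r g^k) *m z'.
Proof.
move=> uu /(rmap_unitmx (in_alg k)) ug; have uE := embed_n_unit ug.
rewrite /act_S /= map_mxM cj_embed_n cj_in_alg; split=> [<-|e].
  by rewrite !mulmxA mulmxK // mulmxV // mul1mx.
apply: (can_inj (mulKmx uE)); apply: (can_inj (mulKmx uu)).
by rewrite !mulmxA in e *; rewrite mulmxK // mulmxV // mul1mx.
Qed.

(** The linear group normalizes the unipotent group, so it acts on normal forms,
    fixing the [t] part and conjugating the central block. *)
Lemma orbit_S_nf z t P : normal_form_S tau z t P -> orbit_S tau z =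
  [set z' | exists2 g : 'M[k']_m, g \in unitmx &
     normal_form_S tau z' t (invmx (embed1 g^k) *m P *m embed1 g^k)].
Proof.
move=> /normal_form_SP[ut [uP sP] [v hv e]]; have [uv hv'] := upU_inv hv.
apply/seteqP; split=> [_ [[u g] [/= hu ug] <-]|z' [g ug /= /normal_form_SP]].
  have [uu hu'] := upU_inv hu; have ugk := rmap_unitmx (in_alg k) ug.
  exists g => //; apply/normal_form_SP; set E := embed_n r g^k.
  have /(act_SP _ _ uu ug) := erefl (act_S tau z (u, g)).
  set z' := act_S tau z (u, g); rewrite -/E => e'.
  have uE : E \in unitmx by exact: embed_n_unit.
  split=> //.
    by apply: sym_conj; rewrite ?embed1_unit // map_embed1 cj_in_alg.
  exists (embed_n r (invmx g^k) *m (invmx u *m v) *m E).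
    by apply: upU_embed_nV => //; apply: upU_mul.
  have uuE : u *m E \in unitmx by rewrite unitmx_mul uu.
  have -> : embed_n r (invmx g^k) *m (invmx u *m v) *m E = invmx (u *m E) *m (v *m E).
    rewrite -[LHS](mulKmx uuE); congr (_ *m _).
    by rewrite !mulmxA -(mulmxA u) embed_n_mulV // mulmx1 mulmxV // mul1mx.
  apply: (can_inj (mulKmx uuE)).
  rewrite map_mxM [LHS]mulmxA -e' -[LHS]mulmxA rmap_invmx // mulKVmx ?rmap_unitmx //.
  rewrite -(mulmxA (invmx (u *m E))) mulKVmx //.
  by rewrite -(mulmxA v) embed_n_normal // map_mxM mulmxA e cj_embed_n cj_in_alg mulmxA.
case=> _ _ [v' hv2 e']; have [uv' hv2'] := upU_inv hv2.
have ugk := rmap_unitmx (in_alg k) ug; set E := embed_n r g^k.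
pose u := v *m (E *m invmx v' *m embed_n r (invmx g^k)).
have hu : upU bix u by apply: upU_mul => //; apply: upU_embed_n.
exists (u, g) => //; apply/act_SP => //; first by case: (upU_inv hu).
have -> : u *m embed_n r g^k = v *m E *m invmx v'.
  by have EE := @embed_n_Vmul g^k ugk; rewrite /u -!mulmxA EE mulmx1.
rewrite !map_mxM !mulmxA e cj_embed_n cj_in_alg.
rewrite -(mulmxA v (normal_mx tau t P)) -embed_n_normal // rmap_invmx //.
have ucv := rmap_unitmx tau uv'.
apply: (can_inj (mulmxK ucv)); rewrite mulmxKV // -[RHS]mulmxA e'.
by rewrite !mulmxA mulmxKV.
Qed.

(** By uniqueness of the decomposition an element of the stabilizer commutes with
    the regular central block, which leaves the unipotent part; that part fixes
    the left unipotent factor of [z]. *)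
Lemma stabilizer_S z : S_reg tau m r z ->
  [set h | H_S m r h /\ act_S tau z h = z] = [set (1%:M, 1%:M)].
Proof.
move=> /S_regP[_ [t [P [/normal_form_SP[ut [uP sP] [v hv e]] hP]]]].
apply/seteqP; split=> [[u g] [[/= hu ug] /act_SP]|_ ->]; last first.
  split; first by split=> /=; [exact: upU1 | exact: unitmx1].
  apply/act_SP; rewrite ?unitmx1 //.
  by rewrite map_mx1 embed_n_1 !mul1mx map_mx1 mulmx1.
have [uu _] := upU_inv hu; move=> /(_ uu ug) e1.
have ugk := rmap_unitmx (in_alg k) ug; set E := embed_n r g^k in e1.
pose g' := invmx g^k; have ug' : g' \in unitmx by rewrite unitmx_inv.
have hv' := upU_mul hu (upU_embed_n ugk hv).
set v' := u *m _ in hv'.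
have e2 : z *m cj v' = v' *m normal_mx tau t (embed1 g^k *m P *m embed1 g').
  have -> : v' = u *m E *m v *m embed_n r g' by rewrite /v' !mulmxA.
  have -> : embed1 g^k = invmx (embed1 g') by rewrite embed1_inv // /g' invmxK.
  rewrite -[RHS]mulmxA (@embed_n_normal g' t P ug').
  have cE : cj (embed_n r g') = embed_n r g'.
    by rewrite cj_embed_n /g' (rmap_invmx tau ugk) cj_in_alg.
  rewrite (map_mxM tau (u *m E *m v)) cE.
  by rewrite (map_mxM tau (u *m E) v) !mulmxA e1 -(mulmxA (u *m E) z) e !mulmxA.
have [ev _ /normal_mx_inj[_ eP]] := cell_unique hv (upU_map tau hv) hv'
  (upU_map tau hv') (@banti_normal _ _ tau _ _ t P) (@banti_normal _ _ tau _ _ t _)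
  (normal_mx_unit tau ut uP) e e2.
have g1 : embed1 g^k = 1%:M.
  apply: (regular_commute hP); last exact: embed1_e0.
  by rewrite [in RHS]eP -!mulmxA embed1_mul mulVmx // embed1_1 mulmx1.
have gk1 : g^k = 1%:M by apply: (@embed1_inj _ k); rewrite g1 embed1_1.
have gg : g = 1%:M.
  by apply: (map_mx_inj (f := in_alg k)); rewrite gk1 map_mx1.
have [uv _] := upU_inv hv.
rewrite gg; congr (_, _); rewrite -[u](mulmxK uv).
by move: ev; rewrite /v' gk1 invmx1 embed_n_1 mul1mx mulmx1 => <-; rewrite mulmxV.
Qed.

End Orbits.

(** * Orbits and stabilizers in the unitary groups *)

Section Unitary.
Variables (k' : fieldType) (k : comUnitAlgType k') (tau : {lrmorphism k -> k}).
Local Notation cj := (map_mx tau).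

Lemma unitary_mul n (J g h : 'M[k]_n) :
  unitary tau J g -> unitary tau J h -> unitary tau J (g *m h).
Proof.
move=> [ug eg] [uh eh]; split; first by rewrite unitmx_mul ug.
by rewrite map_mxM trmx_mul -!mulmxA (mulmxA J) (mulmxA (cj g)^T) (mulmxA (cj g)^T) eg
  mulmxA eh.
Qed.

Lemma unitary_inv n (J g : 'M[k]_n) : unitary tau J g -> unitary tau J (invmx g).
Proof.
move=> [ug eg]; split; first by rewrite unitmx_inv.
have e : (cj (invmx g))^T *m (cj g)^T = 1%:M.
  by rewrite -trmx_mul -map_mxM mulmxV // map_mx1 trmx1.
by rewrite -{1}eg !mulmxA e mul1mx mulmxK.
Qed.

Lemma unitary1 n (J : 'M[k]_n) : unitary tau J 1%:M.
Proof. by split; rewrite ?unitmx1 // map_mx1 trmx1 mul1mx mulmx1. Qed.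

End Unitary.

Section UnitaryOrbits.
Variables (k' : fieldType) (k : comUnitAlgType k') (tau : {lrmorphism k -> k}).
Variables (b0 : k') (m r : nat).
Local Notation n := (r + (m + 1 + r))%N.
Local Notation cj := (map_mx tau).
Local Notation bix := (@bix m r).
Implicit Types (t : 'I_r -> k) (P : 'M[k]_(m + 1)) (z u N : 'M[k]_n) (b : 'M[k]_m).

Lemma beta'_conj b (g : 'M[k]_m) :
  (cj (embed1 g))^T *m beta' b0 b *m embed1 g = beta' b0 ((cj g)^T *m b *m g).
Proof.
rewrite map_embed1 embed1_tr /beta' /embed1 !mulmx_block.
by rewrite !(mulmx0, mul0mx, mul1mx, mulmx1, addr0, add0r).
Qed.

Lemma embed1_unitary b g : unitary tau b g -> unitary tau (beta' b0 b) (embed1 g).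
Proof. by move=> [ug eg]; split; rewrite ?embed1_unit // beta'_conj eg. Qed.

Lemma embed_n_unitary b g : unitary tau b g -> unitary_n tau b0 r b (embed_n r g).
Proof.
move=> h; have [ug _] := h; have [_ eg] := embed1_unitary h.
split; first exact: embed_n_unit.
rewrite cj_embed_n.
rewrite [X in X *m _ *m _]dblock_tr !trmx1 [X in X *m _]dblock_anti [LHS]anti_dblock.
by rewrite !mul1mx !mulmx1 -map_embed1 eg.
Qed.

Lemma unip'_upU b u : unip' tau b0 b u -> upU bix u. Proof. by case. Qed.

Lemma unip'_conj b (g : 'M[k]_m) u : unitary tau b g -> unip' tau b0 b u ->
  unip' tau b0 b (embed_n r g *m u *m embed_n r (invmx g)).
Proof.
move=> hg [hu hu']; split; last by apply: upU_embed_n => //; case: hg.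
apply: unitary_mul; last exact/embed_n_unitary/unitary_inv.
by apply: unitary_mul => //; exact: embed_n_unitary.
Qed.

Lemma unip'_mul b u v : unip' tau b0 b u -> unip' tau b0 b v ->
  unip' tau b0 b (u *m v).
Proof. by move=> [h1 h2] [h3 h4]; split; [exact: unitary_mul | exact: upU_mul]. Qed.

Lemma unip'_inv b u : unip' tau b0 b u -> unip' tau b0 b (invmx u).
Proof.
by move=> [h1 h2]; split; [exact: unitary_inv | case: (upU_inv h2)].
Qed.

Lemma unip'_1 b : unip' tau b0 b (1%:M : 'M[k]_n).
Proof. by split; [exact: unitary1 | exact: upU1]. Qed.

Lemma act_UP z z' (h1 h2 : 'M[k]_n) : h1 \in unitmx ->
  act_U z (h1, h2) = z' <-> z *m h2 = h1 *m z'.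
Proof. by move=> u1; apply: conj_mxP. Qed.

Lemma orbit_U_nf b z t P : normal_form_U tau b0 b z t P -> orbit_U tau b0 b z =
  [set z' | exists2 g : 'M[k]_m, unitary tau b g &
     normal_form_U tau b0 b z' t (invmx (embed1 g) *m P *m embed1 g)].
Proof.
move=> /normal_form_UP[ut hP [v1 [v2 [hv1 hv2 e]]]].
have [uv1 _] := upU_inv (unip'_upU hv1).
apply/seteqP; split=> [_ [[h1 h2] [u1 [u2 [g [hu1 hu2 hg [-> ->]]]]] <-]|z'].
  have [ug _] := hg; have [uu1 _] := upU_inv (unip'_upU hu1).
  have uE := @embed_n_unit _ k m r g ug.
  exists g => //; apply/normal_form_UP.
  have /act_UP := erefl (act_U z (u1 *m embed_n r g, u2 *m embed_n r g)).
  rewrite unitmx_mul uu1 uE => /(_ isT).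
  set z' := act_U z _ => e'.
  split=> //.
    apply: unitary_mul; last exact: embed1_unitary.
    by apply: unitary_mul => //; exact/unitary_inv/embed1_unitary.
  have hV u v : unip' tau b0 b u -> unip' tau b0 b v ->
     unip' tau b0 b (embed_n r (invmx g) *m (invmx u *m v) *m embed_n r g).
    move=> hu hv; have := unip'_conj (unitary_inv hg) (unip'_mul (unip'_inv hu) hv).
    by rewrite invmxK.
  exists (embed_n r (invmx g) *m (invmx u1 *m v1) *m embed_n r g).
  exists (embed_n r (invmx g) *m (invmx u2 *m v2) *m embed_n r g).
  split; [exact: hV | exact: hV|].
  have eN := @embed_n_normal _ _ tau m r g t P ug.
  have EE := @embed_n_mulV _ k m r g ug.
  set N' := normal_mx _ _ _ in eN *.
  move: (embed_n r g) (embed_n r (invmx g)) EE uE eN e' {hV} => E E' EE uE eN e'.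
  have uuE : u1 *m E \in unitmx by rewrite unitmx_mul uu1.
  apply: (can_inj (mulKmx uuE)).
  have [uu2 _] := upU_inv (unip'_upU hu2).
  rewrite [LHS]mulmxA -e' -!mulmxA (mulmxA E) EE mul1mx (mulKVmx uu2).
  by rewrite (mulmxA E E') EE mul1mx (mulKVmx uu1) eN !mulmxA e.
move=> [g hg /normal_form_UP[_ _ [w1 [w2 [hw1 hw2 e']]]]]; have [ug _] := hg.
have [uw1 _] := upU_inv (unip'_upU hw1); have [uw2 _] := upU_inv (unip'_upU hw2).
pose u (v w : 'M[k]_n) := v *m (embed_n r g *m invmx w *m embed_n r (invmx g)).
have hu v w : unip' tau b0 b v -> unip' tau b0 b w -> unip' tau b0 b (u v w).
  by move=> hv hw; apply/unip'_mul/unip'_conj => //; exact: unip'_inv.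
have EE := @embed_n_Vmul _ k m r g ug.
have eN := @embed_n_normal _ _ tau m r g t P ug.
exists (u v1 w1 *m embed_n r g, u v2 w2 *m embed_n r g).
  by exists (u v1 w1), (u v2 w2), g; split=> //; exact: hu.
apply/act_UP.
  rewrite unitmx_mul; apply/andP; split; last exact: embed_n_unit.
  by have [] := upU_inv (unip'_upU (hu _ _ hv1 hw1)).
set N' := normal_mx _ _ _ in eN e'.
rewrite /u; move: (embed_n r g) (embed_n r (invmx g)) EE eN {u hu} => E E' EE eN.
rewrite -!mulmxA EE (mulmxA E' E) EE mul1mx mulmx1.
apply: (can_inj (mulmxK uw2)); rewrite -!mulmxA (mulVmx uw2) mulmx1 e'.
rewrite (mulmxA (invmx w1)) (mulVmx uw1) mul1mx.
by rewrite eN !mulmxA e.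
Qed.

Lemma stabilizer_U b z : U_reg tau b0 r b z ->
  [set h | H_U tau b0 b h /\ act_U z h = z] = [set (1%:M, 1%:M)].
Proof.
move=> /U_regP[_ [t [P [/normal_form_UP[ut [uP sP] [v1 [v2 [hv1 hv2 e]]]] hP]]]].
apply/seteqP; split=> [[_ _] [[u1 [u2 [g [hu1 hu2 hg [-> ->]]]]]]|_ ->]; last first.
  split.
    exists 1%:M, 1%:M, 1%:M; split; try exact: unip'_1; first exact: unitary1.
    by rewrite embed_n_1 mulmx1.
  by apply/act_UP; rewrite ?unitmx1 // mulmx1 mul1mx.
have [ug _] := hg; have [uu1 _] := upU_inv (unip'_upU hu1).
have uE := @embed_n_unit _ k m r g ug.
move=> /act_UP; rewrite unitmx_mul uu1 uE => /(_ isT) e1.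
have ug' : invmx g \in unitmx by rewrite unitmx_inv.
have eg : embed1 g = invmx (embed1 (invmx g)) by rewrite embed1_inv // invmxK.
have eN := @embed_n_normal _ _ tau m r (invmx g) t P ug'.
rewrite -eg in eN.
pose v u v := u *m (embed_n r g *m v *m embed_n r (invmx g)).
have hv u w : unip' tau b0 b u -> unip' tau b0 b w -> upU bix (v u w).
  by move=> hu hw; exact: (unip'_upU (unip'_mul hu (unip'_conj hg hw))).
have e2 : z *m v u2 v2 = v u1 v1 *m normal_mx tau t (embed1 g *m P *m embed1 (invmx g)).
  rewrite /v; move: eN e1; set N' := normal_mx _ _ (_ *m _).
  move: (embed_n r g) (embed_n r (invmx g)) => E E' eN e1.
  rewrite -![in RHS]mulmxA eN [in RHS](mulmxA v1) -e.
  by rewrite !mulmxA -(mulmxA z u2) e1.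
have [ev1 ev2 /normal_mx_inj[_ eP]] := cell_unique (unip'_upU hv1) (unip'_upU hv2)
  (hv _ _ hu1 hv1) (hv _ _ hu2 hv2)
  (@banti_normal _ _ tau _ _ t P) (@banti_normal _ _ tau _ _ t _)
  (normal_mx_unit tau ut uP) e e2.
have g1 : embed1 g = 1%:M.
  apply: (regular_commute hP); last exact: embed1_e0.
  by rewrite [in RHS]eP -!mulmxA embed1_mul mulVmx // embed1_1 mulmx1.
have gk1 : g = 1%:M by apply: (@embed1_inj _ k); rewrite g1 embed1_1.
have [uv1 _] := upU_inv (unip'_upU hv1); have [uv2 _] := upU_inv (unip'_upU hv2).
have triv u w : w \in unitmx -> w = v u w -> u = 1%:M.
  move=> uw; rewrite /v gk1 invmx1 embed_n_1 mul1mx mulmx1 => ew.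
  by rewrite -[u](mulmxK uw) -ew mulmxV.
rewrite (triv _ _ uv1 ev1) (triv _ _ uv2 ev2) gk1 embed_n_1.
by rewrite mulmx1.
Qed.

Hypothesis htauK : involutive tau.
Hypothesis htest : tested_by_fields k.
Variables (a : k) (l1 l2 : {scalar k}).
Hypothesis hbas : quadratic_basis a l1 l2.
Hypothesis ua : a - tau a \is a GRing.unit.

Local Notation W := (wrev k m r).

(** The conditions on minors and the regularity of the central block are units
    of regular functions. *)
Lemma zariski_open_cell (X : set 'M[k]_n) :
  zariski_open X (X `&` [set z | minors bix (W *m z) \is a GRing.unit /\
     regular_mx (center (cell_core z))]).
Proof.
have hC := kpolyfun_algebra hbas n.
have hX : mxfun (@kpolyfun _ k n) (fun z => W *m z).
  by apply: (mxfun_mul hC); [exact: (mxfun_cst hC) | exact: kpolyfun_id].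
have hq := fa_minors hC bix hX.
have := zariski_open_unit htauK hbas ua X hq.
move=> /(_ (fun z => regdet (center (cell_core z)) (e0 k m))) h.
have -> : [set z | minors bix (W *m z) \is a GRing.unit /\
     regular_mx (center (cell_core z))] =
  [set z | minors bix (W *m z) \is a GRing.unit /\
     regdet (center (cell_core z)) (e0 k m) \is a GRing.unit].
  apply/seteqP; split=> z [hz] /=.
    by move=> /(regular_mxP htest).
  by move=> /(regular_mxP htest).
apply: h; have hL := localized_algebra hC hq.
apply: (fa_regdet hL) => i j.
have := @mxfun_elim _ _ _ _ bix _ hC hX (ix2 r i) (ix2 r j).
by apply: fa_ext => z; rewrite [RHS]mxE.
Qed.

End UnitaryOrbits.

(** * Existence of regular elements *)

Lemma no_finite_cover_uniq (T : eqType) (N : nat) (bad : seq T) :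
  no_finite_cover T ->
  exists s : seq T, [/\ size s = N, uniq s & {in s, forall x, x \notin bad}].
Proof.
move=> h; elim: N => [|N [s [hs us hb]]]; first by exists [::].
have [x] := h (s ++ bad); rewrite mem_cat negb_or => /andP[xs xb].
exists (x :: s); split; rewrite /= ?hs ?xs //.
by move=> y; rewrite inE => /orP[/eqP ->|/hb].
Qed.

Section Existence.
Variables (k' : fieldType) (k : comUnitAlgType k') (tau : {lrmorphism k -> k}).
Hypothesis htauK : involutive tau.
Hypothesis htest : tested_by_fields k.
Hypothesis hinf : no_finite_cover k'.
Variable m : nat.
Local Notation n := (m + 1)%N.
Local Notation e0 := (e0 k m).

Lemma in_alg_unit (c : k') : c != 0 -> c%:A \is a @GRing.unit k.
Proof. by move=> h; rewrite scaler_unit ?unitr1 // unitfE. Qed.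

(** Diagonal with distinct entries in a basis where [e0] becomes the vector of
    ones, whose Krylov matrix is a Vandermonde matrix. *)
Lemma exists_cyclic : exists P : 'M[k]_n,
  [/\ dchar P \in unitmx, krylov P e0 \in unitmx & P - 1%:M \in unitmx].
Proof.
have [s [hs us hb]] := no_finite_cover_uniq n [:: 1] hinf.
pose d (i : 'I_n) : k := (s`_i)%:A.
have sub_unit x y : x \in s -> x != y -> x%:A - y%:A \is a @GRing.unit k.
  by move=> _ h; rewrite -scalerBl in_alg_unit // subr_eq0.
have mem_s (i : 'I_n) : s`_i \in s by rewrite mem_nth // hs.
pose D : 'M[k]_n := diag_mx (\row_i d i).
pose v : 'cV[k]_n := const_mx 1.
have D_exp i : D ^+ i = diag_mx (\row_j d j ^+ i).
  elim: i => [|i IH]; first by apply/matrixP => x y; rewrite !mxE expr0.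
  rewrite expSmx IH mulmx_diag; congr diag_mx; apply/rowP => j.
  by rewrite !mxE exprS.
have uK : krylov D v \in unitmx.
  have -> : krylov D v = (Vandermonde n (\row_i d i))^T.
    apply/matrixP => i j; rewrite mxE D_exp mul_diag_mx !mxE mulr1 //.
  rewrite unitmx_tr unitmxE det_Vandermonde; apply: rpred_prod => i _.
  apply: rpred_prod => j ij; rewrite !mxE; apply: sub_unit => //.
  by rewrite nth_uniq ?hs // gtn_eqF.
have uD : dchar D \in unitmx.
  rewrite unitmxE; apply: (unit_by_fields htest) => K f.
  rewrite -det_map_mx map_dchar -unitfE -unitmxE.
  apply/(@cyclic_separable _ _ _ (map_mx f v)).
    by rewrite -map_krylov rmap_unitmx.
  rewrite char_poly_trig; last first.
    apply/is_trig_mxP => i j ij; rewrite !mxE -val_eqE ltn_eqF // mulr0n.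
    by rewrite rmorph0.
  have -> : \prod_(i < n) ('X - ((map_mx f D) i i)%:P) =
     \prod_(x <- [seq f (d i) | i <- enum 'I_n]) ('X - x%:P).
    rewrite big_map big_enum; apply: eq_bigr => i _.
    by rewrite !mxE eqxx mulr1n.
  rewrite separable_prod_XsubC map_inj_uniq ?enum_uniq // => i j /eqP.
  rewrite (inj_eq (fmorph_inj (f \o in_alg k))) nth_uniq ?hs // => /eqP.
  exact: val_inj.
have uD1 : D - 1%:M \in unitmx.
  have -> : D - 1%:M = diag_mx (\row_i (d i - 1)).
    by apply/matrixP => i j; rewrite !mxE; case: eqP; rewrite ?subr0.
  rewrite unitmxE det_diag; apply: rpred_prod => i _; rewrite mxE.
  rewrite -[1 in X in _ - X]scale1r; apply: sub_unit => //.
  by have := hb _ (mem_s i); rewrite inE.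
pose T : 'M[k]_n := block_mx 1%:M (const_mx 1) 0 1%:M.
have uT : T \in unitmx by rewrite unitmxE det_ublock !det1 mulr1 unitr1.
have Te : T *m e0 = v.
  rewrite e0E mul_block_col !mulmx0 !mulmx1 !add0r /v.
  rewrite -[RHS]vsubmxK; congr col_mx; apply/matrixP => i j; rewrite !mxE //.
  by rewrite !ord1 eqxx.
pose P := invmx T *m D *m T.
have eP : T *m P = D *m T by rewrite /P !mulmxA mulmxV // mul1mx.
exists P; split.
- have : T *m dchar P = dchar D *m T.
    rewrite /dchar (char_poly_intertw uT eP) mulmx_sumr mulmx_suml.
    by apply: eq_bigr => i _; rewrite -scalemxAr -scalemxAl (intertw_exp _ eP).
  move=> e; have : T *m dchar P \in unitmx by rewrite e unitmx_mul uD.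
  by rewrite unitmx_mul => /andP[].
- have : T *m krylov P e0 \in unitmx by rewrite (intertw_krylov _ eP) Te.
  by rewrite unitmx_mul => /andP[].
- have : T *m (P - 1%:M) \in unitmx.
    by rewrite mulmxBr eP mulmx1 -[X in _ - X]mul1mx -mulmxBl unitmx_mul uD1.
  by rewrite unitmx_mul => /andP[].
Qed.

(** Row cyclicity of the transpose is column cyclicity, so a generic point of
    the line joining [P] to its transpose has both. *)
Lemma exists_regdet : exists P : 'M[k]_n,
  regdet P e0 \is a GRing.unit /\ P - 1%:M \in unitmx.
Proof.
have [P [h1 h2 h3]] := exists_cyclic; have hC := linefun_algebra k.
pose X (s : k) := P + s *: (P^T - P).
have hX : mxfun (@linefun _ k) X by apply: mxfun_line.
pose F s := \det (dchar (X s)) * \det (krylov (X s) e0) * \det (X s - 1%:M).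
pose G s := \det (krylov (X s)^T e0).
have hF : linefun F.
  apply: (fa_mul hC); last first.
    by apply/(fa_det hC)/(mxfun_add hC) => //; exact: (mxfun_cst hC).
  by apply: (fa_mul hC); [exact: fa_det_dchar | exact: fa_det_krylov].
have hG : linefun G by apply: (fa_det_krylov hC); apply: mxfun_tr.
have [||s []] := linefun_point htest hinf (x := 0) (y := 1) hF hG.
- by rewrite /F /X scale0r addr0 !unitrM -!unitmxE h1 h2 h3.
- by rewrite /G /X scale1r addrC subrK trmxK -unitmxE.
rewrite /F /G !unitrM -!unitmxE => /andP[/andP[u1 u2] u3] u4.
by exists (X s%:A); rewrite regdet_unit u1 u2 u4.
Qed.

Variable a : k.
Hypothesis ua : a - tau a \is a GRing.unit.

(** Generic Cayley transform. The fixed points of [theta] form a [k']-form of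
    the matrix algebra, hence are dense for conditions given by units; the
    condition imposed is the regularity of the Cayley transform, met at the
    inverse Cayley transform of any regular [P]. *)
Lemma exists_cayley (theta : 'M[k]_n -> 'M[k]_n) :
  (forall x X Y, theta (x *: X + Y) = tau x *: theta X + theta Y) ->
  involutive theta ->
  exists X, [/\ theta X = X, X - (tau a)%:M \in unitmx
    & regdet ((X - a%:M) *m invmx (X - (tau a)%:M)) e0 \is a GRing.unit].
Proof.
move=> hth thK; have [P0 [hP uP]] := exists_regdet.
have th0 : theta 0 = 0.
  by have := hth (-1) 0 0; rewrite scaler0 addr0 rmorphN1 scaleN1r addNr.
have thZ x X : theta (x *: X) = tau x *: theta X.
  by rewrite -[x *: X]addr0 hth th0 addr0.
have thB X Y : theta (X - Y) = theta X - theta Y.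
  by rewrite addrC -scaleN1r hth rmorphN1 scaleN1r addrC.
have thD X Y : theta (X + Y) = theta X + theta Y.
  by rewrite -[X]scale1r hth rmorph1 !scale1r.
have hC := linefun_algebra k.
pose u := a - tau a.
have uZ : 1%:M - P0 \in unitmx by rewrite -opprB -scaleN1r unitmxZ ?unitrN1.
pose Z := invmx (1%:M - P0).
pose X0 := (a%:M - tau a *: P0) *m Z.
have eZ x : x%:M = x *: ((1%:M - P0) *m Z) by rewrite mulmxV // scalemx1.
have eX0 : X0 - (tau a)%:M = u *: Z.
  rewrite (eZ (tau a)) /X0 scalemxAl -mulmxBl -[RHS]mul_scalar_mx.
  by rewrite scalerBr opprB addrA subrK !scalemx1 raddfB.
have eX1 : X0 - a%:M = u *: (P0 *m Z).
  rewrite (eZ a) /X0 scalemxAl -mulmxBl [RHS]scalemxAl; congr (_ *m _).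
  rewrite scalerBr scalemx1 opprB scalerBl [a%:M - _]addrC addrACA.
  by rewrite subrr addr0 addrC.
have uZ' : Z \in unitmx by rewrite unitmx_inv.
have uX0 : X0 - (tau a)%:M \in unitmx by rewrite eX0 unitmxZ.
have cX0 : (X0 - a%:M) *m invmx (X0 - (tau a)%:M) = P0.
  apply: (can_inj (mulmxK uX0)); rewrite mulmxKV // eX1 eX0.
  by rewrite -scalemxAr.
pose H2 := u^-1 *: (X0 - theta X0).
pose H1 := X0 - a *: H2.
have tu : tau u = - u by rewrite /u rmorphB /= htauK opprB.
have thH2 : theta H2 = H2.
  by rewrite /H2 thZ thB thK rmorphV //= tu invrN scaleNr -scalerN opprB.
have e : theta X0 = X0 - u *: H2.
  by rewrite /H2 scalerA divrr // scale1r opprB addrC subrK.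
have thH1 : theta H1 = H1.
  rewrite /H1 thB thZ thH2 e /u scalerBl opprB -addrA; congr (_ + _).
  by rewrite addrAC subrr add0r.
pose X s := H1 + s *: H2.
have Xa : X a = X0 by rewrite /X /H1 subrK.
have hX : mxfun (@linefun _ k) X by apply: mxfun_line.
have hXc (c : k) : mxfun (@linefun _ k) (fun s => X s - c%:M).
  by apply: (mxfun_add hC) => //; exact: (mxfun_cst hC).
pose q s := \det (X s - (tau a)%:M).
have hq : linefun q by exact: (fa_det hC).
have hL := localized_algebra hC hq.
pose F s := regdet ((X s - a%:M) *m invmx (X s - (tau a)%:M)) e0.
have hF : localized (@linefun _ k) q F.
  apply: (fa_regdet hL); apply: (mxfun_mul hL).
    by move=> i j; apply: localized_sub; apply: hXc.
  apply: (mxfun_localized_invmx hC hq (hXc _) (fa_cst hC 1)) => s.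
  by rewrite mulr1.
have [||s [uq uF]] := localized_point htest hinf (x := a) hq hF.
- by rewrite /q Xa -unitmxE.
- by rewrite /F Xa cX0.
exists (X s%:A); split=> //.
by rewrite /X thD thZ thH1 thH2 tau_in_alg.
Qed.

Lemma exists_regular_sym : exists P, sym_space tau n P /\ regular_mx P.
Proof.
have [||X [eX uX hX]] := exists_cayley (theta := map_mx tau).
- by move=> x X Y; rewrite map_mxD map_mxZ.
- exact: cjK.
have e1 : map_mx tau (X - (tau a)%:M) = X - a%:M.
  by rewrite map_mxB map_scalar_mx /= htauK eX.
have e2 : map_mx tau (X - a%:M) = X - (tau a)%:M by rewrite -e1 cjK.
have uXa : X - a%:M \in unitmx by rewrite -e1 rmap_unitmx.
eexists; split; last exact/(regular_mxP htest)/hX.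
split; first by rewrite unitmx_mul uXa unitmx_inv.
by rewrite map_mxM rmap_invmx // e1 e2 -mulmxA mulKmx // mulmxV.
Qed.

Lemma exists_regular_unitary b0 b : b0 != 0 -> Her tau m b ->
  exists P, unitary tau (beta' b0 b) P /\ regular_mx P.
Proof.
move=> hb0 hb; have uB := beta'_unit hb hb0; have eB := beta'_herm b0 hb.
set B := beta' b0 b in uB eB *.
pose star (X : 'M[k]_n) := (map_mx tau X)^T.
have starM X Y : star (X *m Y) = star Y *m star X.
  by rewrite /star map_mxM trmx_mul.
have starK X : star (star X) = X by rewrite /star -map_trmx cjK ?trmxK.
pose theta X := invmx B *m star X *m B.
have [||X [eX uX hX]] := exists_cayley (theta := theta).
- move=> x X Y; rewrite /theta /star map_mxD map_mxZ linearD linearZ /=.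
  by rewrite mulmxDr mulmxDl -scalemxAr -scalemxAl.
- move=> X; rewrite /theta !starM starK [star B]eB.
  have -> : star (invmx B) = invmx B.
    by rewrite /star rmap_invmx // trmx_inv -/(star B) [star B]eB.
  by rewrite !mulmxA mulVmx // mul1mx mulmxKV.
have sX : star X *m B = B *m X by rewrite -{2}eX /theta -mulmxA mulKVmx.
have sc (c : k) : star (X - c%:M) *m B = B *m (X - (tau c)%:M).
  rewrite /star map_mxB linearB map_scalar_mx /= tr_scalar_mx mulmxBl mulmxBr.
  by rewrite -/(star X) sX scalar_mxC.
have uXa : X - a%:M \in unitmx.
  have : B *m (X - a%:M) \in unitmx.
    rewrite -[a]htauK -sc unitmx_mul uB andbT unitmx_tr rmap_unitmx //.
  by rewrite unitmx_mul => /andP[].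
set Y := invmx (X - (tau a)%:M) in hX.
eexists; split; last exact/(regular_mxP htest)/hX.
split; first by rewrite unitmx_mul uXa unitmx_inv.
rewrite -/(star _) starM -!mulmxA (mulmxA (star (X - a%:M))) sc.
have cXX : (X - (tau a)%:M) *m (X - a%:M) = (X - a%:M) *m (X - (tau a)%:M).
  have -> : X - (tau a)%:M = (X - a%:M) + (a - tau a)%:M.
    by rewrite raddfB addrA subrK.
  by move: (X - a%:M) => A; rewrite mulmxDl mulmxDr scalar_mxC.
rewrite -mulmxA (mulmxA (X - (tau a)%:M)) cXX -mulmxA mulmxV // mulmx1.
have -> : B *m (X - a%:M) = star (X - (tau a)%:M) *m B by rewrite sc htauK.
by rewrite mulmxA -starM mulmxV // /star map_mx1 trmx1 mul1mx.
Qed.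

End Existence.

(** * Hermitian forms attached to a regular element *)

Lemma row_krylov (R : comUnitRingType) n (v : 'rV[R]_n) (A : 'M[R]_n) e j :
  (v *m krylov A e) 0 j = (v *m (A ^+ j *m e)) 0 0.
Proof. by rewrite !mxE; apply: eq_bigr => l _; rewrite mxE. Qed.

Lemma krylov_scale (R : comUnitRingType) n (A : 'M[R]_n) e (c : R) :
  c \is a GRing.unit -> (krylov A (c *: e) \in unitmx) = (krylov A e \in unitmx).
Proof.
move=> uc; rewrite -(unitmxZ (krylov A e) uc); congr (_ \in unitmx).
apply/matrixP => i j; rewrite [LHS]mxE -scalemxAr [LHS]mxE [RHS]mxE.
by congr (_ * _); rewrite [RHS]mxE.
Qed.

(** Compare the two rows on the Krylov basis of [A]. *)
Lemma intertw_row (R : comUnitRingType) n (A B C : 'M[R]_n) (e f : 'cV[R]_n)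
  (v w : 'rV[R]_n) : krylov A e \in unitmx -> C *m A = B *m C -> C *m e = f ->
  (forall i, v *m (B ^+ i *m f) = w *m (A ^+ i *m e)) -> v *m C = w.
Proof.
move=> u h he hvw; apply: (can_inj (mulmxK u)); apply/rowP => j.
by rewrite -mulmxA (intertw_krylov _ h) he !row_krylov hvw.
Qed.

Lemma trmx11 (R : comUnitRingType) (M : 'M[R]_1) : M^T = M.
Proof. by apply/matrixP => i j; rewrite mxE !ord1. Qed.

Section Matching.
Variables (k' : fieldType) (k : comUnitAlgType k') (tau : {lrmorphism k -> k}).
Hypothesis htauK : involutive tau.
Hypothesis htest : tested_by_fields k.
Hypothesis hinf : no_finite_cover k'.
Variables (a : k) (l1 l2 : {scalar k}).
Hypothesis hbas : quadratic_basis a l1 l2.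
Hypothesis ua : a - tau a \is a GRing.unit.
Variables (b0 : k') (m : nat).
Hypothesis hb0 : b0 != 0.
Local Notation n := (m + 1)%N.
Local Notation e0 := (e0 k m).
Local Notation cj := (map_mx tau).
Local Notation beta' := (@beta' k' k b0 m).
Implicit Types (P Q C : 'M[k]_n) (b g : 'M[k]_m).

Lemma cj_e0 : cj e0 = e0.
Proof. by rewrite map_delta_mx. Qed.

Lemma beta'_e0 b : beta' b *m e0 = b0%:A *: e0.
Proof.
rewrite e0E mul_block_col !mulmx0 !mulmx1 !add0r scale_col_mx scaler0.
by rewrite scalemx1.
Qed.

Lemma beta'_tr_e0 b : (beta' b)^T *m e0 = b0%:A *: e0.
Proof.
rewrite tr_block_mx e0E mul_block_col !mulmx0 !trmx0 mul0mx !add0r.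
by rewrite tr_scalar_mx mulmx1 scale_col_mx scaler0 scalemx1.
Qed.

Lemma beta'_inj : injective beta'.
Proof. by move=> b b' /eq_block_mx[]. Qed.

Lemma scale_e0_beta' C : C *m e0 = b0%:A *: e0 -> C^T *m e0 = b0%:A *: e0 ->
  C = beta' (ulsubmx C).
Proof.
rewrite -[C]submxK e0E tr_block_mx !mul_block_col !mulmx0 !mulmx1 !add0r.
rewrite !scale_col_mx scaler0 scalemx1 block_mxKul.
move=> /eq_col_mx[-> ->] /eq_col_mx[e _].
by rewrite /Defs.beta' -[dlsubmx C]trmxK e trmx0.
Qed.

Lemma unitary_intertw P (B : 'M[k]_n) : sym_space tau n P ->
  unitary tau B P <-> B *m P = P^T *m B.
Proof.
move=> [uP sP]; have e1 : (cj P)^T *m P^T = 1%:M by rewrite -trmx_mul sP trmx1.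
have e2 : P^T *m (cj P)^T = 1%:M by apply: mulmx1C.
split=> [[_ e]|e]; last by split=> //; rewrite -mulmxA e mulmxA e1 mul1mx.
by rewrite -[in RHS]e !mulmxA e2 mul1mx.
Qed.

(** That [P] is unitary for [beta' b] says that [beta' b] intertwines [P] with
    its transpose, both cyclic for [e0], and by its shape [beta' b] scales [e0]
    by [b0]: these two conditions have exactly one solution. *)
Lemma form_unique P b b' : sym_space tau n P -> regular_mx P ->
  unitary tau (beta' b) P -> unitary tau (beta' b') P -> b = b'.
Proof.
move=> sP hP /(unitary_intertw _ sP) e /(unitary_intertw _ sP) e'.
by apply/beta'_inj/(intertw_uniq (regular_krylov hP) e e'); rewrite !beta'_e0.
Qed.

(** On the Krylov basis of [P] the solution is seen to scale the row of [e0] as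
    well, which gives it the shape [beta' b]. Then both conditions are stable
    under transposition and under [tau], so by uniqueness the solution is
    symmetric with entries fixed by [tau]. *)
Lemma form_exists P : sym_space tau n P -> regular_mx P ->
  exists b, Her tau m b /\ unitary tau (beta' b) P.
Proof.
move=> sP hP; have [uP eP] := sP; have ub := b0_unit k hb0.
have uK := regular_krylov hP.
have ccP : cj P *m P = 1%:M by apply: mulmx1C.
have [|C [uC CP Ce]] := @intertw_exists _ _ P P^T e0 (b0%:A *: e0)
  (esym (char_poly_trmx P)) uK.
  by rewrite krylov_scale // regular_krylov_tr.
have CTe : C^T *m e0 = b0%:A *: e0.
  apply: trmx_inj; rewrite trmx_mul trmxK.
  apply: (intertw_row uK CP Ce) => i.
  rewrite -trmx_exp -scalemxAr -scalemxAr linearZ -scalemxAl; congr (_ *: _).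
  by rewrite -[LHS]trmx11 !trmx_mul !trmxK mulmxA.
have CT : C^T = C.
  apply: (@intertw_uniq _ _ P P^T _ _ e0) => //; last by rewrite CTe.
  by apply: trmx_inj; rewrite !trmx_mul !trmxK.
have cC : cj C = C.
  apply: (@intertw_uniq _ _ P P^T _ _ e0) => //; last first.
    by rewrite -{1}cj_e0 -map_mxM Ce map_mxZ cj_e0 /= tau_in_alg.
  have e1 : cj C *m cj P = (cj P)^T *m cj C by rewrite map_trmx -!map_mxM CP.
  have e2 : P^T *m (cj P)^T = 1%:M by rewrite -trmx_mul ccP trmx1.
  by rewrite -[LHS]mul1mx -e2 -[LHS]mulmxA (mulmxA _ _ P) -e1 -mulmxA ccP mulmx1.
have eC := scale_e0_beta' Ce CTe; exists (ulsubmx C); split; last first.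
  by rewrite -eC; apply/unitary_intertw.
split; last by rewrite map_ulsubmx cC trmx_ulsub CT.
have : beta' (ulsubmx C) \in unitmx by rewrite -eC.
by rewrite !unitmxE det_lblock unitrM => /andP[].
Qed.

(** Hilbert 90 for [GL_m]: the cocycle [c] is the coboundary of
    [x + tau x *: c] for a scalar [x] such that the latter is invertible. *)
Lemma hilbert90 (c : 'M[k]_m) : c *m cj c = 1%:M ->
  exists2 g, g \in unitmx & g = c *m cj g.
Proof.
move=> cc; have hC := linefun_algebra k.
pose X (s : k) : 'M[k]_m := (a%:M + tau a *: c) + s *: (1%:M + c).
(* [X s] is [x + tau x *: c] at [x = s + a] for [s] in [k']; as a polynomial
   in [s] over [k] its determinant is a unit at [s = - tau a]. *)
pose F s := \det (X s).
have hF : linefun F by apply: (fa_det hC); apply: mxfun_line.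
have uF : F (- tau a) \is a GRing.unit.
  rewrite /F /X scalerDr scalemx1 addrACA -scalerDl subrr scale0r addr0.
  by rewrite -raddfD det_scalar unitrX.
have [s [us _]] := linefun_point htest hinf hF hF uF uF.
exists (X s%:A); first by rewrite unitmxE.
rewrite /X !map_mxD !map_mxZ map_mxD map_mx1 map_scalar_mx /= htauK tau_in_alg.
rewrite !mulmxDr -!scalemxAr mulmxDr mulmx1 cc scalar_mxC mul_scalar_mx scalemx1.
by rewrite [_ *: c + a%:M]addrC [c + _]addrC.
Qed.

(** The unique matrix fixing [e0] that conjugates [tau Q] to the inverse of [Q]
    is a cocycle with values in [GL_m]; writing it as a coboundary of [g] makes
    [tau] invert the conjugate of [Q] by [g]. *)
Lemma sym_exists b Q : Her tau m b -> unitary tau (beta' b) Q -> regular_mx Q ->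
  exists2 g, g \in unitmx &
    sym_space tau n (invmx (embed1 g) *m Q *m embed1 g).
Proof.
move=> hb [uQ eQ] hQ; have uB := beta'_unit hb hb0; have ub := b0_unit k hb0.
have uQ' : invmx Q \in unitmx by rewrite unitmx_inv.
have eB : beta' b *m invmx Q = (cj Q)^T *m beta' b by rewrite -{1}eQ mulmxK.
have hp : char_poly (cj Q) = char_poly (invmx Q).
  by rewrite -char_poly_trmx (char_poly_intertw uB eB).
have uK : krylov (cj Q) e0 \in unitmx.
  by rewrite -{1}cj_e0 -map_krylov rmap_unitmx // regular_krylov.
have uK' : krylov (invmx Q) e0 \in unitmx.
  have : beta' b *m krylov (invmx Q) e0 \in unitmx.
    rewrite (intertw_krylov _ eB) beta'_e0 krylov_scale // -{1}cj_e0 map_trmx.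
    by rewrite -map_krylov rmap_unitmx // regular_krylov_tr.
  by rewrite unitmx_mul => /andP[].
have [C [uC CQ Ce]] := intertw_exists hp uK uK'.
have scI (M N : 'M[k]_1) : b0%:A *: M = b0%:A *: N -> M = N.
  by move=> /(congr1 (GRing.scale (b0%:A)^-1)); rewrite !scalerA mulVr // !scale1r.
have CTe : C^T *m e0 = e0.
  apply: trmx_inj; rewrite trmx_mul trmxK.
  apply: (intertw_row uK CQ Ce) => i; apply: scI.
  rewrite scalemxAl -linearZ /= -(beta'_tr_e0 b) trmx_mul trmxK.
  rewrite -mulmxA (mulmxA _ _ e0) (intertw_exp _ eB) -(mulmxA _ _ e0) beta'_e0.
  rewrite -!scalemxAr; congr (_ *: _).
  by rewrite -[LHS]trmx11 -trmx_exp !trmx_mul !trmxK mulmxA.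
have CcC : C *m cj C = 1%:M.
  apply: (regular_commute hQ); last by rewrite -mulmxA -{1}cj_e0 -map_mxM Ce cj_e0.
  have e1 : Q *m C = C *m cj (invmx Q).
    rewrite rmap_invmx //; apply: (can_inj (mulmxK (rmap_unitmx tau uQ))).
    by rewrite mulmxKV ?rmap_unitmx // -mulmxA CQ mulKVmx.
  by rewrite [RHS]mulmxA e1 -!mulmxA -map_mxM -CQ map_mxM cjK.
have eC := fix_e0_embed1 Ce CTe; set c := ulsubmx C in eC.
have [|g ug eg] := @hilbert90 c.
  by apply: (@embed1_inj _ k); rewrite -embed1_mul -map_embed1 -eC CcC embed1_1.
exists g => //; set G := embed1 g.
have uG : G \in unitmx by rewrite embed1_unit.
have eG : G = C *m cj G by rewrite /G {1}eg -embed1_mul -eC map_embed1.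
split; first by rewrite !unitmx_mul unitmx_inv uG uQ.
have ucG := rmap_unitmx tau uG.
rewrite !map_mxM rmap_invmx // -!mulmxA.
apply: (can_inj (mulKmx uG)); rewrite mulmx1 mulKVmx //.
have -> : G *m (invmx (cj G) *m (cj Q *m cj G)) = C *m cj Q *m cj G.
  by rewrite {1}eG -[LHS]mulmxA mulKVmx // mulmxA.
by rewrite CQ mulmxA mulKVmx // -eG.
Qed.

Lemma unitary_conj N (J G Q : 'M[k]_N) : G \in unitmx -> unitary tau J Q ->
  unitary tau ((cj G)^T *m J *m G) (invmx G *m Q *m G).
Proof.
move=> uG [uQ eQ]; split; first by rewrite !unitmx_mul unitmx_inv uG uQ.
have e : (cj (invmx G))^T *m (cj G)^T = 1%:M.
  by rewrite -trmx_mul -map_mxM mulmxV // map_mx1 trmx1.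
rewrite !map_mxM !trmx_mul !mulmxA -(mulmxA _ (cj (invmx G))^T) e mulmx1.
rewrite -(mulmxA _ G (invmx G)) mulmxV // mulmx1.
by rewrite -[in RHS]eQ !mulmxA.
Qed.

Lemma conj_embedP g P Q : g \in unitmx ->
  P = invmx (embed1 g) *m Q *m embed1 g <-> embed1 g *m P = Q *m embed1 g.
Proof.
move=> ug; have uG : embed1 g \in unitmx by rewrite embed1_unit.
by split=> [->|e]; rewrite -?mulmxA ?mulKVmx // -e mulKmx.
Qed.

Lemma conj_unitary_form g b P Q : g \in unitmx -> embed1 g *m P = Q *m embed1 g ->
  unitary tau (beta' b) Q -> unitary tau (beta' ((cj g)^T *m b *m g)) P.
Proof.
move=> ug e hQ; rewrite -beta'_conj ((conj_embedP P Q ug).2 e).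
by apply: unitary_conj; rewrite // embed1_unit.
Qed.

Lemma similar_herm_Her b g : g \in unitmx -> Her tau m b ->
  Her tau m ((cj g)^T *m b *m g).
Proof.
move=> ug [ub eb]; split.
  by rewrite !unitmx_mul unitmx_tr rmap_unitmx // ub ug.
by rewrite !map_mxM !trmx_mul eb -map_trmx cjK // trmxK mulmxA.
Qed.

(** Applying [tau] and inverting shows that [tau g] conjugates the two elements
    as well, so [tau g = g] because both embed to matrices fixing [e0]. *)
Lemma conj_rational g P P' : sym_space tau n P -> sym_space tau n P' ->
  regular_mx P' -> g \in unitmx -> embed1 g *m P' = P *m embed1 g ->
  exists2 x : 'M[k']_m, x \in unitmx & g = map_mx (in_alg k) x.
Proof.
move=> [uP sP] [uP' sP'] hP' ug e.
have cg : cj g = g.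
  apply: (@embed1_inj _ k); rewrite -map_embed1.
  apply: (@intertw_uniq _ _ P' P _ _ e0) => //.
  - exact: regular_krylov.
  - have e1 : cj (embed1 g) *m cj P' = cj P *m cj (embed1 g) by rewrite -!map_mxM e.
    have ccP' : cj P' *m P' = 1%:M by apply: mulmx1C.
    by rewrite -[LHS]mul1mx -sP -[LHS]mulmxA (mulmxA _ _ P') -e1 -mulmxA ccP' mulmx1.
  - by rewrite map_embed1 !embed1_e0.
have eg : g = map_mx (in_alg k) (map_mx l1 g).
  apply/matrixP => i j; rewrite !mxE; apply: (tau_fixed hbas ua).
  by have /matrixP /(_ i j) := cg; rewrite mxE.
exists (map_mx l1 g) => //; rewrite unitmxE unitfE.
move: ug; rewrite {1}eg unitmxE det_map_mx; apply: contraTneq => ->.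
by rewrite rmorph0 unitr0.
Qed.

End Matching.

(** * The matching of orbits *)

Section Bijection.
Variables (k' : fieldType) (k : comUnitAlgType k') (tau : {lrmorphism k -> k}).
Hypothesis htauK : involutive tau.
Hypothesis htest : tested_by_fields k.
Hypothesis hinf : no_finite_cover k'.
Variables (a : k) (l1 l2 : {scalar k}).
Hypothesis hbas : quadratic_basis a l1 l2.
Hypothesis ua : a - tau a \is a GRing.unit.
Variables (b0 : k') (m r : nat).
Hypothesis hb0 : b0 != 0.
Local Notation n := (r + (m + 1 + r))%N.
Local Notation cj := (map_mx tau).
Local Notation "g ^k" := (map_mx (in_alg k) g) (at level 2, format "g ^k").
Implicit Types (t : 'I_r -> k) (P Q : 'M[k]_(m + 1)) (z : 'M[k]_n) (b g : 'M[k]_m).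

Definition conjugate g P Q := embed1 g *m P = Q *m embed1 g.

Lemma conjugate_mul g h P Q R : conjugate g P Q -> conjugate h Q R ->
  conjugate (h *m g) P R.
Proof.
rewrite /conjugate -embed1_mul => e1 e2.
by rewrite -mulmxA e1 mulmxA e2 mulmxA.
Qed.

Lemma conjugate_inv g P Q : g \in unitmx -> conjugate g P Q ->
  conjugate (invmx g) Q P.
Proof.
move=> ug e; have uG : embed1 g \in unitmx by rewrite embed1_unit.
rewrite /conjugate -embed1_inv //; apply: (can_inj (mulKmx uG)).
by rewrite mulKVmx // mulmxA e mulmxK.
Qed.

Lemma orbit_S_P z t P : normal_form_S tau z t P -> forall z',
  orbit_S tau z z' <-> exists2 g : 'M[k']_m, g \in unitmx &
     exists2 P', normal_form_S tau z' t P' & conjugate g^k P' P.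
Proof.
move=> h z'; rewrite (orbit_S_nf h); split=> -[g ug].
  move=> h'; exists g => //; eexists; first exact: h'.
  by apply/(conj_embedP _ _ (rmap_unitmx (in_alg k) ug)).
case=> P' h' /(conj_embedP _ _ (rmap_unitmx (in_alg k) ug)) e.
by exists g => //; rewrite -e.
Qed.

Lemma orbit_U_P b z t P : normal_form_U tau b0 b z t P -> forall z',
  orbit_U tau b0 b z z' <-> exists2 g, unitary tau b g &
     exists2 P', normal_form_U tau b0 b z' t P' & conjugate g P' P.
Proof.
move=> h z'; rewrite (orbit_U_nf h); split=> -[g ug].
  move=> h'; exists g => //; eexists; first exact: h'.
  by apply/(conj_embedP _ _ ug.1).
case=> P' h' /(conj_embedP _ _ ug.1) e.
by exists g => //; rewrite -e.
Qed.

Lemma orbit_S_eq z z' t P P' (g' : 'M[k']_m) : normal_form_S tau z t P ->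
  normal_form_S tau z' t P' -> g' \in unitmx -> conjugate g'^k P' P ->
  orbit_S tau z = orbit_S tau z'.
Proof.
move=> h h' ug e; have ugk := rmap_unitmx (in_alg k) ug.
apply/seteqP; split=> x.
  move=> /(orbit_S_P h)[g0 ug0 [R hR eR]]; apply/(orbit_S_P h').
  exists (invmx g' *m g0); first by rewrite unitmx_mul unitmx_inv ug.
  exists R => //; rewrite map_mxM rmap_invmx //.
  exact: conjugate_mul eR (conjugate_inv ugk e).
move=> /(orbit_S_P h')[g0 ug0 [R hR eR]]; apply/(orbit_S_P h).
exists (g' *m g0); first by rewrite unitmx_mul ug.
by exists R => //; rewrite map_mxM; exact: conjugate_mul eR e.
Qed.

Lemma orbit_U_eq b z z' t P P' g : normal_form_U tau b0 b z t P ->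
  normal_form_U tau b0 b z' t P' -> unitary tau b g -> conjugate g P' P ->
  orbit_U tau b0 b z = orbit_U tau b0 b z'.
Proof.
move=> h h' ug e; apply/seteqP; split=> x.
  move=> /(orbit_U_P h)[g0 ug0 [R hR eR]]; apply/(orbit_U_P h').
  exists (invmx g *m g0); first exact/unitary_mul/ug0/unitary_inv.
  by exists R => //; exact: conjugate_mul eR (conjugate_inv ug.1 e).
move=> /(orbit_U_P h')[g0 ug0 [R hR eR]]; apply/(orbit_U_P h).
exists (g *m g0); first exact/unitary_mul/ug0.
by exists R => //; exact: conjugate_mul eR e.
Qed.

Lemma conjugate1 P : conjugate 1%:M P P.
Proof. by rewrite /conjugate embed1_1 mul1mx mulmx1. Qed.

Lemma orbit_S_refl z t P : normal_form_S tau z t P -> orbit_S tau z z.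
Proof.
move=> h; apply/(orbit_S_P h); exists 1%:M; first exact: unitmx1.
by exists P => //; rewrite map_mx1; exact: conjugate1.
Qed.

Lemma orbit_U_refl b z t P : normal_form_U tau b0 b z t P -> orbit_U tau b0 b z z.
Proof.
move=> h; apply/(orbit_U_P h); exists 1%:M; first exact: unitary1.
by exists P => //; exact: conjugate1.
Qed.

Lemma matchesP b z zb : matches tau b0 b z zb <->
  exists t P Q g, [/\ normal_form_S tau z t P, normal_form_U tau b0 b zb t Q,
    g \in unitmx & conjugate g P Q].
Proof.
split=> [[t [P [tb [Q [h h' et [g ug e]]]]]]|[t [P [Q [g [h h' ug e]]]]]].
  have {}et : t = tb by apply: funext.
  rewrite -et in h'; exists t, P, Q, g; split=> //.
  exact/(conj_embedP _ _ ug).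
by exists t, P, t, Q; split=> //; exists g => //; apply/(conj_embedP _ _ ug).
Qed.

Lemma S_reg_nf z t P : S_reg tau m r z -> normal_form_S tau z t P -> regular_mx P.
Proof.
move=> /S_regP[_ [t' [P' [h' hP]]]] h.
by have [_ ->] := normal_form_S_unique h h'.
Qed.

Lemma normal_S_reg t P : (forall i, t i \is a GRing.unit) ->
  sym_space tau (m + 1) P -> regular_mx P ->
  normal_form_S tau (normal_mx tau t P) t P /\ S_reg tau m r (normal_mx tau t P).
Proof.
move=> ut sP hP.
have h : normal_form_S tau (normal_mx tau t P) t P.
  apply/normal_form_SP; split=> //; exists 1%:M; first exact: upU1.
  by rewrite map_mx1 mul1mx mulmx1.
split=> //; apply/S_regP; split; last by exists t, P.
exact: normal_sym.
Qed.

Lemma normal_U_reg b t P : (forall i, t i \is a GRing.unit) ->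
  unitary tau (beta' b0 b) P -> regular_mx P ->
  normal_form_U tau b0 b (normal_mx tau t P) t P
  /\ U_reg tau b0 r b (normal_mx tau t P).
Proof.
move=> ut sP hP.
have h : normal_form_U tau b0 b (normal_mx tau t P) t P.
  apply/normal_form_UP; split=> //; exists 1%:M, 1%:M.
  by split; [exact: unip'_1 | exact: unip'_1 | rewrite mul1mx mulmx1].
split=> //; apply/U_regP; split; last by exists t, P.
exact: normal_unitary.
Qed.

Variable B : set 'M[k]_m.
Hypothesis hB : herm_representatives tau B.

(** The form attached to the central block of [z] is similar to one of the chosen
    representatives [b]; the similarity conjugates the block into the unitary
    group of [b]. *)
Lemma match_of_S z : S_reg tau m r z ->
  exists b zb, [/\ B b, U_reg tau b0 r b zb & matches tau b0 b z zb].
Proof.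
move=> hz; have [sz [t [P [h hP]]]] := (S_regP tau z).1 hz.
have [ut sP _] := h.
have [b1 [hb1 uP]] := form_exists hb0 sP hP.
have [b [[Bb [g ug eb]] _]] := hB.2 b1 hb1.
have ug' : invmx g \in unitmx by rewrite unitmx_inv.
pose Q := invmx (embed1 (invmx g)) *m P *m embed1 (invmx g).
have cQ : conjugate (invmx g) Q P by apply/(conj_embedP _ _ ug').
have eb' : b = (cj (invmx g))^T *m b1 *m invmx g.
  rewrite eb !mulmxA -trmx_mul -map_mxM mulmxV // map_mx1 trmx1 mul1mx.
  by rewrite mulmxK.
have uQ : unitary tau (beta' b0 b) Q.
  by rewrite eb'; apply: (conj_unitary_form ug' cQ).
have [hQ hzb] := normal_U_reg ut uQ (regular_conj htest ug' hP).
exists b, (normal_mx tau t Q); split=> //; apply/matchesP.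
exists t, P, Q, g; split=> //.
by have := conjugate_inv ug' cQ; rewrite invmxK.
Qed.

Lemma match_of_U b zb : Her tau m b -> U_reg tau b0 r b zb ->
  exists z, S_reg tau m r z /\ matches tau b0 b z zb.
Proof.
move=> hb hz; have [sz [t [Q [h hQ]]]] := (U_regP tau b0 b zb).1 hz.
have [ut uQ _] := h.
have [g ug sP] := sym_exists htauK htest hinf ua hb0 hb uQ hQ.
have [hP hzP] := normal_S_reg ut sP (regular_conj htest ug hQ).
eexists; split; first exact: hzP.
apply/matchesP; exists t; eexists; exists Q, g; split=> //; first exact: hP.
exact/(conj_embedP _ _ ug).
Qed.

(** Both forms, transported to the central block of [z'], are the form attached
    to it. So [b] and [b'] are similar, hence equal, and the conjugating matrix
    is unitary. *)
Lemma matches_orbit_U b b' z z' zb zb' : S_reg tau m r z' ->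
  B b -> B b' ->
  matches tau b0 b z zb -> matches tau b0 b' z' zb' ->
  orbit_S tau z = orbit_S tau z' ->
  b = b' /\ orbit_U tau b0 b zb = orbit_U tau b0 b' zb'.
Proof.
move=> hz' Bb Bb' /matchesP[t [P [Q [g [h hQ ug e]]]]].
move=> /matchesP[t' [P' [Q' [g' [h' hQ' ug' e']]]]] eO.
have : orbit_S tau z z' by rewrite eO; exact: (orbit_S_refl h').
move=> /(orbit_S_P h)[x ux [P'' h'' ex]].
have [et eP] := normal_form_S_unique h'' h'.
rewrite {}eP in ex h'' => {P''}.
have ug1 : g *m x^k \in unitmx by rewrite unitmx_mul ug rmap_unitmx.
have e1 := conjugate_mul ex e.
have [_ sP' _] := h'; have [_ uQ _] := hQ; have [_ uQ' _] := hQ'.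
have eb := form_unique sP' (S_reg_nf hz' h') (conj_unitary_form ug1 e1 uQ)
  (conj_unitary_form ug' e' uQ').
have hbeta := similar_herm_Her htauK ug1 (hB.1 _ Bb).
have [b1 [_ ub1]] := hB.2 _ hbeta.
have bb' : b = b'.
  rewrite -(ub1 b) ?(ub1 b') //; first by split=> //; exists g'.
  by split=> //; exists (g *m x^k).
split=> //; rewrite -bb' in eb hQ' *.
set h1 := g *m x^k in ug1 e1 eb.
have ug'' : invmx g' \in unitmx by rewrite unitmx_inv.
rewrite -et in hQ'.
apply: (orbit_U_eq hQ hQ' _ (conjugate_mul (conjugate_inv ug' e') e1)).
split; first by rewrite unitmx_mul ug1.
have -> : (cj (h1 *m invmx g'))^T *m b *m (h1 *m invmx g') =
    (cj (invmx g'))^T *m ((cj h1)^T *m b *m h1) *m invmx g'.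
  by rewrite map_mxM trmx_mul !mulmxA.
rewrite eb !mulmxA -trmx_mul -map_mxM mulmxV // map_mx1 trmx1 mul1mx.
by rewrite mulmxK.
Qed.

(** The central blocks of [z] and [z'] are conjugate over [k], hence over
    [k']. *)
Lemma matches_orbit_S b z z' zb zb' : S_reg tau m r z' ->
  matches tau b0 b z zb -> matches tau b0 b z' zb' ->
  orbit_U tau b0 b zb = orbit_U tau b0 b zb' -> orbit_S tau z = orbit_S tau z'.
Proof.
move=> hz' /matchesP[t [P [Q [g [h hQ ug e]]]]].
move=> /matchesP[t' [P' [Q' [g' [h' hQ' ug' e']]]]] eO.
have : orbit_U tau b0 b zb zb' by rewrite eO; exact: (orbit_U_refl hQ').
move=> /(orbit_U_P hQ)[y uy [Q'' hQ'' ey]].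
have [et eQ] := normal_form_U_unique hQ'' hQ'.
rewrite {}eQ -{}et in ey hQ'' h' hQ' => {Q''}.
have [_ sP _] := h; have [_ sP' _] := h'.
have uh : invmx g *m (y *m g') \in unitmx.
  by rewrite !unitmx_mul unitmx_inv ug uy.1.
have eh := conjugate_mul (conjugate_mul e' ey) (conjugate_inv ug e).
have [x ux ex] := conj_rational hbas ua sP sP' (S_reg_nf hz' h') uh eh.
by rewrite ex in eh; exact: (orbit_S_eq h h' ux eh).
Qed.

Lemma matches_orbits b z z' zb zb' : S_reg tau m r z -> U_reg tau b0 r b zb ->
  matches tau b0 b z' zb' ->
  orbit_S tau z = orbit_S tau z' -> orbit_U tau b0 b zb = orbit_U tau b0 b zb' ->
  matches tau b0 b z zb.
Proof.
move=> /S_regP[_ [t1 [P1 [h1 _]]]] /U_regP[_ [t2 [Q1 [h2 _]]]].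
move=> /matchesP[t [P [Q [g [h hQ ug e]]]]] eS eU.
have : orbit_S tau z' z by rewrite -eS; exact: (orbit_S_refl h1).
move=> /(orbit_S_P h)[x ux [P'' hP'' ex]].
have : orbit_U tau b0 b zb' zb by rewrite -eU; exact: (orbit_U_refl h2).
move=> /(orbit_U_P hQ)[y uy [Q'' hQ'' ey]].
apply/matchesP; exists t, P'', Q'', (invmx y *m (g *m x^k)); split=> //.
  by rewrite !unitmx_mul unitmx_inv uy.1 ug rmap_unitmx.
exact: conjugate_mul (conjugate_mul ex e) (conjugate_inv uy.1 ey).
Qed.

(** Matching depends on the orbits only, and as a relation between orbits it is
    total and single-valued in both directions. *)
Lemma matching_bijection :
  exists N : set 'M[k]_n -> 'M[k]_m * set 'M[k]_n,
    set_bij (S_orbits tau m r) (U_orbits tau b0 r B) N /\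
    (forall z b zb, S_reg tau m r z -> B b -> U_reg tau b0 r b zb ->
      (N (orbit_S tau z) = (b, orbit_U tau b0 b zb) <-> matches tau b0 b z zb)).
Proof.
pose rel O (p : 'M[k]_m * set 'M[k]_n) := exists z b zb,
  [/\ S_reg tau m r z, B b, U_reg tau b0 r b zb, matches tau b0 b z zb
    & O = orbit_S tau z /\ p = (b, orbit_U tau b0 b zb)].
have [N hN] : {N & forall O, S_orbits tau m r O -> rel O (N O)}.
  apply: (choice (P := fun O p => S_orbits tau m r O -> rel O p)) => O.
  have [[z hz <-]|no] := pselect (S_orbits tau m r O).
    have [b [zb [Bb hzb hm]]] := match_of_S hz.
    by exists (b, orbit_U tau b0 b zb) => _; exists z, b, zb.
  by exists (0, set0).
have inS z : S_reg tau m r z -> S_orbits tau m r (orbit_S tau z) by exists z.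
have key z b zb : S_reg tau m r z -> B b -> U_reg tau b0 r b zb ->
    (N (orbit_S tau z) = (b, orbit_U tau b0 b zb) <-> matches tau b0 b z zb).
  move=> hz Bb hzb; have [z1 [b1 [zb1 [hz1 Bb1 hzb1 hm [eO ->]]]]] := hN _ (inS _ hz).
  split=> [[eb eU]|hm'].
    by rewrite eb in hm eU; exact: (matches_orbits hz hzb hm eO (esym eU)).
  by have [-> ->] := matches_orbit_U hz1 Bb Bb1 hm' hm eO.
exists N; split=> //; split.
- move=> O hO; have [z [b [zb [hz Bb hzb hm [_ ->]]]]] := hN _ hO.
  by split=> //; exists zb.
- move=> O O' /set_mem[z hz <-] /set_mem[z' hz' <-].
  have [z1 [b1 [zb1 [hz1 Bb1 hzb1 hm1 [-> ->]]]]] := hN _ (inS _ hz).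
  have [z2 [b2 [zb2 [hz2 Bb2 hzb2 hm2 [-> ->]]]]] := hN _ (inS _ hz').
  move=> [eb eU]; rewrite -eb in hm2 eU.
  exact: (matches_orbit_S hz2 hm1 hm2 eU).
- move=> [b O] [/= Bb [zb hzb <-]].
  have [z [hz hm]] := match_of_U (hB.1 _ Bb) hzb.
  by exists (orbit_S tau z); [exact: inS | apply/key].
Qed.

End Bijection.

Theorem proposition4p11 (k' : fieldType) (k : comUnitAlgType k')
    (tau : {lrmorphism k -> k}) (b0 : k') (m r : nat)
    (hk' : number_field k' \/ local_field k')
    (hk : separable_quadratic k)
    (htauK : involutive tau) (htau1 : exists x : k, tau x != x)
    (hb0 : b0 != 0) :
  (forall B : set 'M[k]_m, herm_representatives tau B ->
     exists N : set 'M[k]_(r + (m + 1 + r)) ->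
                'M[k]_m * set 'M[k]_(r + (m + 1 + r)),
       set_bij (S_orbits tau m r) (U_orbits tau b0 r B) N /\
       (forall z b zb, S_reg tau m r z -> B b -> U_reg tau b0 r b zb ->
          (N (orbit_S tau z) = (b, orbit_U tau b0 b zb)
             <-> matches tau b0 b z zb)))
  /\
  ([/\ S_reg tau m r !=set0,
       zariski_open (sym_space tau (r + (m + 1 + r))) (S_reg tau m r)
     & forall z, S_reg tau m r z ->
         [set h | H_S m r h /\ act_S tau z h = z] = [set (1%:M, 1%:M)]]
   /\
   (forall b, Her tau m b ->
    [/\ U_reg tau b0 r b !=set0,
        zariski_open (unitary_n tau b0 r b) (U_reg tau b0 r b)
      & forall z, U_reg tau b0 r b z ->
          [set h | H_U tau b0 b h /\ act_U z h = z] = [set (1%:M, 1%:M)]])).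
Proof.
have hinf : no_finite_cover k'.
  by case: hk' => [/number_field_infinite|/local_field_infinite].
have htest := quadratic_tested hk.
have [a [l1 [l2 [hbas ua]]]] := quadratic_has_basis htauK htau1 hk.
split; first by move=> B hB; apply: (matching_bijection htauK htest hinf hbas ua).
split=> [|b hb]; split.
- have [P [sP hP]] := exists_regular_sym htauK htest hinf m ua.
  exists (normal_mx tau (fun=> 1) P).
  by have [] := @normal_S_reg _ _ tau htauK m r (fun=> 1) P (fun=> unitr1 _) sP hP.
- have := zariski_open_cell htauK htest hbas ua (sym_space tau (r + (m + 1 + r))).
  congr zariski_open; apply/seteqP; split=> z; first by move=> h; apply/S_reg_cell.
  by move=> /(S_reg_cell htauK).
- exact: stabilizer_S.
- have [P [sP hP]] := exists_regular_unitary htauK htest hinf ua hb0 hb.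
  exists (normal_mx tau (fun=> 1) P).
  by have [] := @normal_U_reg _ _ tau htauK b0 m r b (fun=> 1) P (fun=> unitr1 _) sP hP.
- have := zariski_open_cell htauK htest hbas ua (unitary_n tau b0 r b).
  congr zariski_open; apply/seteqP; split=> z; first by move=> h; apply/U_reg_cell.
  by move=> /(U_reg_cell htauK hb hb0).
- exact: stabilizer_U.
Qed.
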